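(* There is a finite first-order language $L$ such that for every $\Pi^1_1$ set $B\subseteq\omega$ there is a Turing reduction of $B$ to the set $3Mod_L$ of all indexes of decidable Ehrenfeucht $L$-theories with exactly three countable models.
   Context: An Ehrenfeucht theory is a complete first-order theory with finitely many (but more than one) countable models up to isomorphism; ''exactly three countable models'' is meant up to isomorphism. $(\varphi_e)_{e\in\omega}$ is a standard enumeration of the unary partial computable functions, $\mathrm{sgn}(x)=1$ for $x\ne 0$ and $\mathrm{sgn}(0)=0$. A Gödel numbering of the sentences of the finite language $L$ is fixed. A number $e$ is an index of a decidable complete $L$-theory $T$ if $\mathrm{sgn}(\varphi_e(x))$ is total and is the characteristic function of the set of Gödel numbers of the sentences of $T$. Thus $3Mod_L\subseteq\omega$ is the set of all $e$ that are indexes of decidable complete $L$-theories having exactly three countable models up to isomorphism. *)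

(* Defs.v *)
From mathcomp Require Import all_boot.
From Stdlib Require Cantor.

Set Implicit Arguments.
Unset Strict Implicit.
Unset Printing Implicit Defensive.

(** * First-order logic with equality over finite languages *)

(* The symbols are numbered: the function symbols of [L] are the ordinals
   below [size (fun_arities L)], and likewise for the relation symbols.
   Constants are function symbols of arity 0. *)
Record language : Type :=
  Language { fun_arities : seq nat; rel_arities : seq nat }.

Definition fsym (L : language) := 'I_(size (fun_arities L)).
Definition rsym (L : language) := 'I_(size (rel_arities L)).
Definition far (L : language) (f : fsym L) : nat := nth 0 (fun_arities L) f.
Definition rar (L : language) (r : rsym L) : nat := nth 0 (rel_arities L) r.

(* Variables are named by natural numbers (no de Bruijn convention). *)
Inductive term (L : language) : Type :=
| Var of nat
| App (f : fsym L) of {ffun 'I_(far f) -> term L}.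

(* The other connectives and the universal quantifier are the usual classical
   abbreviations. *)
Inductive formula (L : language) : Type :=
| Equal of term L & term L
| Rel (r : rsym L) of {ffun 'I_(rar r) -> term L}
| Not of formula L
| And of formula L & formula L
| Ex of nat & formula L.

Fixpoint occurs (L : language) (n : nat) (t : term L) : bool :=
  match t with
  | Var m => n == m
  | App f a => [exists i, occurs n (a i)]
  end.

Fixpoint free_in (L : language) (n : nat) (phi : formula L) : bool :=
  match phi with
  | Equal t u => occurs n t || occurs n u
  | Rel r a => [exists i, occurs n (a i)]
  | Not p => free_in n p
  | And p q => free_in n p || free_in n q
  | Ex m p => (n != m) && free_in n p
  end.

Definition sentence (L : language) (phi : formula L) : Prop :=
  forall n, ~~ free_in n phi.

Record structure (L : language) : Type := Structure {
  dom :> Type;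
  dom_inhabited : inhabited dom;
  fint : forall f : fsym L, (far f).-tuple dom -> dom;
  rint : forall r : rsym L, (rar r).-tuple dom -> Prop
}.

Fixpoint teval (L : language) (M : structure L) (v : nat -> M) (t : term L)
    : M :=
  match t with
  | Var n => v n
  | App f a => fint [tuple teval v (a i) | i < far f]
  end.

Definition update (A : Type) (v : nat -> A) (n : nat) (a : A) : nat -> A :=
  fun m => if m == n then a else v m.

Fixpoint sat (L : language) (M : structure L) (v : nat -> M) (phi : formula L)
    : Prop :=
  match phi with
  | Equal t u => teval v t = teval v u
  | Rel r a => rint [tuple teval v (a i) | i < rar r]
  | Not p => ~ sat v p
  | And p q => sat v p /\ sat v q
  | Ex n p => exists a : M, sat (update v n a) p
  end.

Definition holds (L : language) (M : structure L) (phi : formula L) : Prop :=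
  forall v : nat -> M, sat v phi.

(** * Theories and their countable models *)

Definition model (L : language) (T : formula L -> Prop) (M : structure L)
    : Prop :=
  forall phi, T phi -> holds M phi.

(* A complete theory is a satisfiable set of sentences, closed under logical
   consequence, that decides every sentence. *)
Definition complete_theory (L : language) (T : formula L -> Prop) : Prop :=
  [/\ forall phi, T phi -> sentence phi,
      exists M : structure L, model T M,
      forall phi, sentence phi ->
        (forall M : structure L, model T M -> holds M phi) -> T phi
    & forall phi, sentence phi -> T phi \/ T (Not phi)].

Definition isomorphic (L : language) (M N : structure L) : Prop :=
  exists h : M -> N,
    [/\ bijective h,
        forall (f : fsym L) (a : (far f).-tuple M),
          h (fint a) = fint (map_tuple h a)
      & forall (r : rsym L) (a : (rar r).-tuple M),
          rint a <-> rint (map_tuple h a)].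

(* Finite structures count as countable. *)
Definition countable_structure (L : language) (M : structure L) : Prop :=
  exists code : M -> nat, injective code.

Definition has_exactly_countable_models (L : language) (T : formula L -> Prop)
    (n : nat) : Prop :=
  exists M : 'I_n -> structure L,
    [/\ forall i, countable_structure (M i) /\ model T (M i),
        forall i j, isomorphic (M i) (M j) -> i = j
      & forall N : structure L, countable_structure N -> model T N ->
          exists i, isomorphic N (M i)].

Definition ehrenfeucht (L : language) (T : formula L -> Prop) : Prop :=
  complete_theory T /\ exists2 n, 1 < n & has_exactly_countable_models T n.

(** * Gödel numbering *)

Definition cpair (x y : nat) : nat := Cantor.to_nat (x, y).

Definition seq_code (s : seq nat) : nat :=
  foldr (fun x c => (cpair x c).+1) 0 s.

Fixpoint term_code (L : language) (t : term L) : nat :=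
  match t with
  | Var n => cpair 0 n
  | App f a =>
      cpair 1 (cpair f (seq_code [seq term_code (a i) | i <- enum 'I_(far f)]))
  end.

Fixpoint goedel (L : language) (phi : formula L) : nat :=
  match phi with
  | Equal t u => cpair 0 (cpair (term_code t) (term_code u))
  | Rel r a =>
      cpair 1 (cpair r (seq_code [seq term_code (a i) | i <- enum 'I_(rar r)]))
  | Not p => cpair 2 (goedel p)
  | And p q => cpair 3 (cpair (goedel p) (goedel q))
  | Ex n p => cpair 4 (cpair n (goedel p))
  end.

Definition goedel_set (L : language) (T : formula L -> Prop) (x : nat) : Prop :=
  exists2 phi, T phi & goedel phi = x.

(** * (Relative) computability *)

(* Programs for the unary partial functions computable from an oracle; tuples
   of arguments are coded by the Cantor pairing. *)
Inductive prog : Type :=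
| Zero
| Succ
| Fst
| Snd
| Oracle
| Pair of prog & prog
| Comp of prog & prog
| Prec of prog & prog
| Min of prog.

Fixpoint prog_code (p : prog) : nat :=
  match p with
  | Zero => cpair 0 0
  | Succ => cpair 1 0
  | Fst => cpair 2 0
  | Snd => cpair 3 0
  | Oracle => cpair 4 0
  | Pair p q => cpair 5 (cpair (prog_code p) (prog_code q))
  | Comp p q => cpair 6 (cpair (prog_code p) (prog_code q))
  | Prec p q => cpair 7 (cpair (prog_code p) (prog_code q))
  | Min p => cpair 8 (prog_code p)
  end.

(* Partial functions are represented by their graphs. *)
Definition char_fun (A : nat -> Prop) (x y : nat) : Prop :=
  (A x /\ y = 1) \/ (~ A x /\ y = 0).

Fixpoint prec_graph (F G : nat -> nat -> Prop) (a n y : nat) : Prop :=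
  if n is m.+1
  then exists2 z, prec_graph F G a m z & G (cpair a (cpair m z)) y
  else F a y.

(* [Min p] maps x to the least y with p<x,y> = 0, all the values p<x,m> for
   m < y being required to be defined. *)
Fixpoint run (A : nat -> Prop) (p : prog) (x y : nat) : Prop :=
  match p with
  | Zero => y = 0
  | Succ => y = x.+1
  | Fst => y = (Cantor.of_nat x).1
  | Snd => y = (Cantor.of_nat x).2
  | Oracle => char_fun A x y
  | Pair p q => exists u v, [/\ run A p x u, run A q x v & y = cpair u v]
  | Comp p q => exists2 z, run A q x z & run A p z y
  | Prec p q =>
      prec_graph (run A p) (run A q)
        (Cantor.of_nat x).1 (Cantor.of_nat x).2 y
  | Min p =>
      run A p (cpair x y) 0 /\
      forall m, m < y -> exists k, run A p (cpair x m) k.+1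
  end.

(* The e-th function computable from the oracle A; it is nowhere defined when e
   is not the code of a program. *)
Definition Phi (A : nat -> Prop) (e x y : nat) : Prop :=
  exists2 p, prog_code p = e & run A p x y.

(* The standard enumeration of the unary partial computable functions. *)
Definition varphi (e x y : nat) : Prop := Phi (fun=> False) e x y.

Definition turing_reducible (B A : nat -> Prop) : Prop :=
  exists e, forall x y, Phi A e x y <-> char_fun B x y.

(** * Indexes of theories *)

Definition sgn (x : nat) : nat := if x is 0 then 0 else 1.

Definition index_of (L : language) (e : nat) (T : formula L -> Prop) : Prop :=
  forall x, exists2 y, varphi e x y & char_fun (goedel_set T) x (sgn y).

Definition three_mod (L : language) (e : nat) : Prop :=
  exists T : formula L -> Prop,
    [/\ ehrenfeucht T, has_exactly_countable_models T 3 & index_of e T].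

(** * Lightface Pi^1_1 sets *)

(* The language 0, 1, +, *, <, X of arithmetic with one set variable X. *)
Definition arith : language := Language [:: 0; 0; 2; 2] [:: 2; 1].

Definition arith_fun (f : fsym arith) (a : (far f).-tuple nat) : nat :=
  match val f with
  | 0 => 0
  | 1 => 1
  | 2 => nth 0 a 0 + nth 0 a 1
  | _ => nth 0 a 0 * nth 0 a 1
  end.

Definition arith_rel (X : nat -> Prop) (r : rsym arith)
    (a : (rar r).-tuple nat) : Prop :=
  match val r with
  | 0 => nth 0 a 0 < nth 0 a 1
  | _ => X (nth 0 a 0)
  end.

Definition standard (X : nat -> Prop) : structure arith :=
  @Structure arith nat (inhabits 0) arith_fun (arith_rel X).

(* B is defined in the standard model by a formula [forall X, psi(v_0, X)] with
   psi arithmetical and without other free variables. *)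
Definition pi11 (B : nat -> Prop) : Prop :=
  exists2 psi : formula arith,
    forall n, free_in n psi -> n = 0
    & forall x, B x <->
        forall X : nat -> Prop, @sat arith (standard X) (fun=> x) psi.

(* Main.v *)
(* Let [E m n -> m < n] be a decidable relation, regarded as a tree on the numbers with root 0. The
   colour of a pair (u, v) is the number of [z] with [link z u v], so one ternary relation provides
   infinitely many binary colours. In the structure [std0 E] there is a dense order with levels
   1, 2, 3, ... (the level of [a] is the colour of (a, a)) and, for every finite path from the root
   whose last step is arbitrary, infinitely many elements with pointers to elements of the levels on
   this path.

   The theory of [std0 E] has models with elements of infinite level. If no infinite path starts at
   the root, then every element has finitely many pointers, and a back-and-forth argument shows that
   a countable model is determined by its part of infinite level, which is empty, has a least element,
   or is nonempty without a least element. Along an infinite path there may be an element with infinitely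
   many pointers although the part of infinite level is empty; this gives a fourth countable model.

   The same back-and-forth argument, played with elements of bounded code, shows that a sentence keeps
   its truth value when its quantifiers are restricted to an explicit finite set of elements. So the
   theory is decidable uniformly in [E]. Finally [forall X, psi(x, X)], with psi arithmetical, says
   that a tree computable from [x] has no infinite path: a path consists of a set X together with a
   truth definition for the subformulas of psi that makes psi false, and with witnesses for the true
   existential formulas. *)
From mathcomp Require Import all_boot zify.
From Stdlib Require Import Classical ClassicalEpsilon FunctionalExtensionality ProofIrrelevance.
From Stdlib Require Cantor PropExtensionality.
Require Import Defs.

Set Implicit Arguments.
Unset Strict Implicit.
Unset Printing Implicit Defensive.

(** * Satisfaction, complete theories and the language *)

(** The order with its levels is Ehrenfeucht's classical example of three countable models, the
    levels taking the place of an increasing sequence of constants. A finite language cannot name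
    infinitely many levels or pointer functions, so numbers are expressed as cardinalities: each
    link belongs to a single pair, and a sentence counts links only up to about its rank, beyond
    which every colour looks infinite.

    The obstacle is uniform decidability. By compactness pointers may lead to infinite level. If
    every step of a path had to be an edge of [E], whether a pointer of colour c can lead there
    would depend on c having infinitely many successors, which is not decidable. With the last step
    free, a path may end at any level above its last colour, finite or infinite, and the question
    disappears. The colour of a pointer is the level of its predecessor, so a path can be followed
    from colour 0, and a pointer to infinite level, leaving no finite colour for a next one, ends
    it. *)

Lemma term_ind_ffun (L : language) (P : term L -> Prop) :
  (forall n, P (Var L n)) ->
  (forall f (a : {ffun 'I_(far f) -> term L}), (forall i, P (a i)) -> P (App a)) ->
  forall t, P t.
Proof.
move=> HV HA; fix IH 1 => -[n|f a]; first exact: HV.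
by apply: HA => i; apply: IH.
Qed.

Lemma teval_ext (L : language) (M : structure L) (v w : nat -> M) (t : term L) :
  (forall n, occurs n t -> v n = w n) -> teval v t = teval w t.
Proof.
elim/term_ind_ffun: t => [n|f a IH] /= H; first by apply: H; rewrite eqxx.
congr fint; apply: eq_from_tnth => i; rewrite !tnth_mktuple.
by apply: IH => n Hn; apply: H; apply/existsP; exists i.
Qed.

Lemma sat_ext (L : language) (M : structure L) (phi : formula L) (v w : nat -> M) :
  (forall n, free_in n phi -> v n = w n) -> sat v phi <-> sat w phi.
Proof.
elim: phi v w => [t u|r a|p IH|p IHp q IHq|n p IH] v w /= H.
- by rewrite (@teval_ext L M v w t) ?(@teval_ext L M v w u) // => n Hn; apply: H; rewrite Hn ?orbT.
- suff -> : [tuple teval v (a i) | i < rar r] = [tuple teval w (a i) | i < rar r] by [].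
  apply: eq_from_tnth => i; rewrite !tnth_mktuple.
  by apply: teval_ext => n Hn; apply: H; apply/existsP; exists i.
- by have := IH v w H; tauto.
- have [Hp Hq] : (sat v p <-> sat w p) /\ (sat v q <-> sat w q).
    by split; [apply: IHp|apply: IHq] => n Hn; apply: H; rewrite Hn ?orbT.
  by tauto.
- suff E a : sat (update v n a) p <-> sat (update w n a) p.
    by split=> -[a Ha]; exists a; apply/E.
  apply: IH => m Hm; rewrite /update; case: eqP => // /eqP Hmn.
  by apply: H; rewrite Hmn.
Qed.

Definition Th (L : language) (M : structure L) (phi : formula L) : Prop :=
  sentence phi /\ holds M phi.

Lemma Th_complete (L : language) (M : structure L) : complete_theory (Th M).
Proof.
split=> [phi []//||phi sphi H|phi sphi].
- by exists M => phi [].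
- by split=> //; apply: H => psi [].
- have [v0] : inhabited (nat -> M) by case: (dom_inhabited M) => a; exists => _; exact: a.
  have E (v w : nat -> M) : sat v phi <-> sat w phi by apply: sat_ext => n; rewrite (negbTE (sphi n)).
  have [Hs|Hs] := classic (sat v0 phi); [left|right]; split=> // v.
    exact/(E v0).
  by move=> /= /(E v0).
Qed.

Definition All (L : language) n (p : formula L) := Not (Ex n (Not p)).
Definition Imp (L : language) (p q : formula L) := Not (And p (Not q)).
Definition Or (L : language) (p q : formula L) := Not (And (Not p) (Not q)).

Section Connectives.
Variables (L : language) (M : structure L).
Implicit Types (v : nat -> M) (p q : formula L).

Lemma sat_All v n p : sat v (All n p) <-> forall a, sat (update v n a) p.
Proof.
rewrite /=; split=> [H a|H [a]]; last by apply.
by apply: NNPP => H'; apply: H; exists a.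
Qed.

Lemma sat_Imp v p q : sat v (Imp p q) <-> (sat v p -> sat v q).
Proof. by rewrite /=; have := classic (sat v q); tauto. Qed.

Lemma sat_Or v p q : sat v (Or p q) <-> sat v p \/ sat v q.
Proof. by rewrite /=; have := classic (sat v q); have := classic (sat v p); tauto. Qed.

Lemma sat_And v p q : sat v (And p q) <-> sat v p /\ sat v q.
Proof. by []. Qed.

Lemma sat_Not v p : sat v (Not p) <-> ~ sat v p.
Proof. by []. Qed.

Lemma sat_Ex v n p : sat v (Ex n p) <-> exists a, sat (update v n a) p.
Proof. by []. Qed.

Lemma update_id v n : update v n (v n) = v.
Proof. by apply: functional_extensionality => m; rewrite /update; case: eqP => [->|]. Qed.

Fixpoint alls k (p : formula L) := if k is k'.+1 then alls k' (All k' p) else p.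

Lemma holds_alls k p : holds M (alls k p) <-> holds M p.
Proof.
elim: k p => //= k IH p; rewrite IH; split=> H v.
  by have /sat_All /(_ (v k)) := H v; rewrite update_id.
by apply/sat_All => a; apply: H.
Qed.

End Connectives.

Lemma free_alls (L : language) n k (p : formula L) :
  free_in n (alls k p) = (k <= n) && free_in n p.
Proof.
elim: k p => //= k IH p; rewrite IH /=.
by case: ltngtP => //= _; rewrite andbF.
Qed.

Lemma occurs_bound (L : language) (t : term L) : exists k, forall n, occurs n t -> n < k.
Proof.
elim/term_ind_ffun: t => [m|f a IH].
  by exists m.+1 => n /eqP ->.
have [k Hk] : exists k : 'I_(far f) -> nat, forall i n, occurs n (a i) -> n < k i.
  by exists (fun i => proj1_sig (constructive_indefinite_description _ (IH i))) => i; case: constructive_indefinite_description.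
exists (\max_i k i) => n /= /existsP[i Hi].
exact: leq_trans (Hk i n Hi) (leq_bigmax i).
Qed.

Lemma free_bound (L : language) (p : formula L) : exists k, forall n, free_in n p -> n < k.
Proof.
elim: p => [t u|r a|p [k Hk]|p [k Hk] q [l Hl]|m p [k Hk]].
- have [k Hk] := occurs_bound t; have [l Hl] := occurs_bound u.
  by exists (k + l) => n /= /orP[/Hk|/Hl]; lia.
- have [k Hk] : exists k : 'I_(rar r) -> nat, forall i n, occurs n (a i) -> n < k i.
    by exists (fun i => proj1_sig (constructive_indefinite_description _ (occurs_bound (a i)))) => i; case: constructive_indefinite_description.
  exists (\max_i k i) => n /= /existsP[i Hi].
  exact: leq_trans (Hk i n Hi) (leq_bigmax i).
- by exists k.
- by exists (k + l) => n /= /orP[/Hk|/Hl]; lia.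
- by exists k => n /= /andP[_ /Hk].
Qed.

(** [Th M] contains sentences only, so a formula with free variables is carried over through its
    universal closure over all variables below a bound of the free ones. *)
Lemma transfer (L : language) (M N : structure L) (p : formula L) :
  model (Th M) N -> holds M p -> holds N p.
Proof.
move=> HN Hp; have [k Hk] := free_bound p; apply/(holds_alls N k)/HN; split.
  by move=> n; rewrite free_alls; apply/negP => /andP[H /Hk]; lia.
exact/holds_alls.
Qed.

(** * The language with an order and a ternary link relation *)

Definition L0 : language := Language [::] [:: 2; 3].
Definition rs_lt : rsym L0 := @Ordinal 2 0 isT.
Definition rs_link : rsym L0 := @Ordinal 2 1 isT.

Definition below (N : structure L0) (u v : N) : Prop := @rint L0 N rs_lt [tuple u; v].
Definition link (N : structure L0) (z u v : N) : Prop :=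
  @rint L0 N rs_link [tuple z; u; v].

Definition fLt i j : formula L0 := @Rel L0 rs_lt [ffun k : 'I_2 => Var L0 (nth 0 [:: i; j] k)].
Definition fLink i j k : formula L0 :=
  @Rel L0 rs_link [ffun m : 'I_3 => Var L0 (nth 0 [:: i; j; k] m)].
Definition fEq i j : formula L0 := Equal (Var L0 i) (Var L0 j).

Definition tvar (t : term L0) : nat := if t is Var n then n else 0.

Lemma term_var (t : term L0) : t = Var L0 (tvar t).
Proof. by case: t => // f; case: (ltn_ord f). Qed.

Definition targ (r : rsym L0) (a : {ffun 'I_(rar r) -> term L0}) (i : nat) : nat :=
  if insub i is Some j then tvar (a j) else 0.

Lemma targE (r : rsym L0) (a : {ffun 'I_(rar r) -> term L0}) (i : 'I_(rar r)) :
  targ a i = tvar (a i).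
Proof. by rewrite /targ; case: insubP => [j _ /val_inj ->|]; rewrite ?ltn_ord. Qed.

Lemma rsymP (r : rsym L0) : r = rs_lt \/ r = rs_link.
Proof. by case: r => -[|[|//]] H; [left|right]; apply: val_inj. Qed.

Lemma Rel_lt (a : {ffun 'I_(rar rs_lt) -> term L0}) : Rel a = fLt (targ a 0) (targ a 1).
Proof.
congr Rel; apply/ffunP => i; rewrite ffunE [LHS]term_var; congr Var; rewrite -targE.
by case: i => -[|[|//]].
Qed.

Lemma Rel_link (a : {ffun 'I_(rar rs_link) -> term L0}) :
  Rel a = fLink (targ a 0) (targ a 1) (targ a 2).
Proof.
congr Rel; apply/ffunP => i; rewrite ffunE [LHS]term_var; congr Var; rewrite -targE.
by case: i => -[|[|[|//]]].
Qed.

Lemma formula_ind0 (P : formula L0 -> Prop) :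
  (forall i j, P (fEq i j)) -> (forall i j, P (fLt i j)) -> (forall i j k, P (fLink i j k)) ->
  (forall p, P p -> P (Not p)) -> (forall p q, P p -> P q -> P (And p q)) ->
  (forall n p, P p -> P (Ex n p)) -> forall p, P p.
Proof.
move=> HE HL HW HN HA HX; elim=> //.
- by move=> t u; rewrite (term_var t) (term_var u); apply: HE.
- move=> r a; have [E|E] := rsymP r; subst r; first by rewrite Rel_lt.
  by rewrite Rel_link.
- by move=> p Hp q Hq; apply: HA.
Qed.

Section SatL0.
Variable N : structure L0.
Implicit Types v : nat -> N.

Lemma sat_fEq v i j : sat v (fEq i j) <-> v i = v j.
Proof. by []. Qed.

Lemma sat_fLt v i j : sat v (fLt i j) <-> below (v i) (v j).
Proof.
rewrite /fLt /below /=.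
suff -> : [tuple teval v ([ffun k : 'I_2 => Var L0 (nth 0 [:: i; j] k)] k) | k < rar rs_lt] =
  [tuple v i; v j] by [].
apply: eq_from_tnth => k; rewrite tnth_mktuple ffunE /=.
by case: k => -[|[|//]].
Qed.

Lemma sat_fLink v i j k : sat v (fLink i j k) <-> link (v i) (v j) (v k).
Proof.
rewrite /fLink /link /=.
suff -> : [tuple teval v ([ffun m : 'I_3 => Var L0 (nth 0 [:: i; j; k] m)] m) | m < rar rs_link] =
  [tuple v i; v j; v k] by [].
apply: eq_from_tnth => m; rewrite tnth_mktuple ffunE /=.
by case: m => -[|[|[|//]]].
Qed.

End SatL0.

(** * Tree structures and their first-order axioms *)

Section Notions.
Variable N : structure L0.
Implicit Types a b u v y z : N.

(* The colour of (u, v) is the number of [z] with [link z u v]; an infinite colour satisfies no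
   [cex]. The level of [a] of sort A is the colour of (a, a), and [a] is a pointer of [y] of sort Y
   when the colour of (y, a) is finite. *)
Definition isA u := exists v, below u v.
Definition isZ z := exists u v, link z u v.
Definition isY u := ~ isA u /\ ~ isZ u.

Definition cge u v k := exists2 g : nat -> N,
  forall i, i < k -> link (g i) u v &
  forall i j, i < k -> j < k -> g i = g j -> i = j.
Definition cex u v c := cge u v c /\ ~ cge u v c.+1.

Lemma cge_leq u v k l : l <= k -> cge u v k -> cge u v l.
Proof.
move=> lk [g H1 H2]; exists g => [i Hi|i j Hi Hj]; first by apply: H1; lia.
by apply: H2; lia.
Qed.

Lemma cex_cge u v c k : cex u v c -> cge u v k <-> k <= c.
Proof.
move=> [H1 H2]; split=> [H|H]; last exact: cge_leq H1.
by case: leqP => // /cge_leq /(_ H).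
Qed.

Lemma cex_inj u v c c' : cex u v c -> cex u v c' -> c = c'.
Proof.
move=> H H'; apply/eqP; rewrite eqn_leq; apply/andP; split.
  by apply/(cex_cge c H'); case: H.
by apply/(cex_cge c' H); case: H'.
Qed.

Lemma cge0 u v : cge u v 0. Proof. by exists (fun=> u). Qed.

Lemma cexVcge u v : (exists c, cex u v c) \/ (forall k, cge u v k).
Proof.
have [H|H] := classic (forall k, cge u v k); [by right|left].
apply: NNPP => H'; apply: H; elim=> [|k IH]; first exact: cge0.
by apply: NNPP => Hk; apply: H'; exists k.
Qed.

End Notions.

(* The elements of sort A are densely ordered and split into convex levels 1, 2, 3, ... The pointers
   of [y] form an ascending chain, the first one having colour 0 and each later one the level of its
   predecessor; the colours run along the tree [E]. The filtration [V] and the bound [Q] are trivial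
   for the models of the theory; they bound the quantifiers in the decision procedure. *)
Record tree_axioms (E : rel nat) (N : structure L0) (Q : nat -> Prop) (V : nat -> N -> Prop)
    : Prop := TreeAxioms {
  V_mono : forall i u, V i u -> V i.+1 u;
  V_link : forall i (z u v : N), V i z -> link z u v -> V i u /\ V i v;
  V_ptr : forall i (y a : N) c, V i y -> isY y -> isA a -> cex y a c -> V i a;
  below_irr : forall u : N, ~ below u u;
  below_trans : forall u v w : N, below u v -> below v w -> below u w;
  below_total : forall u v : N, isA u -> isA v -> below u v \/ u = v \/ below v u;
  below_A : forall u v : N, below u v -> isA v;
  link_A : forall z u v : N, link z u v -> isA v /\ (u = v \/ isY u) /\ ~ isA z;
  link_fun : forall z u v u' v' : N, link z u v -> link z u' v' -> u = u' /\ v = v';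
  lev_pos : forall a : N, isA a -> cge a a 1;
  lev_mono : forall (a b : N) k, below a b -> cge a a k -> cge b b k;
  lev_dn : forall i (a : N) n, V i a -> isA a -> cex a a n ->
    exists c, [/\ V i.+1 c, below c a & cex c c n];
  lev_up : forall i (a : N), V i a -> isA a ->
    exists c, [/\ V i.+1 c, below a c & forall k, cge c c k -> cge a a k];
  below_dense : forall i (a b : N), V i a -> V i b -> below a b ->
    exists c, [/\ V i.+1 c, below a c & below c b];
  lev_ex : forall n, 0 < n -> Q n -> exists a, [/\ V 0 a, isA a & cex a a n];
  ptr_uniq : forall (y a a' : N) c, isY y -> isA a -> isA a' ->
    cex y a c -> cex y a' c -> a = a';
  ptr_lev : forall (y a : N) c, isY y -> isA a -> cex y a c -> cge a a c.+1;
  ptr_prev : forall (y b : N) c, isY y -> isA b -> cex y b c -> 0 < c ->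
    exists a c', [/\ isA a, cex y a c', cex a a c & E c' c];
  ptr_inj : forall (y a a' : N) c c' n, isY y -> isA a -> isA a' ->
    cex y a c -> cex y a' c' -> cex a a n -> cex a' a' n -> a = a';
  y_nil : forall i (e : seq N), (forall u, List.In u e -> V i u) ->
    exists y, [/\ V i.+1 y, isY y, ~ List.In y e & forall b, isA b -> ~ cex y b 0];
  y_ex : forall i k (x : nat -> N) (ns : nat -> nat) (e : seq N), Q k.+1 ->
    (forall j, j <= k -> V i (x j) /\ isA (x j)) ->
    (forall u, List.In u e -> V i u) -> ns 0 = 0 ->
    (forall j, j < k -> cex (x j) (x j) (ns j.+1) /\ E (ns j) (ns j.+1)) ->
    cge (x k) (x k) (ns k).+1 ->
    exists y, [/\ V i.+1 y, isY y, ~ List.In y e,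
      forall j, j <= k -> cex y (x j) (ns j) &
      forall n b, isA b -> cex (x k) (x k) n -> ~ cex y b n];
  link_ex : forall i (u v : N) k, V i u -> V i v -> Q k -> cge u v k ->
    exists g, [/\ forall j, j < k -> V i.+1 (g j) /\ link (g j) u v &
      forall j l, j < k -> l < k -> g j = g l -> j = l] }.

Definition tree_structure E N :=
  @tree_axioms E N (fun=> True) (fun _ _ => True).

Definition fA i : formula L0 := Ex i.+1 (fLt i i.+1).
Definition fZ i : formula L0 := Ex i.+1 (Ex i.+2 (fLink i i.+1 i.+2)).
Definition fY i : formula L0 := And (Not (fA i)) (Not (fZ i)).
Fixpoint fexs b k (p : formula L0) := if k is k'.+1 then Ex b (fexs b.+1 k' p) else p.
Fixpoint fconj k (F : nat -> formula L0) : formula L0 :=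
  if k is k'.+1 then And (fconj k' F) (F k') else fEq 0 0.
(** The [k] bound variables start at [(i + j).+1], so none of them captures [i] or [j]. The formula
    [fEq 0 0] stands for truth, here on the diagonal of the distinctness conditions. *)
Definition fge k i j : formula L0 :=
  let b := (i + j).+1 in
  fexs b k (And (fconj k (fun l => fLink (b + l) i j))
    (fconj k (fun l => fconj k (fun m =>
       if l == m then fEq 0 0 else Not (fEq (b + l) (b + m)))))).
Definition fex c i j : formula L0 := And (fge c i j) (Not (fge c.+1 i j)).

Section SatNotions.
Variable N : structure L0.
Implicit Types v : nat -> N.

Lemma update_ne v n a m : m <> n -> update v n a m = v m.
Proof. by rewrite /update; case: eqP. Qed.
Lemma update_eq v n a : update v n a n = a.
Proof. by rewrite /update eqxx. Qed.

Lemma sat_fA v i : sat v (fA i) <-> isA (v i).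
Proof.
rewrite /fA sat_Ex.
by split=> -[a H]; exists a; move: H; rewrite sat_fLt update_eq update_ne //; lia.
Qed.

Lemma sat_fZ v i : sat v (fZ i) <-> isZ (v i).
Proof.
have E a : sat (update v i.+1 a) (Ex i.+2 (fLink i i.+1 i.+2)) <-> exists b, link (v i) a b.
  rewrite sat_Ex; split=> -[b H]; exists b; move: H; rewrite sat_fLink update_eq.
    by rewrite !(@update_ne _ i.+2) ?update_eq ?update_ne //; lia.
  by rewrite !(@update_ne _ i.+2) ?update_eq ?update_ne //; lia.
by rewrite /fZ sat_Ex; split=> -[a H]; exists a; apply/E.
Qed.

Lemma sat_fY v i : sat v (fY i) <-> isY (v i).
Proof. by rewrite /fY sat_And !sat_Not sat_fA sat_fZ. Qed.

Lemma sat_eqv v w p : (forall n, v n = w n) -> sat v p -> sat w p.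
Proof. by move=> /functional_extensionality ->. Qed.

Lemma sat_fexs v b k p :
  sat v (fexs b k p) <->
  exists g : nat -> N, sat (fun m => if b <= m < b + k then g (m - b) else v m) p.
Proof.
elim: k v b => [|k IH] v b; last rewrite [fexs _ _ _]/= sat_Ex.
  have E : (fun m => if b <= m < b + 0 then v (m - b) else v m) = v.
    by apply: functional_extensionality => m; case: ifP => //; lia.
  split=> [H|[g H]]; first by exists (fun i => v i); rewrite E.
  suff <- : (fun m => if b <= m < b + 0 then g (m - b) else v m) = v by [].
  by apply: functional_extensionality => m; case: ifP => //; lia.
split=> [[a /IH[g H]]|[g H]].
  exists (fun i => if i is j.+1 then g j else a).
  apply: sat_eqv H => m; case: ifP => H1; case: ifP => H2; try lia.
  - by have -> : m - b = (m - b.+1).+1 by lia.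
  - by have -> : m = b by [lia]; rewrite update_eq subnn.
  - by rewrite update_ne //; lia.
exists (g 0); apply/IH; exists (fun i => g i.+1).
apply: sat_eqv H => m; case: ifP => H1; case: ifP => H2; try lia.
- by have -> : m - b = (m - b.+1).+1 by lia.
- by have -> : m = b by [lia]; rewrite update_eq subnn.
- by rewrite update_ne //; lia.
Qed.

Lemma sat_fconj v k F : sat v (fconj k F) <-> forall i, i < k -> sat v (F i).
Proof.
elim: k => [|k IH]; first by split.
rewrite [fconj _ _]/= sat_And IH; split=> [[H1 H2] i|H]; last by split=> [i Hi|]; apply: H; lia.
by rewrite ltnS leq_eqVlt => /orP[/eqP ->//|/H1].
Qed.

Lemma sat_fge v k i j : sat v (fge k i j) <-> cge (v i) (v j) k.
Proof.
rewrite /fge sat_fexs; set b := (i + j).+1.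
have Fi : (b <= i < b + k) = false by rewrite /b; lia.
have Fj : (b <= j < b + k) = false by rewrite /b; lia.
have Fl l : l < k -> (b <= b + l < b + k) = true by move=> Hl; apply/andP; rewrite leq_addr ltn_add2l.
split=> -[g].
  rewrite sat_And !sat_fconj => -[H1 H2]; exists g => [l Hl|l m Hl Hm E].
    have := H1 l Hl; rewrite sat_fLink addKn.
    by rewrite Fi Fj (Fl l Hl).
  have /sat_fconj /(_ m Hm) := H2 l Hl; case: eqP => // _.
  by rewrite sat_Not sat_fEq !Fl // !addKn.
move=> H1 H2; exists g; rewrite sat_And !sat_fconj; split=> l Hl.
  by rewrite sat_fLink addKn Fi Fj (Fl l Hl); apply: H1.
apply/sat_fconj => m Hm; case: eqP => // Hlm.
by rewrite sat_Not sat_fEq !Fl // !addKn => /H2 H; apply: Hlm; apply: H.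
Qed.

Lemma sat_fex v c i j : sat v (fex c i j) <-> cex (v i) (v j) c.
Proof. by rewrite /fex sat_And sat_Not !sat_fge. Qed.

Lemma iff_Ex v n p (P : N -> Prop) :
  (forall a, sat (update v n a) p <-> P a) -> sat v (Ex n p) <-> exists a, P a.
Proof. by move=> H; rewrite sat_Ex; split=> -[a Ha]; exists a; apply/H. Qed.

Lemma iff_And v p q (P P' : Prop) :
  (sat v p <-> P) -> (sat v q <-> P') -> sat v (And p q) <-> P /\ P'.
Proof. by rewrite sat_And => -> ->. Qed.

Lemma iff_Or v p q (P P' : Prop) :
  (sat v p <-> P) -> (sat v q <-> P') -> sat v (Or p q) <-> P \/ P'.
Proof. by rewrite sat_Or => -> ->. Qed.

Lemma iff_Imp v p q (P P' : Prop) :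
  (sat v p <-> P) -> (sat v q <-> P') -> sat v (Imp p q) <-> (P -> P').
Proof. by rewrite sat_Imp => -> ->. Qed.

Lemma iff_Not v p (P : Prop) : (sat v p <-> P) -> sat v (Not p) <-> ~ P.
Proof. by rewrite sat_Not => ->. Qed.

Lemma iff_fconj v k F (P : nat -> Prop) :
  (forall i, sat v (F i) <-> P i) -> sat v (fconj k F) <-> forall i, i < k -> P i.
Proof. by rewrite sat_fconj => H; split=> H' i Hi; apply/H; apply: H'. Qed.

End SatNotions.

Ltac fo := repeat first
  [ apply: sat_fA | apply: sat_fY | apply: sat_fZ | apply: sat_fex | apply: sat_fge
  | apply: sat_fLt | apply: sat_fEq | apply: sat_fLink
  | apply: iff_Imp | apply: iff_Or
  | apply: iff_And | apply: iff_Ex => ? | apply: iff_fconj => ? | apply: iff_Not ].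

Lemma In_map_iota (T : Type) (w : nat -> T) s n j :
  s <= j < s + n -> List.In (w j) [seq w i | i <- iota s n].
Proof.
elim: n s => [|n IH] s /= H; first by lia.
by have [->|Hs] := eqVneq s j; [left|right; apply: IH; lia].
Qed.

(** * The tree axioms pass to all models of the theory *)

Section FromTree.
Variables (E : rel nat) (M N : structure L0).
Hypotheses (HM : tree_structure E M) (HN : model (Th M) N).

(** One formula defines [P] in all structures at once; since [N] satisfies the theory of [M], [P]
    passes from all assignments in [M] to all assignments in [N]. The formulas given below serve
    only as witnesses of definability. *)
Lemma xfer (p : formula L0) (P : forall N : structure L0, (nat -> N) -> Prop) :
  (forall (N : structure L0) v, sat v p <-> P N v) -> (forall v, P M v) -> forall v, P N v.
Proof.
move=> H HPM v; apply/H; suff : holds N p by apply.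
by apply: (transfer HN) => w; apply/H.
Qed.

Definition asg2 (a b : N) i := nth a [:: a; b] i.
Definition asg3 (a b c : N) i := nth a [:: a; b; c] i.
Definition asg5 (a b c d e : N) i := nth a [:: a; b; c; d; e] i.

(** A formula has no list parameters; the points [x 0, ..., x k] and the entries of [e] become
    values of consecutive variables, those of the list from [k.+1] on. *)
Lemma list_fun (k : nat) (x : nat -> N) (e : seq N) : exists v : nat -> N,
  (forall j, j <= k -> v j = x j) /\
  forall u, List.In u e <-> exists2 j, j < size e & v (k.+1 + j) = u.
Proof.
exists (fun i => if i <= k then x i else nth (x 0) e (i - k.+1)); split=> [j ->//|u].
split=> [|[j Hj]].
  elim: e => //= a e IH [->|/IH[j Hj H]].
    by exists 0 => //; rewrite addn0 ltnn subnn.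
  exists j.+1 => //; move: H; rewrite !ifF; [|lia|lia].
  by rewrite addnS subSn ?leq_addr // !addKn.
rewrite ifF; last by lia.
rewrite addKn => <-; elim: e j Hj => //= a e IH [|j] Hj; [by left|right; exact: IH].
Qed.

Lemma extract_y_nil (e : seq N) :
  exists y : N, [/\ isY y, ~ List.In y e & forall b, isA b -> ~ cex y b 0].
Proof.
pose n := size e.
pose p := Ex n (And (fY n) (And (fconj n (fun j => Not (fEq n j)))
   (Not (Ex n.+1 (And (fA n.+1) (fex 0 n n.+1)))))).
pose P (N : structure L0) (v : nat -> N) := exists y, isY y /\
  (forall j, j < n -> y <> v j) /\ ~ exists b, isA b /\ cex y b 0.
have [a0] := dom_inhabited N.
have [v [_ Hv]] := list_fun 0 (fun=> a0) e.
have [|w|y [Yy [H1 H2]]] := @xfer p P _ _ (fun i => v i.+1).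
- move=> N' w; apply: iff_Ex => y; apply: iff_And; last apply: iff_And.
  + by rewrite sat_fY update_eq.
  + rewrite sat_fconj; split=> H j Hj; have := H j Hj; rewrite sat_Not sat_fEq update_eq update_ne //; lia.
  + apply: iff_Not; apply: iff_Ex => b.
    by rewrite sat_And sat_fA sat_fex !update_eq update_ne ?update_eq //; lia.
- have [y [_ Yy Hy H]] := y_nil HM (i := 0) (e := [seq w i | i <- iota 0 n]) (fun _ _ => I).
  exists y; split=> //; split=> [j Hj Ej|[b [Ab Hb]]]; last exact: H Hb.
  by apply: Hy; rewrite Ej; apply: In_map_iota.
- exists y; split=> // [/Hv[j Hj Ej]|b Ab Hb].
    by apply: (H1 j Hj); rewrite -Ej.
  by apply: H2; exists b.
Qed.

(** The clause forbidding a pointer whose colour is the level of [x k] quantifies over that level,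
    which is not first-order. [o] fixes it in advance: [Some n] for the finite level [n], and [None]
    for an infinite level, where the clause is void. *)
Lemma extract_y_ex k (x : nat -> N) (ns : nat -> nat) (e : seq N) (o : option nat) :
  (forall j, j <= k -> isA (x j)) -> ns 0 = 0 ->
  (forall j, j < k -> cex (x j) (x j) (ns j.+1) /\ E (ns j) (ns j.+1)) ->
  cge (x k) (x k) (ns k).+1 ->
  (forall n, o = Some n -> cex (x k) (x k) n) ->
  exists y : N, [/\ isY y, ~ List.In y e,
      forall j, j <= k -> cex y (x j) (ns j) &
      forall n b, o = Some n -> isA b -> ~ cex y b n].
Proof.
move=> Ax ns0 Hx Hk Ho.
pose n := size e; pose m := k.+1 + n.
pose p0 := if o is Some l then fex l k k else fEq 0 0.
pose p1 := if o is Some l then Not (Ex m.+1 (And (fA m.+1) (fex l m m.+1))) else fEq 0 0.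
pose p := Imp (And (fconj k.+1 fA) (And (fconj k (fun j => fex (ns j.+1) j j))
    (And (fge (ns k).+1 k k) p0)))
  (Ex m (And (fY m) (And (fconj n (fun j => Not (fEq m (k.+1 + j))))
   (And (fconj k.+1 (fun j => fex (ns j) m j)) p1)))).
pose P (N : structure L0) (v : nat -> N) :=
  (forall j, j < k.+1 -> isA (v j)) /\ (forall j, j < k -> cex (v j) (v j) (ns j.+1)) /\
  cge (v k) (v k) (ns k).+1 /\ (forall l, o = Some l -> cex (v k) (v k) l) ->
  exists y, isY y /\ (forall j, j < n -> y <> v (k.+1 + j)) /\
  (forall j, j < k.+1 -> cex y (v j) (ns j)) /\
  (forall l, o = Some l -> ~ exists b, isA b /\ cex y b l).
have [v [Hv1 Hv2]] := list_fun k x e.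
have Hkm j : j < k.+1 -> j <> m by rewrite /m; lia.
have [|w||y [Yy [H1 [H2 H3]]]] := @xfer p P _ _ v.
- move=> N' w; apply: iff_Imp; last (apply: iff_Ex => y; apply: iff_And; last apply: iff_And; last apply: iff_And).
  + do 3?apply: iff_And.
    * by apply: iff_fconj => i; apply: sat_fA.
    * by apply: iff_fconj => i; apply: sat_fex.
    * exact: sat_fge.
    * rewrite /p0; case: o {Ho p1 p P} p0 => [l|] _; last by [].
      by rewrite sat_fex; split=> [H ? [<-]|]; last by apply.
  + by rewrite sat_fY update_eq.
  + rewrite sat_fconj; split=> H j Hj; have := H j Hj; rewrite sat_Not sat_fEq update_eq update_ne //; rewrite /m; lia.
  + by rewrite sat_fconj; split=> H j Hj; have := H j Hj; rewrite sat_fex update_eq update_ne //; apply: Hkm.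
  + rewrite /p1; case: o {Ho p0 p P} p1 => [l|] _; last by [].
    have F : sat (update w m y) (Not (Ex m.+1 (And (fA m.+1) (fex l m m.+1)))) <->
       ~ exists b, isA b /\ cex y b l.
      apply: iff_Not; apply: iff_Ex => b.
      by rewrite sat_And sat_fA sat_fex !update_eq update_ne ?update_eq //; lia.
    by rewrite F; split=> [H ? [<-]|]; last by apply.
- move=> [A1 [A2 [A3 A4]]].
  have [|||||y [_ Yy Hy H1 H2]] := y_ex HM (i := 0) (k := k) (x := w) (ns := ns)
     (e := [seq w (k.+1 + i) | i <- iota 0 n]) I.
  + by move=> j Hj; split=> //; apply: A1.
  + by [].
  + by [].
  + by move=> j Hj; split; [apply: A2|case: (Hx j Hj)].
  + by [].
  exists y; split=> //; split=> [j Hj Ej|].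
    by apply: Hy; rewrite Ej; apply: (@In_map_iota _ (fun i => w (k.+1 + i))).
  split=> [j Hj|l El [b [Ab Hb]]]; first exact: H1.
  exact: (H2 l b Ab (A4 l El) Hb).
- split=> [j Hj|]; first by rewrite Hv1 //; apply: Ax.
  split=> [j Hj|]; first by rewrite Hv1 ?(ltnW Hj) //; case: (Hx j Hj).
  by rewrite Hv1.
- exists y; split=> //.
  + by move=> /Hv2[j Hj Ej]; apply: (H1 j Hj).
  + by move=> j Hj; have := H2 j Hj; rewrite Hv1.
  + by move=> l b El Ab Hb; apply: (H3 l El); exists b.
Qed.

Lemma tree_extract : tree_structure E N.
Proof.
split=> //.
- move=> u; apply: (@xfer (Not (fLt 0 0)) (fun N v => ~ below (v 0) (v 0)) _ _ (fun=> u)).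
    by move=> N' v; fo.
  by move=> v; apply: below_irr HM _.
- move=> u v w H1 H2; apply: (@xfer (Imp (And (fLt 0 1) (fLt 1 2)) (fLt 0 2))
    (fun N v => below (v 0) (v 1) /\ below (v 1) (v 2) -> below (v 0) (v 2)) _ _ (asg3 u v w)) => //.
    by move=> N' v'; fo.
  by move=> v' [F1 F2]; apply: below_trans HM _ _ _ F1 F2.
- move=> u v H1 H2; apply: (@xfer (Imp (And (fA 0) (fA 1)) (Or (fLt 0 1) (Or (fEq 0 1) (fLt 1 0))))
    (fun N v => isA (v 0) /\ isA (v 1) -> below (v 0) (v 1) \/ v 0 = v 1 \/ below (v 1) (v 0)) _ _ (asg2 u v)) => //.
    by move=> N' v'; fo.
  by move=> v' [F1 F2]; apply: below_total HM _ _ F1 F2.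
- move=> u v H1; apply: (@xfer (Imp (fLt 0 1) (fA 1))
    (fun N v => below (v 0) (v 1) -> isA (v 1)) _ _ (asg2 u v)) => //.
    by move=> N' v'; fo.
  by move=> v' F; apply: below_A HM _ _ F.
- move=> z u v H1; apply: (@xfer (Imp (fLink 0 1 2) (And (fA 2) (And (Or (fEq 1 2) (fY 1)) (Not (fA 0)))))
    (fun N v => link (v 0) (v 1) (v 2) -> isA (v 2) /\ (v 1 = v 2 \/ isY (v 1)) /\ ~ isA (v 0)) _ _ (asg3 z u v)) => //.
    by move=> N' v'; fo.
  by move=> v' F; apply: link_A HM _ _ _ F.
- move=> z u v u' v' H1 H2; apply: (@xfer (Imp (And (fLink 0 1 2) (fLink 0 3 4)) (And (fEq 1 3) (fEq 2 4)))
    (fun N v => link (v 0) (v 1) (v 2) /\ link (v 0) (v 3) (v 4) -> v 1 = v 3 /\ v 2 = v 4) _ _ (asg5 z u v u' v')) => //.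
    by move=> N' w; fo.
  by move=> w [F1 F2]; apply: link_fun HM _ _ _ _ _ F1 F2.
- move=> u H1; apply: (@xfer (Imp (fA 0) (fge 1 0 0))
    (fun N v => isA (v 0) -> cge (v 0) (v 0) 1) _ _ (fun=> u)) => //.
    by move=> N' w; fo.
  by move=> w F1; apply: lev_pos HM _ F1.
- move=> u v k H1 H2; apply: (@xfer (Imp (And (fLt 0 1) (fge k 0 0)) (fge k 1 1))
    (fun N v => below (v 0) (v 1) /\ cge (v 0) (v 0) k -> cge (v 1) (v 1) k) _ _ (asg2 u v)) => //.
    by move=> N' w; fo.
  by move=> w [F1 F2]; apply: lev_mono HM _ _ _ F1 F2.
- move=> _ a n _ H1 H2.
  have [//|w [F1 F2]|//|c [F1 F2]] := @xfer (Imp (And (fA 0) (fex n 0 0)) (Ex 1 (And (fLt 1 0) (fex n 1 1))))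
    (fun N v => isA (v 0) /\ cex (v 0) (v 0) n -> exists c, below c (v 0) /\ cex c c n) _ _ (fun=> a).
  + by move=> N' w; fo.
  + by have [c [_ ? ?]] := lev_dn HM (i := 0) I F1 F2; exists c.
  + by exists c.
(* Comparing all [k] is not first-order. At infinite level any element above [a] serves, [cge a a k]
   being true anyway; at a finite level [n] an element of level exactly [n] is found. *)
- move=> _ a _ H1; have [[n Hn]|H2] := cexVcge a a; last first.
    by have [c Hc] := H1; exists c.
  have [//|w [F1 F2]|//|c [F1 F2]] := @xfer (Imp (And (fA 0) (fex n 0 0)) (Ex 1 (And (fLt 0 1) (fex n 1 1))))
    (fun N v => isA (v 0) /\ cex (v 0) (v 0) n -> exists c, below (v 0) c /\ cex c c n) _ _ (fun=> a).
  + by move=> N' w; fo.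
  + have [c [_ B H]] := lev_up HM (i := 0) I F1; exists c; split=> //; split.
      by apply: (lev_mono HM B); case: F2.
    by move/H; case: F2.
  + by exists c; split=> // k; rewrite (cex_cge _ F2) (cex_cge _ Hn).
- move=> _ a b _ _ H1.
  have [//|w F1|//|c [F1 F2]] := @xfer (Imp (fLt 0 1) (Ex 2 (And (fLt 0 2) (fLt 2 1))))
    (fun N v => below (v 0) (v 1) -> exists c, below (v 0) c /\ below c (v 1)) _ _ (asg2 a b).
  + by move=> N' w; fo.
  + by have [c [_ ? ?]] := below_dense HM (i := 0) I I F1; exists c.
  + by exists c.
- move=> n n0 _; have [a0] := dom_inhabited N.
  have [//|w|a [F1 F2]] := @xfer (Ex 0 (And (fA 0) (fex n 0 0)))
    (fun N v => exists a : N, isA a /\ cex a a n) _ _ (fun=> a0).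
  + by move=> N' w; fo.
  + by have [a [_ ? ?]] := lev_ex HM n0 I; exists a.
  + by exists a.
- move=> y a a' c H1 H2 H3 H4 H5.
  apply: (@xfer (Imp (And (fY 0) (And (fA 1) (And (fA 2) (And (fex c 0 1) (fex c 0 2))))) (fEq 1 2))
    (fun N v => isY (v 0) /\ isA (v 1) /\ isA (v 2) /\ cex (v 0) (v 1) c /\ cex (v 0) (v 2) c -> v 1 = v 2) _ _ (asg3 y a a')) => //.
    by move=> N' w; fo.
  by move=> w [F1 [F2 [F3 [F4 F5]]]]; apply: ptr_uniq HM _ _ _ _ F1 F2 F3 F4 F5.
- move=> y a c H1 H2 H3.
  apply: (@xfer (Imp (And (fY 0) (And (fA 1) (fex c 0 1))) (fge c.+1 1 1))
    (fun N v => isY (v 0) /\ isA (v 1) /\ cex (v 0) (v 1) c -> cge (v 1) (v 1) c.+1) _ _ (asg2 y a)) => //.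
    by move=> N' w; fo.
  by move=> w [F1 [F2 F3]]; apply: ptr_lev HM _ _ _ F1 F2 F3.
(* The search for [c'] is a finite disjunction, because [ptr_lev] puts the colour of [a] below its
   level [c]. It is written as a negated conjunction of negations, and [E] is evaluated outside the
   formula. *)
- move=> y b c H1 H2 H3 c0.
  have [|w|//|a [F1 F2]] := @xfer (Imp (And (fY 0) (And (fA 1) (fex c 0 1)))
     (Ex 2 (And (And (fA 2) (fex c 2 2)) (Not (fconj c (fun c' => if E c' c then Not (fex c' 0 2) else fEq 0 0))))))
    (fun N v => isY (v 0) /\ isA (v 1) /\ cex (v 0) (v 1) c ->
        exists a, (isA a /\ cex a a c) /\ ~ forall c', c' < c -> E c' c -> ~ cex (v 0) a c') _ _ (asg2 y b).
  + move=> N' w; apply: iff_Imp; first by fo.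
    apply: iff_Ex => a; apply: iff_And; first by fo.
    apply: iff_Not; apply: iff_fconj => c'; case: ifP => // _.
    have -> : (true -> ~ cex (w 0) a c') <-> ~ cex (w 0) a c' by split=> // H; apply: H.
    by apply: iff_Not; apply: sat_fex.
  + move=> [F1 [F2 F3]].
    have [a [c' [G1 G2 G3 G4]]] := ptr_prev HM F1 F2 F3 c0.
    exists a; split=> // /(_ c') H; apply: (H _ G4 G2).
    have := ptr_lev HM F1 G1 G2; rewrite (cex_cge _ G3); lia.
  + apply: NNPP => H; apply: F2 => c' _ Ec Hc; apply: H; exists a, c'.
    by case: F1.
- move=> y a a' c c' n H1 H2 H3 H4 H5 H6 H7.
  apply: (@xfer (Imp (And (fY 0) (And (fA 1) (And (fA 2) (And (fex c 0 1) (And (fex c' 0 2) (And (fex n 1 1) (fex n 2 2))))))) (fEq 1 2))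
    (fun N v => isY (v 0) /\ isA (v 1) /\ isA (v 2) /\ cex (v 0) (v 1) c /\ cex (v 0) (v 2) c' /\
      cex (v 1) (v 1) n /\ cex (v 2) (v 2) n -> v 1 = v 2) _ _ (asg3 y a a')) => //.
    by move=> N' w; fo.
  by move=> w [F1 [F2 [F3 [F4 [F5 [F6 F7]]]]]]; apply: ptr_inj HM _ _ _ _ _ _ F1 F2 F3 F4 F5 F6 F7.
- by move=> _ e _; have [y [H1 H2 H3]] := extract_y_nil e; exists y.
- move=> _ k x ns e _ Hx _ ns0 H1 H2.
  have Ax j : j <= k -> isA (x j) by move=> /Hx[].
  have [[n Hn]|Hinf] := cexVcge (x k) (x k).
    have [|y [G1 G2 G3 G4]] := @extract_y_ex k x ns e (Some n) Ax ns0 H1 H2.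
      by move=> _ [<-].
    by exists y; split=> // n' b Ab /(cex_inj Hn) <-; apply: G4.
  have [|y [G1 G2 G3 G4]] := @extract_y_ex k x ns e None Ax ns0 H1 H2; first by [].
  by exists y; split=> // n b Ab [_ []].
- move=> _ u v k _ _ _ [g G1 G2]; exists g; split=> // j Hj; split=> //; exact: G1.
Qed.

End FromTree.

(** * Back and forth between labelled tree structures *)

(* A label is a level regarded as finite, or tells whether an element is the least one of infinite
   level; for the comparison of a structure with its approximations all levels from some bound on
   count as infinite. *)
Inductive label := Fin of nat | Least | Inf.

Definition lle (l l' : label) : bool :=
  match l, l' with
  | Fin m, Fin n => m <= n
  | Fin _, _ => true
  | _, Fin _ => false
  | Inf, Least => false
  | _, _ => true
  end.

Definition is_fin (l : label) : bool := if l is Fin _ then true else false.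

Lemma lle_anti l l' : lle l l' -> lle l' l -> l = l'.
Proof. by case: l l' => [m||] [n||] //= H1 H2; congr Fin; lia. Qed.

Fixpoint legal (E : rel nat) c (ls : seq label) : bool :=
  if ls is l :: ls' then
    (if l is Fin n then c < n else true) &&
    (nilp ls' || if l is Fin n then E c n && legal E n ls' else false)
  else true.

Fixpoint cols c (ls : seq label) : seq nat :=
  if ls is l :: ls' then c :: (if l is Fin n then cols n ls' else [::]) else [::].

(* [s] lists the pointers of [y] from the one of colour [c] on, and [ls] their labels. *)
Inductive chain (N : structure L0) (labof : N -> label -> Prop) (y : N) :
    nat -> seq N -> seq label -> Prop :=
| ch_nil c : (forall b, isA b -> ~ cex y b c) -> chain labof y c [::] [::]
| ch_stop c b l : isA b -> cex y b c -> labof b l -> ~~ is_fin l -> chain labof y c [:: b] [:: l]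
| ch_cons c b n s ls : isA b -> cex y b c -> labof b (Fin n) -> chain labof y n s ls ->
    chain labof y c (b :: s) (Fin n :: ls).

(** What the back-and-forth argument needs once levels are replaced by labels: which labels occur
    ([pres]), that every cut compatible with the labels is filled, and that every legal list of
    labels is realised by pointers. Colours need to be reliable only up to the numbers in [Q]. The
    same interface serves for genuine models, where [Q] holds of all numbers, and for comparisons up
    to a bound. *)
Record view (E : rel nat) (Q : nat -> Prop) (pres : label -> Prop)
    (N : structure L0) (V : nat -> N -> Prop) (labof : N -> label -> Prop) : Prop := View {
  v_tree : tree_axioms E Q V;
  v_lab : forall a, isA a -> exists l, labof a l;
  v_pres : forall a l, labof a l -> pres l;
  v_labfun : forall a l l', labof a l -> labof a l' -> l = l';
  v_mono : forall a b l l', below a b -> labof a l -> labof b l' -> lle l l';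
  v_least : forall a b, labof a Least -> labof b Least -> a = b;
  v_fin : forall a n, labof a (Fin n) -> cex a a n;
  v_inf : forall a l k, labof a l -> ~~ is_fin l -> Q k -> cge a a k;
  v_extA : forall i (lo up : seq N) l, pres l ->
    (forall a, List.In a lo -> [/\ V i a, isA a & exists2 l', labof a l' & lle l' l /\ (l = Least -> l' <> Least)]) ->
    (forall b, List.In b up -> [/\ V i b, isA b & exists2 l', labof b l' & lle l l' /\ (l = Least -> l' <> Least)]) ->
    (forall a b, List.In a lo -> List.In b up -> below a b) ->
    exists c, [/\ V i.+1 c, isA c, labof c l, forall a, List.In a lo -> below a c
      & forall b, List.In b up -> below c b];
  v_chain : forall y, isY y -> exists s ls, chain labof y 0 s ls;
  v_legal : forall y s ls, isY y -> chain labof y 0 s ls -> legal E 0 ls /\ Q (size s);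
  v_extY : forall i (s : seq N) ls (e : seq N), legal E 0 ls -> Q (size s) ->
    List.Forall2 labof s ls -> (forall a, List.In a s -> V i a /\ isA a) ->
    (forall u, List.In u e -> V i u) ->
    exists y, [/\ V i.+1 y, isY y, ~ List.In y e & chain labof y 0 s ls];
  v_all : forall y s ls a k, isY y -> chain labof y 0 s ls -> isA a ->
    ~ List.In a s -> Q k -> cge y a k }.

Lemma chain_isA (N : structure L0) labof (y : N) c s ls a :
  chain labof y c s ls -> List.In a s -> isA a /\ exists c', cex y a c'.
Proof.
elim=> {c s ls} [//|c b l Ab H _ _ [<-|//]|c b n s ls Ab H _ _ IH [<-|/IH//]].
  by split=> //; exists c.
by split=> //; exists c.
Qed.

Lemma chain_lab (N : structure L0) labof (y : N) c s ls :
  chain labof y c s ls -> List.Forall2 labof s ls.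
Proof.
by elim=> {c s ls} [//|c b l _ _ H _|c b n s ls _ _ H _ IH]; do ?constructor.
Qed.

Lemma chain_cols (N : structure L0) labof (y : N) c s ls a c' :
  chain labof y c s ls -> List.In (a, c') (zip s (cols c ls)) -> cex y a c'.
Proof.
elim=> {c s ls} [//|c b l _ H _ _ /=|c b n s ls _ H _ _ IH /=].
  by case: l => [n||] /= [[<- <-]|].
by case=> [[<- <-]|].
Qed.

Lemma chain_col_ex (N : structure L0) labof (y : N) c s ls a :
  chain labof y c s ls -> List.In a s -> exists c', List.In (a, c') (zip s (cols c ls)).
Proof.
elim=> {c s ls} [//|c b l _ H _ Hl /= [<-|//]|c b n s ls _ H _ _ IH /= [<-|/IH[c' Hc']]].
- by exists c; left.
- by exists c; left.
- by exists c'; right.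
Qed.

Lemma zip_Forall2 (T T' : Type) (R : T -> T' -> Prop) (s : seq T) (s' : seq T') (cs : seq nat) a c :
  List.Forall2 R s s' -> List.In (a, c) (zip s cs) ->
  exists2 a', R a a' & List.In (a', c) (zip s' cs).
Proof.
move=> H; elim: H cs => {s s'} [|b b' s s' Hb _ IH] [|d cs] //= [[<- <-]|/IH[a' Ha' Hin]].
  by exists b' => //; left.
by exists a' => //; right.
Qed.

Lemma Forall2_In_r (T T' : Type) (R : T -> T' -> Prop) (s : seq T) (s' : seq T') a' :
  List.Forall2 R s s' -> List.In a' s' -> exists2 a, R a a' & List.In a s.
Proof.
elim=> {s s'} [//|b b' s s' Hb _ IH] /= [<-|/IH[a ? ?]].
  by exists b => //; left.
by exists a => //; right.
Qed.

Lemma Forall2_imp (T T' : Type) (R R' : T -> T' -> Prop) (s : seq T) (s' : seq T') :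
  (forall a b, R a b -> R' a b) -> List.Forall2 R s s' -> List.Forall2 R' s s'.
Proof. by move=> H; elim=> *; constructor; auto. Qed.

Lemma V_leq E (N : structure L0) Q V i j (u : N) : tree_axioms E Q V -> i <= j -> V i u -> V j u.
Proof.
move=> H ij Hu; rewrite -(subnKC ij); elim: (j - i) => [|k IH]; first by rewrite addn0.
by rewrite addnS; apply: (V_mono H).
Qed.

Lemma isA_nZ E (N : structure L0) Q V (u : N) : @tree_axioms E N Q V -> isA u -> ~ isZ u.
Proof. by move=> H Au [v [w /(link_A H)[_ [_]]]]. Qed.

Definition swap (T T' : Type) (p : T * T') := (p.2, p.1).

Lemma In_swap (T T' : Type) (p : seq (T * T')) u u' :
  List.In (u', u) (map (@swap T T') p) <-> List.In (u, u') p.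
Proof.
elim: p => //= -[a b] p ->; rewrite /swap /=.
by split=> -[[<- <-]|]; [left|right|left|right].
Qed.

Definition match_chain (N N' : structure L0) (labof : N -> label -> Prop) (labof' : N' -> label -> Prop)
    (p : seq (N * N')) (y : N) (y' : N') : Prop :=
  exists s s' ls, [/\ chain labof y 0 s ls, chain labof' y' 0 s' ls &
    List.Forall2 (fun a a' => List.In (a, a') p) s s'].

(** A finite partial isomorphism whose domain and range are closed under pointers and under
    endpoints of links. [m] bounds the pairs of sort Z, hence the links of any pair that are already
    used up; [i] and [i'] are the stages of the filtrations in which the elements lie. *)
Record good (N N' : structure L0) (V : nat -> N -> Prop) (V' : nat -> N' -> Prop)
    (labof : N -> label -> Prop) (labof' : N' -> label -> Prop)
    (m i i' : nat) (p : seq (N * N')) : Prop := Good {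
  g_inj : forall u u' w w', List.In (u, u') p -> List.In (w, w') p -> u = w <-> u' = w';
  g_sort : forall u u', List.In (u, u') p -> (isA u <-> isA u') /\ (isZ u <-> isZ u');
  g_lab : forall u u', List.In (u, u') p -> isA u -> exists2 l, labof u l & labof' u' l;
  g_lt : forall u u' w w', List.In (u, u') p -> List.In (w, w') p -> below u w <-> below u' w';
  g_Y : forall y y', List.In (y, y') p -> isY y -> match_chain labof labof' p y y';
  g_link : forall z z' u v, List.In (z, z') p -> link z u v ->
    exists u' v', [/\ List.In (u, u') p, List.In (v, v') p & link z' u' v'];
  g_link' : forall z z' u' v', List.In (z, z') p -> link z' u' v' ->
    exists u v, [/\ List.In (u, u') p, List.In (v, v') p & link z u v];
  g_V : forall u u', List.In (u, u') p -> V i u /\ V' i' u';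
  g_Z : exists2 pz : seq (N * N'), size pz <= m &
    forall z z', List.In (z, z') p -> isZ z -> List.In (z, z') pz }.

Lemma good_sym (N N' : structure L0) V V' labof labof' m i i' p :
  @good N N' V V' labof labof' m i i' p ->
  @good N' N V' V labof' labof m i' i (map (@swap N N') p).
Proof.
move=> G; split.
- by move=> u u' w w' /In_swap H1 /In_swap H2; rewrite (g_inj G H1 H2).
- by move=> u u' /In_swap H; have [-> ->] := g_sort G H.
- move=> u u' /In_swap H Au; have [] := g_lab G H; first by apply/(proj1 (g_sort G H)).
  by move=> l; exists l.
- by move=> u u' w w' /In_swap H1 /In_swap H2; rewrite (g_lt G H1 H2).
- move=> y y' /In_swap H [H1 H2]; have [H3 H4] := g_sort G H.
  have [|s [s' [ls [C C' F]]]] := g_Y G H; first by split; rewrite ?H3 ?H4.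
  exists s', s, ls; split=> //.
  by elim: F => *; constructor=> //; apply/In_swap.
- move=> z z' u v /In_swap H /(g_link' G H)[u' [v' [H1 H2 H3]]].
  by exists u', v'; split=> //; apply/In_swap.
- move=> z z' u v /In_swap H /(g_link G H)[u' [v' [H1 H2 H3]]].
  by exists u', v'; split=> //; apply/In_swap.
- by move=> u u' /In_swap /(g_V G)[].
- have [pz Hs Hz] := g_Z G; exists (map (@swap N N') pz); first by rewrite size_map.
  move=> z z' /In_swap H Hz'; apply/In_swap; apply: Hz => //.
  by apply/(proj2 (g_sort G H)).
Qed.

Lemma filter_nodup (U : Type) (P : U -> Prop) (s : seq U) :
  exists t, [/\ List.NoDup t, size t <= size s & forall x, List.In x t <-> List.In x s /\ P x].
Proof.
elim: s => [|a s [t [N1 S1 Ht]]]; first by exists [::]; split=> [||x] /=; [constructor| |tauto].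
have [[Pa nt]|nPa] := classic (P a /\ ~ List.In a t).
  exists (a :: t); split=> //; first by constructor.
  by move=> x /=; rewrite Ht; split=> [[<-|]|]; tauto.
exists t; split=> //; first by apply: leq_trans S1 _.
move=> x /=; split=> [/Ht[? ?]|[[<-|Ix] Hx]]; [tauto| |by apply/Ht].
by apply: NNPP => H; apply: nPa.
Qed.

Lemma In_map_fst (U U' : Type) (p : seq (U * U')) (u : U) :
  List.In u (map fst p) <-> exists u', List.In (u, u') p.
Proof.
elim: p => [|[a b] p IH] /=; first by split=> // -[].
rewrite IH; split=> [[<-|[v Hv]]|[v [[<- _]|Hv]]].
- by exists b; left.
- by exists v; right.
- by left.
- by right; exists v.
Qed.

Lemma In_nth (U : Type) (x0 : U) s j : j < size s -> List.In (nth x0 s j) s.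
Proof. by elim: s j => //= a s IH [|j] Hj; [left|right; apply: IH]. Qed.

Lemma NoDup_nth_inj (U : Type) (x0 : U) s : List.NoDup s ->
  forall i j, i < size s -> j < size s -> nth x0 s i = nth x0 s j -> i = j.
Proof.
elim=> // a {}s Na _ IH [|i] [|j] //= Hi Hj H; last by rewrite (IH i j).
- by case: Na; rewrite H; apply: In_nth.
- by case: Na; rewrite -H; apply: In_nth.
Qed.

Lemma pigeon (U : Type) n (g : nat -> U) t :
  (forall i j, i < n -> j < n -> g i = g j -> i = j) ->
  (forall j, j < n -> List.In (g j) t) -> n <= size t.
Proof.
move=> Hg Ht.
suff: (List.length (map g (iota 0 n)) <= List.length t)%coq_nat.
  by move/leP; rewrite -[List.length _]/(size _) size_map size_iota.
apply: List.NoDup_incl_length => [|x].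
  have: forall i, i \in iota 0 n -> i < n by move=> i; rewrite mem_iota.
  elim: (iota 0 n) (iota_uniq 0 n) => [|i s IH] /= => [_ _|/andP[Ni Us] Hs]; first by constructor.
  constructor; last by apply: IH => // j Hj; apply: Hs; rewrite inE Hj orbT.
  have si : forall j, j \in s -> j < n by move=> j Hj; apply: Hs; rewrite inE Hj orbT.
  have Hi : i < n by apply: Hs; rewrite inE eqxx.
  elim: s si Ni {IH Us Hs} => [_ _ []|j s IH si]; rewrite /= inE negb_or => /andP[ij Ni] [E|].
    by move: ij; rewrite (Hg j i) ?eqxx //; apply: si; rewrite inE eqxx.
  by apply: IH Ni => l Hl; apply: si; rewrite inE Hl orbT.
suff: forall s, (forall i, i \in s -> i < n) -> List.In x (map g s) -> List.In x t.
  by apply=> i; rewrite mem_iota.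
elim=> //= i s IH Hs [<-|]; first by apply: Ht; apply: Hs; rewrite inE eqxx.
by apply: IH => j Hj; apply: Hs; rewrite inE Hj orbT.
Qed.

(** * Extending a partial isomorphism by one element *)

Section Extension.
Variables (E : rel nat) (Q : nat -> Prop) (pres : label -> Prop) (N N' : structure L0).
Variables (V : nat -> N -> Prop) (V' : nat -> N' -> Prop).
Variables (labof : N -> label -> Prop) (labof' : N' -> label -> Prop).
Hypotheses (W : view E Q pres V labof) (W' : view E Q pres V' labof').
Let T := v_tree W.
Let T' := v_tree W'.
Notation good := (good V V' labof labof').

Lemma good_leq m i i' j j' p : i <= j -> i' <= j' -> good m i i' p -> good m j j' p.
Proof.
move=> H H' [] *; split=> // u u' Hu.
have [Vu Vu'] : V i u /\ V' i' u' by auto.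
by split; [apply: (V_leq T H)|apply: (V_leq T' H')].
Qed.

Lemma good_mS m i i' p : good m i i' p -> good m.+1 i i' p.
Proof. by case=> ? ? ? ? ? ? ? ? [pz H1 H2]; split=> //; exists pz => //; apply: leq_trans H1 _. Qed.

Lemma match_chain_sub p q y y' :
  (forall u, List.In u p -> List.In u q) ->
  match_chain labof labof' p y y' -> match_chain labof labof' q y y'.
Proof.
move=> H [s [s' [ls [C C' F]]]]; exists s, s', ls; split=> //.
by apply: Forall2_imp F => a b; apply: H.
Qed.

(* Adding a pair of fresh elements of sort A or Y preserves everything that does not mention the
   new elements. *)
Lemma good_add m i i' p u u' :
  good m i i' p -> (forall w', ~ List.In (u, w') p) -> (forall w, ~ List.In (w, u') p) ->
  ~ isZ u -> ~ isZ u' -> (isA u <-> isA u') ->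
  (isA u -> exists2 l, labof u l & labof' u' l) ->
  (forall w w', List.In (w, w') p -> (below u w <-> below u' w') /\ (below w u <-> below w' u')) ->
  (isY u -> match_chain labof labof' p u u') ->
  V i u -> V' i' u' -> good m i i' ((u, u') :: p).
Proof.
move=> G F F' nZ nZ' SA HL HB HY HV HV'.
split.
- move=> w w' x x' /= [[<- <-]|H1] [[<- <-]|H2]; [by []|..|exact: (g_inj G H1 H2)].
    by split=> E0; subst; [case: (F _ H2)|case: (F' _ H2)].
  by split=> E0; subst; [case: (F _ H1)|case: (F' _ H1)].
- by move=> w w' /= [[<- <-]|/(g_sort G)//]; split.
- by move=> w w' /= [[<- <-]|/(g_lab G)]; auto.
- move=> w w' x x' /= [[<- <-]|H1] [[<- <-]|H2].
  + by split=> H; [case: (below_irr T H)|case: (below_irr T' H)].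
  + by have [] := HB _ _ H2.
  + by have [] := HB _ _ H1.
  + exact: (g_lt G H1 H2).
- move=> y y' /= [[<- <-]|H1] Yy; (apply: (@match_chain_sub p) => [w Hw|]; first by right).
    exact: HY.
  exact: (g_Y G).
- move=> z z' w x /= [[<- <-]|H1] Hl; first by case: nZ; exists w, x.
  by have [w' [x' [? ? ?]]] := g_link G H1 Hl; exists w', x'; split=> //; right.
- move=> z z' w x /= [[<- <-]|H1] Hl; first by case: nZ'; exists w, x.
  by have [w' [x' [? ? ?]]] := g_link' G H1 Hl; exists w', x'; split=> //; right.
- by move=> w w' /= [[<- <-]|/(g_V G)].
- have [pz Hs Hz] := g_Z G; exists pz => // z z' /= [[<- <-]//|]; exact: Hz.
Qed.

Lemma In_filter_prop (U : Type) (P : U -> Prop) (s : seq U) :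
  exists t, forall x, List.In x t <-> List.In x s /\ P x.
Proof.
elim: s => [|a s [t Ht]]; first by exists [::] => x /=; tauto.
have [Pa|nPa] := classic (P a).
  exists (a :: t) => x /=; rewrite Ht; split=> [[<-|]|]; tauto.
exists t => x /=; rewrite Ht; split=> [|[[Ea|] Hx]]; try tauto.
by subst.
Qed.

Lemma In_map_snd p (u' : N') : List.In u' (map snd p) <-> exists u : N, List.In (u, u') p.
Proof.
elim: p => [|[a b] p IH] /=; first by split=> // -[].
rewrite IH; split=> [[<-|[u Hu]]|[u [[_ <-]|Hu]]].
- by exists a; left.
- by exists u; right.
- by left.
- by right; exists u.
Qed.

(** The image of [b] must lie in the gap between the images of the elements below and above [b] and
    carry the label of [b]. Labels are monotone along the order, so the gap is compatible with this
    label and [v_extA] fills it. *)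
Lemma extend_A m i i' p b : good m i i' p -> isA b -> V i b ->
  exists2 p', good m i i'.+1 p' & (forall u, List.In u p -> List.In u p') /\ exists b', List.In (b, b') p'.
Proof.
move=> G Ab Vb.
have [[b' Hb']|Fb] := classic (exists b', List.In (b, b') p).
  exists p; first exact: good_leq G.
  by split=> //; exists b'.
have [l Hl] := v_lab W Ab.
have [lo Hlo] := In_filter_prop (fun x => below x.1 b) p.
have [up Hup] := In_filter_prop (fun x => below b x.1) p.
have HLO c' : List.In c' (map snd lo) -> exists2 c, List.In (c, c') p & below c b.
  by move=> /In_map_snd[c /Hlo[H1 H2]]; exists c.
have HUP c' : List.In c' (map snd up) -> exists2 c, List.In (c, c') p & below b c.
  by move=> /In_map_snd[c /Hup[H1 H2]]; exists c.
have [||||c' [Vc Ac lc Clo Cup]] := @v_extA _ _ _ _ _ _ W' i' (map snd lo) (map snd up) l.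
- exact: (v_pres W Hl).
- move=> c' /HLO[c Hc Bc].
  have Ac : isA c by exists b.
  have [lc L1 L2] := g_lab G Hc Ac.
  have [_ Vc'] := g_V G Hc; split=> //; first by apply/(proj1 (g_sort G Hc)).
  exists lc => //; split; first exact: (v_mono W Bc L1 Hl).
  (* At most one element carries [Least], so no neighbour of [b] shares that label with it. *)
  move=> El Elc; subst; have Ecb := v_least W L1 Hl; subst; exact: (below_irr T Bc).
- move=> c' /HUP[c Hc Bc].
  have Ac : isA c by apply: (below_A T Bc).
  have [lc L1 L2] := g_lab G Hc Ac.
  have [_ Vc'] := g_V G Hc; split=> //; first by apply/(proj1 (g_sort G Hc)).
  exists lc => //; split; first exact: (v_mono W Bc Hl L1).
  move=> El Elc; subst; have Ecb := v_least W L1 Hl; subst; exact: (below_irr T Bc).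
- move=> a' d' /HLO[a Ha Ba] /HUP[d Hd Bd].
  by apply/(g_lt G Ha Hd); apply: (below_trans T Ba Bd).
have cmp w w' : List.In (w, w') p -> (below b w <-> below c' w') /\ (below w b <-> below w' c').
  move=> Hw; have [[SA _] [SZ _]] := g_sort G Hw.
  have [SA' _] := g_sort G Hw.
  have L : below w b -> below w' c'.
    by move=> Bw; apply: Clo; apply/In_map_snd; exists w; apply/Hlo.
  have U : below b w -> below c' w'.
    by move=> Bw; apply: Cup; apply/In_map_snd; exists w; apply/Hup.
  have Tri : isA w' -> below w b \/ below b w.
    move=> /SA' Aw; have [|[Ew|]] := below_total T Aw Ab; [by left| |by right].
    by subst; case: Fb; exists w'.
  split; split=> // Bw.
    have [Bw'|//] := Tri (below_A T' Bw).
    by case: (below_irr T' (below_trans T' Bw (L Bw'))).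
  have [//|Bw'] : below w b \/ below b w by apply: Tri; exists c'.
  by case: (below_irr T' (below_trans T' Bw (U Bw'))).
exists ((b, c') :: p); last by split=> [u Hu|]; [right|exists c'; left].
apply: good_add => //.
- exact: good_leq G.
- by move=> w' Hw; apply: Fb; exists w'.
- move=> w Hw; have [SA _] := g_sort G Hw.
  have Aw : isA w by apply/SA.
  have [C1 C2] := cmp _ _ Hw.
  have [/C2|[Ew|/C1]] := below_total T Aw Ab; [exact: below_irr T' _| |exact: below_irr T' _].
  by subst; case: Fb; exists c'.
- exact: (isA_nZ T).
- exact: (isA_nZ T').
- by exists l.
- by move=> [].
Qed.

Lemma extend_As m i i' p s : good m i i' p -> (forall a, List.In a s -> isA a /\ V i a) ->
  exists2 p', good m i (i' + size s) p' & (forall u, List.In u p -> List.In u p') /\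
    forall a, List.In a s -> exists a', List.In (a, a') p'.
Proof.
elim: s p i' => [|a s IH] p i' G Hs; first by exists p => //; rewrite addn0.
have [Aa Va] := Hs a (or_introl erefl).
have [p1 G1 [S1 [a' Ha']]] := extend_A G Aa Va.
have [|p2 G2 [S2 F2]] := IH p1 i'.+1 G1; first by move=> b Hb; apply: Hs; right.
exists p2; first by rewrite addnS -addSn.
split=> [u /S1/S2//|b [<-|/F2//]]; by exists a'; apply: S2.
Qed.

Lemma choose_images (p : seq (N * N')) (s : seq N) :
  (forall a, List.In a s -> exists a', List.In (a, a') p) ->
  exists s', List.Forall2 (fun a a' => List.In (a, a') p) s s'.
Proof.
elim: s => [|a s IH] H; first by exists [::]; constructor.
have [a' Ha'] := H a (or_introl erefl).
have [|s' Hs'] := IH; first by move=> b Hb; apply: H; right.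
by exists (a' :: s'); constructor.
Qed.

Lemma Forall2_size (U U' : Type) (R : U -> U' -> Prop) s s' : List.Forall2 R s s' -> size s = size s'.
Proof. by elim=> //= *; congr S. Qed.

Lemma image_labels m i i' p s s' ls : good m i i' p -> List.Forall2 labof s ls ->
  (forall a, List.In a s -> isA a) -> List.Forall2 (fun a a' => List.In (a, a') p) s s' ->
  List.Forall2 labof' s' ls.
Proof.
move=> G CL; elim: CL s' => {s ls} [|a l s ls Hal _ IH] s' CA Hs'.
  by inversion Hs'; constructor.
inversion Hs' as [|? a' ? s1' Ha' Hs1']; subst; constructor.
  have [|l' L1 L2] := g_lab G Ha'; first by apply: CA; left.
  by rewrite (v_labfun W Hal L1).
by apply: IH => // b Hb; apply: CA; right.
Qed.

(** The pointers of [y] are added before [y] itself, one stage of the filtration each. Their images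
    carry the same labels, so [v_extY] yields an element with exactly these pointers, and one that
    avoids the range. *)
Lemma extend_Y m i i' p y : good m i i' p -> isY y -> V i y ->
  exists s ls, chain labof y 0 s ls /\
  exists2 p', good m i (i' + (size s).+1) p' & (forall u, List.In u p -> List.In u p') /\ exists y', List.In (y, y') p'.
Proof.
move=> G Yy Vy; have [s [ls C]] := v_chain W Yy; exists s, ls; split=> //.
have [[y' Hy']|Fy] := classic (exists y', List.In (y, y') p).
  exists p; first by apply: good_leq G => //; lia.
  by split=> //; exists y'.
have [|p1 G1 [S1 F1]] := extend_As (s := s) G.
  move=> a /(chain_isA C)[Aa [c Hc]]; split=> //; exact: (V_ptr T Vy Yy Aa Hc).
have [[y' Hy']|Fy1] := classic (exists y', List.In (y, y') p1).
  exists p1; first by apply: good_leq G1 => //; lia.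
  by split=> //; exists y'.
have [s' Hs'] := choose_images F1.
have [Lg Qs] := v_legal W Yy C.
have As : forall a', List.In a' s' -> V' (i' + size s) a' /\ isA a'.
  move=> a' /(Forall2_In_r Hs')[a Ha Ia].
  have [_ Va] := g_V G1 Ha; split=> //; apply/(proj1 (g_sort G1 Ha)).
  by case: (chain_isA C Ia).
have L' : List.Forall2 labof' s' ls.
  by apply: (image_labels G1 (chain_lab C) _ Hs') => a /(chain_isA C)[].
have [||y' [Vy' Yy' Ny' C']] := v_extY W' (i := i' + size s) (s := s') (e := map snd p1) Lg _ L' As.
- by rewrite -(Forall2_size Hs').
- by move=> u /In_map_snd[w Hw]; case: (g_V G1 Hw).
exists ((y, y') :: p1); last by split=> [u /S1 Hu|]; [right|exists y'; left].
apply: good_add.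
- by apply: good_leq G1 => //; lia.
- by move=> w' Hw; apply: Fy1; exists w'.
- by move=> w Hw; apply: Ny'; apply/In_map_snd; exists w.
- by case: Yy.
- by case: Yy'.
- by case: Yy Yy' => ? ? [].
- by case: Yy.
- case: Yy Yy' => nA _ [nA' _] w w' Hw; split; split=> Bw; exfalso.
  + by apply: nA; exists w.
  + by apply: nA'; exists w'.
  + by apply: nA; apply: (below_A T Bw).
  + by apply: nA'; apply: (below_A T' Bw).
- by move=> _; exists s, s', ls.
- done.
- by rewrite addnS.
Qed.

(** A colour is either fixed by a label or by a place in a chain, and then has the same exact value
    on both sides, or it is infinite on both sides as far as [Q] counts. *)
Lemma match_cge m i i' p u u' v v' k : good m i i' p -> Q k ->
  List.In (u, u') p -> List.In (v, v') p -> isA v -> u = v \/ isY u ->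
  cge u v k -> cge u' v' k.
Proof.
move=> G Qk Hu Hv Av [Euv|Yu] Hk.
  subst; have <- : u' = v' by apply/(g_inj G Hu Hv).
  have [l L1 L2] := g_lab G Hu Av.
  case Fl : (is_fin l); last by apply: (v_inf W' L2); rewrite ?Fl.
  case: l L1 L2 Fl => // n L1 L2 _.
  by apply/(cex_cge _ (v_fin W' L2)); apply/(cex_cge _ (v_fin W L1)).
have [s [s' [ls [C C' F]]]] := g_Y G Hu Yu.
have SY : isY u' by case: Yu => nA nZ; have [SA SZ] := g_sort G Hu; split; rewrite -?SA -?SZ.
have [Iv|Nv] := classic (List.In v s).
  have [c Hc] := chain_col_ex C Iv.
  have [v2 Hv2 Hc'] := zip_Forall2 F Hc.
  have Ev : v' = v2 by apply/(g_inj G Hv Hv2).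
  subst; apply/(cex_cge _ (chain_cols C' Hc')); exact/(cex_cge _ (chain_cols C Hc)).
apply: (v_all W' SY C') => //; first by apply/(proj1 (g_sort G Hv)).
move=> /(Forall2_In_r F)[a Ha Ia]; apply: Nv.
by have -> : v = a by apply/(g_inj G Hv Ha).
Qed.

Hypothesis Qdown : forall k l, l <= k -> Q k -> Q l.

(** A counting argument: at most [m] links of [(u, v)] are matched already, and [z] is one more. The
    image pair has at least that many links; if all of them were matched, closure under endpoints
    would make them images of the matched links of [(u, v)], against the pigeonhole principle. *)
Lemma extend_Z m i i' p z u v : good m i i' p -> Q m.+1 -> V i z -> link z u v ->
  (exists u', List.In (u, u') p) -> (exists v', List.In (v, v') p) ->
  exists2 p', good m.+1 i i'.+1 p' & (forall u, List.In u p -> List.In u p') /\ exists z', List.In (z, z') p'.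
Proof.
move=> G Qm Vz Hl [u' Hu] [v' Hv].
have [[z' Hz']|Fz] := classic (exists z', List.In (z, z') p).
  exists p; last by split=> //; exists z'.
  exact/good_mS/(good_leq (leqnn i) (leqnSn i') G).
have [pz Hpz Hz] := g_Z G.
have [Av [HY nAz]] := link_A T Hl.
have [D [ND SD HD]] := filter_nodup (fun x : N * N' => List.In x p /\ link x.1 u v) pz.
have inD x : List.In x p -> link x.1 u v -> List.In x D.
  case: x => w w' Hw Hlw; apply/HD; split=> //; apply: (Hz _ _ Hw); by exists u, v.
have Dinj w w' w2' : List.In (w, w') D -> List.In (w, w2') D -> w' = w2'.
  by move=> /HD[_ [H1 _]] /HD[_ [H2 _]]; apply/(g_inj G H1 H2).
have NDf : List.NoDup (map fst D).
  suff H D' : List.NoDup D' -> (forall x, List.In x D' -> List.In x D) -> List.NoDup (map fst D').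
    exact: (H D ND).
  elim=> [_|[w w'] {}D' N1 _ IH sub]; first by constructor.
  constructor; last by apply: IH => x Hx; apply: sub; right.
  move=> /In_map_fst[w2' Hw]; apply: N1.
  by rewrite (Dinj w w' w2') //; apply: sub; [left|right].
have Cuv : cge u v (size D).+1.
  have Nz : List.NoDup (z :: map fst D).
    constructor=> // /In_map_fst[w' /HD[_ [Hw _]]]; by apply: Fz; exists w'.
  exists (nth z (z :: map fst D)) => [j Hj|j l Hj Hl']; last first.
    by apply: (NoDup_nth_inj Nz); rewrite /= size_map.
  case: j Hj => //= j Hj.
  have /In_map_fst[w' /HD[_ [_]]//] : List.In (nth z (map fst D) j) (map fst D).
  by apply: In_nth; rewrite size_map.
have QD : Q (size D).+1 by apply: (Qdown _ Qm); rewrite ltnS; apply: leq_trans Hpz.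
have Cuv' := match_cge G QD Hu Hv Av HY Cuv.
have [_ Vu'] := g_V G Hu; have [_ Vv'] := g_V G Hv.
have [g [Hg1 Hg2]] := link_ex T' Vu' Vv' QD Cuv'.
have [z' [Vz' Hl' Nz']] : exists z', [/\ V' i'.+1 z', link z' u' v' & ~ exists w, List.In (w, z') p].
  apply: NNPP => H.
  suff : (size D).+1 <= size (map snd D) by rewrite size_map ltnn.
  apply: (@pigeon _ _ g) => // j Hj; apply/In_map_snd.
  have [Vg Lg] := Hg1 j Hj.
  have [w Hw] : exists w, List.In (w, g j) p by apply: NNPP => H'; apply: H; exists (g j).
  exists w; apply: inD => //=.
  have [u2 [v2 [I1 I2 I3]]] := g_link' G Hw Lg.
  have -> : u = u2 by apply/(g_inj G Hu I1).
  by have -> : v = v2 by apply/(g_inj G Hv I2).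
have Zz : isZ z by exists u, v.
have Zz' : isZ z' by exists u', v'.
have [_ [_ nAz']] := link_A T' Hl'.
exists ((z, z') :: p); last by split=> [w Hw|]; [right|exists z'; left].
split.
- move=> w w' x x' /= [[<- <-]|H1] [[<- <-]|H2]; [by []|..|exact: (g_inj G H1 H2)].
    by split=> E0; subst; [case: Fz; exists x'|case: Nz'; exists x].
  by split=> E0; subst; [case: Fz; exists w'|case: Nz'; exists w].
- by move=> w w' /= [[<- <-]|/(g_sort G)//]; split.
- by move=> w w' /= [[<- <-]|/(g_lab G)].
- have B0 w : ~ below z w by move=> B; apply: nAz; exists w.
  have B1 w : ~ below w z by move=> /(below_A T).
  have B2 w : ~ below z' w by move=> B; apply: nAz'; exists w.
  have B3 w : ~ below w z' by move=> /(below_A T').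
  move=> w w' x x' /= [[<- <-]|H1] [[<- <-]|H2]; last exact: (g_lt G H1 H2).
  + by split=> B; [case: (B0 _ B)|case: (B2 _ B)].
  + by split=> B; [case: (B0 _ B)|case: (B2 _ B)].
  + by split=> B; [case: (B1 _ B)|case: (B3 _ B)].
- move=> y y' /= [[<- <-]|H1] Yy; first by case: Yy.
  by apply: (@match_chain_sub p); [right|exact: (g_Y G)].
- move=> w w' x y /= [[<- <-]|H1] Hlw.
    have [-> ->] := link_fun T Hlw Hl.
    by exists u', v'; split=> //; right.
  by have [x' [y' [? ? ?]]] := g_link G H1 Hlw; exists x', y'; split=> //; right.
- move=> w w' x y /= [[<- <-]|H1] Hlw.
    have [-> ->] := link_fun T' Hlw Hl'.
    by exists u, v; split=> //; right.
  by have [x' [y' [? ? ?]]] := g_link' G H1 Hlw; exists x', y'; split=> //; right.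
- move=> w w' /= [[<- <-]|/(g_V G)[? ?]]; first by [].
  by split=> //; apply: (V_mono T').
- exists ((z, z') :: pz) => // w w' /= [[<- <-]|H1] Hw; first by left.
  by right; apply: Hz.
Qed.

(* One move of the back-and-forth game; [K] bounds the number of elementary extensions. *)
Lemma extend m i j i' p b : good m i i' p -> Q m.+1 -> i <= j -> V j b ->
  exists K p', [/\ good m.+1 j (i' + K) p', forall u, List.In u p -> List.In u p',
    exists b', List.In (b, b') p' &
    K <= 3 \/ exists y s ls, [/\ isY y, chain labof y 0 s ls & K <= size s + 3]].
Proof.
move=> G0 Qm ij Vb; have G : good m j i' p by apply: good_leq G0.
have [Ab|nA] := classic (isA b).
  have [p' G' [S' H']] := extend_A G Ab Vb.
  exists 1, p'; split=> //; [by rewrite addn1; apply: good_mS|by left].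
have [[u [v Hl]]|nZ] := classic (isZ b); last first.
  have Yb : isY b by split.
  have [s [ls [C [p' G' [S' H']]]]] := extend_Y G Yb Vb.
  exists (size s).+1, p'; split=> //; first exact: good_mS.
  by right; exists b, s, ls; split=> //; lia.
have [Vu Vv] := V_link T Vb Hl.
have [Av [[Euv|Yu] _]] := link_A T Hl.
  subst; have [p1 G1 [S1 H1]] := extend_A G Av Vv.
  have [p2 G2 [S2 H2]] := extend_Z G1 Qm Vb Hl H1 H1.
  exists 2, p2; split=> //; [by rewrite addnS addn1|by move=> w /S1/S2|by left].
have [s [ls [C [p1 G1 [S1 [u' Hu]]]]]] := extend_Y G Yu Vu.
have [p2 G2 [S2 [v' Hv]]] := extend_A G1 Av Vv.
have Hu2 : exists u', List.In (u, u') p2 by exists u'; apply: S2.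
have [p3 G3 [S3 H3]] := extend_Z G2 Qm Vb Hl Hu2 (ex_intro _ v' Hv).
exists (size s + 3), p3; split=> //.
- by rewrite addnA addnS addnS addn1; rewrite addnS in G3.
- by move=> w /S1/S2/S3.
- by right; exists u, s, ls.
Qed.

End Extension.

(* Quantifiers of depth [t] range over [R t] only. *)
Fixpoint satR (N : structure L0) (R : nat -> N -> Prop) t (v : nat -> N) (phi : formula L0) : Prop :=
  match phi with
  | Not p => ~ satR R t v p
  | And p q => satR R t v p /\ satR R t v q
  | Ex n p => exists2 a, R t.+1 a & satR R t.+1 (update v n a) p
  | _ => sat v phi
  end.

Lemma satR_True (N : structure L0) t (v : nat -> N) phi :
  satR (fun _ _ => True) t v phi <-> sat v phi.
Proof.
elim: phi t v => //= [p IH|p IHp q IHq|n p IH] t v; first by rewrite IH.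
  by rewrite IHp IHq.
by split=> [[a _ /IH Ha]|[a /IH Ha]]; exists a.
Qed.

Fixpoint rank (phi : formula L0) : nat :=
  match phi with
  | Not p => rank p
  | And p q => maxn (rank p) (rank q)
  | Ex n p => (rank p).+1
  | _ => 0
  end.

(** * The game with restricted quantifiers *)

Section Game.
Variables (E : rel nat) (Q : nat -> Prop) (pres : label -> Prop) (N N' : structure L0).
Variables (V : nat -> N -> Prop) (V' : nat -> N' -> Prop).
Variables (labof : N -> label -> Prop) (labof' : N' -> label -> Prop).
Hypotheses (W : view E Q pres V labof) (W' : view E Q pres V' labof').
Hypothesis Qdown : forall k l, l <= k -> Q k -> Q l.

Lemma good_lt_link m i i' p (G : good V V' labof labof' m i i' p) u u' v v' w w' :
  List.In (u, u') p -> List.In (v, v') p -> List.In (w, w') p ->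
  link u v w <-> link u' v' w'.
Proof.
move=> Hu Hv Hw; split.
  move=> /(g_link G Hu)[v2 [w2 [Iv Iw]]].
  have -> : v' = v2 by apply/(g_inj G Hv Iv).
  by have -> : w' = w2 by apply/(g_inj G Hw Iw).
move=> /(g_link' G Hu)[v2 [w2 [Iv Iw]]].
have -> : v = v2 by apply/(g_inj G Hv Iv).
by have -> : w = w2 by apply/(g_inj G Hw Iw).
Qed.

Lemma good_nil i i' : good V V' labof labof' 0 i i' [::].
Proof. by split=> //; exists [::]. Qed.

Lemma extend_back m i j i' p b : good V V' labof labof' m i i' p -> Q m.+1 -> i' <= j -> V' j b ->
  exists K p', [/\ good V V' labof labof' m.+1 (i + K) j p', forall u, List.In u p -> List.In u p',
    exists a, List.In (a, b) p' &
    K <= 3 \/ exists y s ls, [/\ isY y, chain labof' y 0 s ls & K <= size s + 3]].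
Proof.
move=> /good_sym G Qm ij Vb.
have [K [p' [G' S' [a Ha] HK]]] := extend W' W Qdown G Qm ij Vb.
exists K, (map (@swap N' N) p'); split=> //; first exact: (good_sym G').
  by move=> [w w'] Hw; apply/In_swap; apply: S'; apply/In_swap.
by exists a; apply/In_swap.
Qed.

Variable K : nat.
Hypotheses (HK : forall y s ls, isY y -> chain labof y 0 s ls -> size s + 3 <= K).
Hypotheses (HK' : forall y s ls, isY y -> chain labof' y 0 s ls -> size s + 3 <= K).
Hypothesis K3 : 3 <= K.

(** Each quantifier is one move. A move adds an element together with at most its endpoints and a
    chain of pointers, which costs at most [K] stages of the filtration, so depth [t] is played at
    stage [K * t]. The hypothesis [Q (t + rank phi)] leaves room for one new link in each remaining
    move. *)
Lemma satR_game phi t p v v' :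
  good V V' labof labof' t (K * t) (K * t) p ->
  (forall n, free_in n phi -> List.In (v n, v' n) p) ->
  Q (t + rank phi) ->
  satR (fun t => V (K * t)) t v phi <-> satR (fun t => V' (K * t)) t v' phi.
Proof.
elim/formula_ind0: phi t p v v' => [i j|i j|i j k|phi IH|phi psi IHp IHq|n phi IH] t p v v' G Hv HQ.
- have Hi := Hv i; have Hj := Hv j; move: Hi Hj; rewrite /= !eqxx orbT => Hi Hj.
  exact: (g_inj G (Hi isT) (Hj isT)).
- have H x : x \in [:: i; j] -> List.In (v x, v' x) p.
    move=> Hx; apply: Hv => /=; apply/existsP.
    by move: Hx; rewrite !inE => /orP[]/eqP ->; [exists ord0|exists (inord 1 : 'I_2)]; rewrite ffunE ?inordK //= eqxx.
  change (sat v (fLt i j) <-> sat v' (fLt i j)); rewrite !sat_fLt.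
  by apply: (g_lt G); apply: H; rewrite !inE eqxx ?orbT.
- have H x : x \in [:: i; j; k] -> List.In (v x, v' x) p.
    move=> Hx; apply: Hv => /=; apply/existsP.
    by move: Hx; rewrite !inE => /or3P[]/eqP ->;
      [exists ord0|exists (inord 1 : 'I_3)|exists (inord 2 : 'I_3)]; rewrite ffunE ?inordK //= eqxx.
  change (sat v (fLink i j k) <-> sat v' (fLink i j k)); rewrite !sat_fLink.
  by apply: (good_lt_link G); apply: H; rewrite !inE eqxx ?orbT.
- by have := IH t p v v' G Hv HQ => /=; tauto.
- have H1 : satR (fun t => V (K * t)) t v phi <-> satR (fun t => V' (K * t)) t v' phi.
    apply: (IHp _ _ _ _ G); first by move=> n Hn; apply: Hv; rewrite /= Hn.
    by apply: Qdown HQ; rewrite /= leq_add2l leq_maxl.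
  have H2 : satR (fun t => V (K * t)) t v psi <-> satR (fun t => V' (K * t)) t v' psi.
    apply: (IHq _ _ _ _ G); first by move=> n Hn; apply: Hv; rewrite /= Hn orbT.
    by apply: Qdown HQ; rewrite /= leq_add2l leq_maxr.
  by rewrite /= H1 H2.
- have Q1 : Q t.+1 by apply: Qdown HQ => /=; lia.
  have KK : K * t <= K * t.+1 by rewrite leq_mul2l leqnSn orbT.
  have HQ' : Q (t.+1 + rank phi) by rewrite addSn -addnS.
  have step a a' p' : (forall u, List.In u p -> List.In u p') -> List.In (a, a') p' ->
      forall m, free_in m phi -> List.In (update v n a m, update v' n a' m) p'.
    move=> S' H m Hm; rewrite /update; case: eqP => // /eqP mn.
    by apply: S'; apply: Hv; rewrite /= mn Hm.
  split=> -[a Va Ha].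
    have [k [p' [G' S' [a' Ha'] Hk]]] := extend W W' Qdown G Q1 KK Va.
    have G2 : good V V' labof labof' t.+1 (K * t.+1) (K * t.+1) p'.
      apply: (good_leq W W') G' => //; rewrite mulnS addnC leq_add2r.
      case: Hk => [|[y [s [ls [Yy C]]]]]; first by move/leq_trans; apply.
      by move/leq_trans; apply; apply: HK Yy C.
    exists a'; first by case: (g_V G2 Ha').
    by apply/(IH _ _ _ _ G2 (step _ _ _ S' Ha') HQ').
  have [k [p' [G' S' [a' Ha'] Hk]]] := extend_back G Q1 KK Va.
  have G2 : good V V' labof labof' t.+1 (K * t.+1) (K * t.+1) p'.
    apply: (good_leq W W') G' => //; rewrite mulnS addnC leq_add2r.
    case: Hk => [|[y [s [ls [Yy C]]]]]; first by move/leq_trans; apply.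
    by move/leq_trans; apply; apply: HK' Yy C.
  exists a'; first by case: (g_V G2 Ha').
  by apply/(IH _ _ _ _ G2 (step _ _ _ S' Ha') HQ').
Qed.

End Game.

(** * From back-and-forth to isomorphism *)

Lemma tuple2 (T : Type) (a : 2.-tuple T) : exists u v, a = [tuple u; v].
Proof. by case: a => -[|u [|v []]] // H; exists u, v; apply: val_inj. Qed.

Lemma tuple3 (T : Type) (a : 3.-tuple T) : exists u v w, a = [tuple u; v; w].
Proof. by case: a => -[|u [|v [|w []]]] // H; exists u, v, w; apply: val_inj. Qed.

Section Isomorphism.
Variables (E : rel nat) (pres : label -> Prop) (N N' : structure L0).
Variables (labof : N -> label -> Prop) (labof' : N' -> label -> Prop).
Notation noV := (fun _ _ => True).
Notation noQ := (fun _ => True).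
Hypotheses (W : view E noQ pres noV labof) (W' : view E noQ pres noV labof').
Hypotheses (CN : countable_structure N) (CN' : countable_structure N').

Let pgood p := exists m, @good N N' noV noV labof labof' m 0 0 p.

Lemma pgood_ext (code : N -> nat) (code' : N' -> nat) n p : injective code -> injective code' -> pgood p ->
  exists p', [/\ pgood p', forall u, List.In u p -> List.In u p',
    forall u : N, code u = n -> exists u', List.In (u, u') p' &
    forall u' : N', code' u' = n -> exists u, List.In (u, u') p'].
Proof.
move=> Ic Ic' [m G].
have triv k l q i i' : good noV noV labof labof' k i i' q -> l = k -> pgood q.
  by case=> *; exists k; split.
have [p1 [P1 S1 H1]] : exists p1, [/\ pgood p1, forall u, List.In u p -> List.In u p1 &
    forall u : N, code u = n -> exists u', List.In (u, u') p1].
  have [[u Hu]|F] := classic (exists u, code u = n); last first.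
    by exists p; split=> //; [exists m|move=> u Hu; case: F; exists u].
  have [K [p1 [G1 S1 H1 _]]] := extend W W' (fun _ _ _ _ => I) G I (leqnn 0) (b := u) I.
  by exists p1; split=> // [|w]; [apply: triv G1 erefl|rewrite -Hu => /Ic ->].
case: P1 => m1 G1.
have [[u Hu]|F] := classic (exists u, code' u = n); last first.
  by exists p1; split=> //; [exists m1|move=> u Hu; case: F; exists u].
have [K [p2 [G2 S2 H2 _]]] := extend_back W W' (fun _ _ _ _ => I) G1 I (leqnn 0) (b := u) I.
exists p2; split=> //; first exact: triv G2 erefl.
- by move=> w /S1/S2.
- by move=> w /H1[w' /S2]; exists w'.
- by move=> w; rewrite -Hu => /Ic' ->.
Qed.

(** The isomorphism is the union of a growing sequence of finite partial isomorphisms, round [n]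
    dealing with the elements of code [n] on both sides. Relations have arity at most three and any
    three pairs occur together at some stage, so the union preserves them. *)
Lemma view_isomorphic : isomorphic N N'.
Proof.
have [code Ic] := CN; have [code' Ic'] := CN'.
have step (n : nat) (p : {p | pgood p}) : {q : {q | pgood q} |
    [/\ forall u, List.In u (sval p) -> List.In u (sval q),
    forall u : N, code u = n -> exists u', List.In (u, u') (sval q) &
    forall u' : N', code' u' = n -> exists u, List.In (u, u') (sval q)]}.
  apply: constructive_indefinite_description.
  have [q [Hq H1 H2 H3]] := pgood_ext n Ic Ic' (proj2_sig p).
  by exists (exist _ q Hq).
have P0 : pgood [::] by exists 0; split=> //; exists [::].
pose F := fix F n := if n is k.+1 then sval (step k (F k)) else exist pgood [::] P0.
have FS n : F n.+1 = sval (step n (F n)) by [].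
have SP n : [/\ forall u, List.In u (sval (F n)) -> List.In u (sval (F n.+1)),
    forall u : N, code u = n -> exists u', List.In (u, u') (sval (F n.+1)) &
    forall u' : N', code' u' = n -> exists u, List.In (u, u') (sval (F n.+1))].
  by rewrite FS; apply: (proj2_sig (step n (F n))).
have mono i j u : i <= j -> List.In u (sval (F i)) -> List.In u (sval (F j)).
  move=> ij Hu; rewrite -(subnKC ij); elim: (j - i) => [|k IH]; first by rewrite addn0.
  by rewrite addnS; case: (SP (i + k)) => H _ _; apply: H.
have tot u : exists u', exists n, List.In (u, u') (sval (F n)).
  have [u' H] : exists u', List.In (u, u') (sval (F (code u).+1)).
    by case: (SP (code u)) => _ H _; apply: H.
  by exists u', (code u).+1.
have tot' u' : exists u, exists n, List.In (u, u') (sval (F n)).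
  have [u H] : exists u, List.In (u, u') (sval (F (code' u').+1)).
    by case: (SP (code' u')) => _ _ H; apply: H.
  by exists u, (code' u').+1.
have join3 u u' v v' w w' : (exists n, List.In (u, u') (sval (F n))) ->
    (exists n, List.In (v, v') (sval (F n))) -> (exists n, List.In (w, w') (sval (F n))) ->
    exists m p, good noV noV labof labof' m 0 0 p /\
      [/\ List.In (u, u') p, List.In (v, v') p & List.In (w, w') p].
  move=> [i Hi] [j Hj] [k Hk]; have [m G] := proj2_sig (F (i + j + k)).
  exists m, (sval (F (i + j + k))); split=> //; split.
  - by apply: mono Hi; lia.
  - by apply: mono Hj; lia.
  - by apply: mono Hk; lia.
pose h u := sval (constructive_indefinite_description _ (tot u)).
pose h' u' := sval (constructive_indefinite_description _ (tot' u')).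
have Hh u : exists n, List.In (u, h u) (sval (F n)) by rewrite /h; case: constructive_indefinite_description.
have Hh' u : exists n, List.In (h' u, u) (sval (F n)) by rewrite /h'; case: constructive_indefinite_description.
exists h; split.
- exists h' => u.
    have [m [p [G [I1 I2 _]]]] := join3 _ _ _ _ _ _ (Hh u) (Hh' (h u)) (Hh u).
    by apply/(g_inj G I2 I1).
  have [m [p [G [I1 I2 _]]]] := join3 _ _ _ _ _ _ (Hh' u) (Hh (h' u)) (Hh' u).
  by apply/(g_inj G I2 I1).
- by case.
- move=> r; have [->|->] := rsymP r => a.
    have [u [v ->]] := tuple2 a.
    have -> : map_tuple h [tuple u; v] = [tuple h u; h v] by apply: val_inj.
    have [m [p [G [I1 I2 _]]]] := join3 _ _ _ _ _ _ (Hh u) (Hh v) (Hh u).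
    exact: (g_lt G I1 I2).
  have [u [v [w ->]]] := tuple3 a.
  have -> : map_tuple h [tuple u; v; w] = [tuple h u; h v; h w] by apply: val_inj.
  have [m [p [G [I1 I2 I3]]]] := join3 _ _ _ _ _ _ (Hh u) (Hh v) (Hh w).
  exact: (good_lt_link G I1 I2 I3).
Qed.

End Isomorphism.

(** * Labelling tree structures *)

Definition present (fin : pred nat) (pI pL : Prop) (l : label) : Prop :=
  match l with Fin n => 0 < n /\ fin n | Least => pL | Inf => pI end.

(** Infinite relative to [fin]: the level is infinite, or finite but outside [fin]. With [predT]
    this is genuinely infinite level. *)
Definition beyond (fin : pred nat) (N : structure L0) (a : N) : Prop :=
  isA a /\ forall n, cex a a n -> ~~ fin n.

Definition label_of (fin : pred nat) (N : structure L0) (least : N -> Prop) (a : N) l : Prop :=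
  isA a /\ match l with
           | Fin n => cex a a n /\ fin n
           | Least => least a
           | Inf => beyond fin a /\ ~ least a
           end.

(** * The tree axioms provide a view *)

Section ViewOfTree.
Variables (E : rel nat) (N : structure L0) (Q : nat -> Prop) (V : nat -> N -> Prop).
Hypothesis T : tree_axioms E Q V.
Variables (fin : pred nat) (least : N -> Prop) (pI pL : Prop).
Hypotheses (E_lt : forall m n, E m n -> m < n)
  (fin_down : forall m n, m <= n -> fin n -> fin m)
  (Qdown : forall k l, l <= k -> Q k -> Q l)
  (fin_Q : forall n, fin n -> Q n.+1) (Q1 : Q 1)
  (Q_fin : forall n k, ~~ fin n -> Q k -> k <= n)
  (E_acc : Acc (fun n m => E m n && fin n) 0)
  (least_inf : forall a, least a -> beyond fin a)
  (least_min : forall a b, least a -> beyond fin b -> a = b \/ below a b)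
  (least_V : forall a, least a -> V 0 a)
  (least_pL : (exists a, least a) <-> pL)
  (inf_pI : forall a : N, beyond fin a -> ~ least a -> pI)
  (pI_inf : pI -> exists a, [/\ V 0 a, beyond fin a & ~ least a])
  (inf_dn : forall i b, V i b -> beyond fin b -> ~ least b ->
     exists c, [/\ V i.+1 c, beyond fin c, ~ least c & below c b]).
Notation labof := (label_of fin least).
Implicit Types (a b y : N) (s e : seq N).

Lemma lab_total a : isA a -> exists l, labof a l.
Proof.
move=> Aa; have [[n [Hn Fn]]|H] := classic (exists n, cex a a n /\ fin n).
  by exists (Fin n).
have Ia : beyond fin a by split=> // n Hn; apply/negP => Fn; apply: H; exists n.
by have [L|L] := classic (least a); [exists Least|exists Inf].
Qed.

Lemma lab_beyond a l : labof a l -> ~~ is_fin l -> beyond fin a.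
Proof. by case: l => [n||] [_] // => [/least_inf|[]]. Qed.

Lemma lab_fun a l l' : labof a l -> labof a l' -> l = l'.
Proof.
case: l l' => [m||] [n||] [Aa H] [_ H'] //.
- by congr Fin; apply: cex_inj (proj1 H) (proj1 H').
- by have [_ /(_ m (proj1 H))] := least_inf H'; rewrite (proj2 H).
- by have [[_ /(_ m (proj1 H)) Fm] _] := H'; rewrite (proj2 H) in Fm.
- by have [_ /(_ n (proj1 H'))] := least_inf H; rewrite (proj2 H').
- by case: H'.
- by have [[_ /(_ n (proj1 H')) Fm] _] := H; rewrite (proj2 H') in Fm.
- by case: H.
Qed.

Lemma beyond_up a b : below a b -> beyond fin a -> beyond fin b.
Proof.
move=> Bab [Aa Ha]; split=> [|n Hn]; first exact: (below_A T Bab).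
apply/negP => Fn.
have Hk k : cge a a k -> k <= n by move/(lev_mono T Bab) => /(cex_cge _ Hn).
have [[m Hm]|Hm] := cexVcge a a; last by have := Hk n.+1 (Hm _); rewrite ltnn.
have mn : m <= n by apply: Hk; case: Hm.
by have := Ha m Hm; rewrite (fin_down mn Fn).
Qed.

Lemma lab_mono a b l l' : below a b -> labof a l -> labof b l' -> lle l l'.
Proof.
move=> Bab La Lb; case Fl' : (is_fin l'); last first.
  case: l La => [m||] La; case: l' Lb Fl' => [n||] Lb //= _.
  have [Eab|Bba] := least_min (proj2 Lb) (proj1 (proj2 La)).
    by subst; case: (below_irr T Bab).
  by case: (below_irr T (below_trans T Bab Bba)).
case: l' Lb Fl' => [n||] Lb // _.
case Fl : (is_fin l); last first.
  have [_ /(_ n (proj1 (proj2 Lb)))] := beyond_up Bab (lab_beyond La (negbT Fl)).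
  by rewrite (proj2 (proj2 Lb)).
case: l La Fl => [m||] La // _ /=.
have [_ [Hm _]] := La; have [_ [Hn _]] := Lb.
by apply/(cex_cge _ Hn); apply: (lev_mono T Bab); case: Hm.
Qed.

Lemma lab_below a b l l' : labof a l -> labof b l' -> lle l l' -> l <> l' -> below a b.
Proof.
move=> La Lb H ne; have [//|[Eab|Bba]] := below_total T (proj1 La) (proj1 Lb).
  by subst; case: ne; apply: lab_fun La Lb.
by case: ne; apply: lle_anti H (lab_mono Bba Lb La).
Qed.

Lemma list_max (s : seq N) : (forall a, List.In a s -> isA a) ->
  s = [::] \/ exists2 a, List.In a s & forall u, List.In u s -> u = a \/ below u a.
Proof.
elim: s => [|b s IH] H; [by left|right].
have Ab : isA b by apply: H; left.
have [|->|[a Ha1 Ha2]] := IH; first by move=> u Hu; apply: H; right.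
  by exists b; [left|move=> u [->|//]; left].
have Aa : isA a by apply: H; right.
have [Bba|Bab] : (below b a \/ b = a) \/ below a b by have := below_total T Ab Aa; tauto.
  by exists a; [right|move=> u [<-|/Ha2//]; tauto].
exists b; [by left|move=> u [->|/Ha2[->|Bua]]; [by left|by right|right]].
exact: (below_trans T Bua Bab).
Qed.

Lemma list_min (s : seq N) : (forall a, List.In a s -> isA a) ->
  s = [::] \/ exists2 a, List.In a s & forall u, List.In u s -> u = a \/ below a u.
Proof.
elim: s => [|b s IH] H; [by left|right].
have Ab : isA b by apply: H; left.
have [|->|[a Ha1 Ha2]] := IH; first by move=> u Hu; apply: H; right.
  by exists b; [left|move=> u [->|//]; left].
have Aa : isA a by apply: H; right.
have [Bba|Bab] : (below a b \/ b = a) \/ below b a by have := below_total T Ab Aa; intuition.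
  by exists a; [right|move=> u [<-|/Ha2//]; tauto].
exists b; [by left|move=> u [->|/Ha2[->|Bua]]; [by left|by right|right]].
exact: (below_trans T Bab Bua).
Qed.

(** Bounds with a label other than [l] are on the right side of every element labelled [l], so only
    the greatest lower bound in [lo] and the least upper bound in [up] labelled [l] matter. With
    neither, the label just has to occur; with one, the absence of end points inside a label is
    used; with both, density. When [l] is [Least], no bound carries the label [l]. *)
Lemma tree_extA i (lo up : seq N) l : present fin pI pL l ->
  (forall a, List.In a lo -> [/\ V i a, isA a & exists2 l', labof a l' & lle l' l /\ (l = Least -> l' <> Least)]) ->
  (forall b, List.In b up -> [/\ V i b, isA b & exists2 l', labof b l' & lle l l' /\ (l = Least -> l' <> Least)]) ->
  (forall a b, List.In a lo -> List.In b up -> below a b) ->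
  exists c, [/\ V i.+1 c, isA c, labof c l, forall a, List.In a lo -> below a c
    & forall b, List.In b up -> below c b].
Proof.
move=> Pl Hlo Hup Hlu.
suff [c [Vc Lc C1 C2]] : exists c, [/\ V i.+1 c, labof c l,
    forall a, List.In a lo -> labof a l -> below a c &
    forall b, List.In b up -> labof b l -> below c b].
  exists c; split=> // [|a Ha|b Hb]; first by case: Lc.
    have [_ _ [l' L' [le _]]] := Hlo a Ha.
    have [El|ne] := classic (l' = l); first by subst; apply: C1.
    exact: lab_below L' Lc le ne.
  have [_ _ [l' L' [le _]]] := Hup b Hb.
  have [El|ne] := classic (l' = l); first by subst; apply: C2.
  by apply: lab_below Lc L' le _ => El; apply: ne.
have V0 c : V 0 c -> V i.+1 c by apply: (V_leq T).
have [lo' Hlo'] := In_filter_prop (labof^~ l) lo.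
have [up' Hup'] := In_filter_prop (labof^~ l) up.
have Alo a : List.In a lo' -> isA a by move=> /Hlo'[_ []].
have Aup a : List.In a up' -> isA a by move=> /Hup'[_ []].
have [Elo|[a Ia Ma]] := list_max Alo.
- have Nlo a : List.In a lo -> labof a l -> False.
    by move=> H1 H2; have : List.In a lo' by [apply/Hlo']; rewrite Elo.
  have [Eup|[b Ib Mb]] := list_min Aup.
    have Nup a : List.In a up -> labof a l -> False.
      by move=> H1 H2; have : List.In a up' by [apply/Hup']; rewrite Eup.
    suff [c [Vc Lc]] : exists c, V 0 c /\ labof c l.
      by exists c; split=> // [|a H1 /(Nlo a H1)|a H1 /(Nup a H1)] //; apply: V0.
    case: l Pl {Hlo Hup Hlo' Hup' Nlo Nup} => [n||] /= Pl.
    + have [c [Vc Ac Hc]] := lev_ex T (proj1 Pl) (Qdown (leqnSn n) (fin_Q (proj2 Pl))).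
      by exists c; split=> //; split=> //; split=> //; case: Pl.
    + have [c Hc] := proj2 least_pL Pl; exists c; split; first exact: least_V.
      by split=> //; case: (least_inf Hc).
    + by have [c [? [? ?] ?]] := pI_inf Pl; exists c.
  have [Hb Lb] : List.In b up /\ labof b l by apply/Hup'.
  have [Vb Ab [l' Lb' [_ Hl]]] := Hup b Hb.
  have El := lab_fun Lb Lb'; subst l'.
  suff [c [Vc Lc Bc]] : exists c, [/\ V i.+1 c, labof c l & below c b].
    exists c; split=> // [a H1 /(Nlo a H1)//|d Hd Ld].
    have [->//|Bd] : d = b \/ below b d by apply: Mb; apply/Hup'.
    exact: (below_trans T Bc Bd).
  case: l Pl Lb Hl {Hlo Hup Hlo' Hup' Nlo Lb'} => [n||] /= Pl Lb Hl; last 1 first.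
  + by have [c [? ? ? ?]] := inf_dn Vb (proj1 (proj2 Lb)) (proj2 (proj2 Lb)); exists c; split=> //; split=> //; exists b.
  + have [c [Vc Bc Hc]] := lev_dn T Vb Ab (proj1 (proj2 Lb)).
    by exists c; split=> //; split; [exists b|case: Pl].
  + by case: Hl.
have [Ha La] : List.In a lo /\ labof a l by apply/Hlo'.
have [Va Aa [l' La' [_ Hl]]] := Hlo a Ha.
have El := lab_fun La La'; subst l'.
have Inf_ok c : l = Inf -> below a c -> labof c l.
  move=> El Bc; subst; have Ic := beyond_up Bc (proj1 (proj2 La)).
  split; [by case: Ic|split=> // Lc].
  have [Eac|B] := least_min Lc (proj1 (proj2 La)).
    by subst; case: (proj2 (proj2 La)).
  by case: (below_irr T (below_trans T B Bc)).
have nLeast : l <> Least by move=> El; apply: (Hl El).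
have lo_c c : below a c -> forall a', List.In a' lo -> labof a' l -> below a' c.
  move=> Bc a' H1 H2; have [->//|Ba] : a' = a \/ below a' a by apply: Ma; apply/Hlo'.
  exact: (below_trans T Ba Bc).
have [Eup|[b Ib Mb]] := list_min Aup.
  have Nup d : List.In d up -> labof d l -> False.
    by move=> H1 H2; have : List.In d up' by [apply/Hup']; rewrite Eup.
  have [c [Vc Bc Hc]] := lev_up T Va Aa.
  exists c; split=> // [|a' H1 H2|d H1 /(Nup d H1)//]; last exact: lo_c.
  case: l Pl La Inf_ok nLeast {Hlo Hup Hlo' Hup' Nup La' Hl lo_c} => [n||] // Pl La Inf_ok _; last exact: Inf_ok.
  split; first exact: (below_A T Bc).
  have [_ [[G1 G2] Fn]] := La; split=> //; split; first exact: (lev_mono T Bc).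
  by move/Hc.
have [Hb Lb] : List.In b up /\ labof b l by apply/Hup'.
have [Vb Ab _] := Hup b Hb.
have [c [Vc Bac Bcb]] := below_dense T Va Vb (Hlu a b Ha Hb).
exists c; split=> // [|a' H1 H2|d Hd Ld].
- case: l Pl La Lb Inf_ok nLeast {Hlo Hup Hlo' Hup' La' Hl lo_c} => [n||] // Pl La Lb Inf_ok _; last exact: Inf_ok.
  split; first exact: (below_A T Bac).
  have [_ [[G1 G2] Fn]] := La; have [_ [[G3 G4] _]] := Lb.
  split=> //; split; first exact: (lev_mono T Bac).
  by move/(lev_mono T Bcb).
- exact: lo_c.
- have [->//|Bd] : d = b \/ below b d by apply: Mb; apply/Hup'.
  exact: (below_trans T Bcb Bd).
Qed.

(** A pointer of colour [n > 0] has a predecessor of level [n], and [y] has at most one pointer of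
    each finite level. So the predecessor is [b], and the edge it comes with is [E c n]. *)
Lemma next_E (y b b' : N) c n : isY y -> isA b -> isA b' -> cex y b c -> cex b b n ->
  cex y b' n -> E c n.
Proof.
move=> Yy Ab Ab' Hb Hn Hb'.
have n0 : 0 < n by have := lev_pos T Ab; rewrite (cex_cge _ Hn).
have [a [c' [Aa H1 H2 H3]]] := ptr_prev T Yy Ab' Hb' n0.
have Eab := ptr_inj T Yy Aa Ab H1 Hb H2 Hn; subst.
by rewrite (cex_inj Hb H1).
Qed.

(** Well-foundedness of [E] on [fin] ends the chain: passing from a pointer with finite label to the
    next follows an edge of [E] into [fin]. For genuine models this is where the absence of an
    infinite path enters. *)
Lemma tree_chain y : isY y -> exists s ls, chain labof y 0 s ls.
Proof.
move=> Yy; elim: E_acc => c _ IH.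
have [[b [Ab Hb]]|F] := classic (exists b, isA b /\ cex y b c); last first.
  by exists [::], [::]; constructor=> b Ab Hb; apply: F; exists b.
have [l Hl] := lab_total Ab.
case Fl : (is_fin l); last by exists [:: b], [:: l]; constructor=> //; rewrite Fl.
case: l Hl Fl => [n||] // Hl _; have [_ [Hn Fn]] := Hl.
have [[b' [Ab' Hb']]|F] := classic (exists b, isA b /\ cex y b n).
  have [|s [ls C]] := IH n; first by rewrite (next_E Yy Ab Ab' Hb Hn Hb') Fn.
  by exists (b :: s), (Fin n :: ls); apply: ch_cons.
exists [:: b], [:: Fin n]; apply: ch_cons => //; constructor.
by move=> d Ad Hd; apply: F; exists d.
Qed.

(** Every label but the last is finite and raises the colour. A list of length at least 2 therefore
    has length at most its last colour plus one, and that colour belongs to [fin]. *)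
Lemma legal_size c ls : legal E c ls -> (forall n, List.In (Fin n) ls -> fin n) ->
  size ls <= 1 \/ exists2 n, fin n & c + size ls <= n.+1.
Proof.
elim: ls c => [|l ls IH] c; first by left.
case: ls IH => [|l' ls] IH; first by left.
move=> H Hf; right; move: H => /andP[Hc].
rewrite [nilp _]/= orFb; case: l Hc Hf => [n||] // Hc Hf /andP[_ HL].
have Fn : fin n by apply: Hf; left.
have [|H1|[n' Fn' Hn']] := IH n HL; first by move=> m Hm; apply: Hf; right.
  by exists n => //; move: H1 => /=; lia.
by exists n' => //; move: Hn' => /=; lia.
Qed.

Lemma chain_fin y c s ls n : chain labof y c s ls -> List.In (Fin n) ls -> fin n.
Proof.
elim=> {c s ls} [//|c b l _ _ _ Hl [El|//]|c b m s ls _ _ [_ [_ Fm]] _ IH [[<-]//|/IH//]].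
by rewrite El in Hl.
Qed.

Lemma tree_legal y s ls : isY y -> chain labof y 0 s ls -> legal E 0 ls /\ Q (size s).
Proof.
move=> Yy C.
have HL : legal E 0 ls.
  elim: C => {s ls} [//|c b l _ _ _ Hl|c b n s ls Ab Hb Hn C IH].
    by case: l Hl.
  have [_ [Hbn _]] := Hn.
  have -> : legal E c (Fin n :: ls) = (c < n) && (nilp ls || E c n && legal E n ls) by [].
  have -> /= : c < n by have := ptr_lev T Yy Ab Hb; rewrite (cex_cge _ Hbn).
  rewrite IH andbT; inversion C; subst=> //=; apply: (next_E Yy Ab _ Hb Hbn); eassumption.
split=> //; rewrite (Forall2_size (chain_lab C)).
have [H|[n Fn Hn]] := legal_size HL (fun n => @chain_fin y 0 s ls n C).
  exact: Qdown H Q1.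
by apply: (Qdown _ (fin_Q Fn)); exact: Hn.
Qed.

Lemma list_levels c s ls a0 : legal E c ls -> List.Forall2 labof s ls -> 0 < size s ->
  (c = 0 \/ fin c) ->
  [/\ nth 0 (cols c ls) 0 = c,
    forall j, j < (size s).-1 -> cex (nth a0 s j) (nth a0 s j) (nth 0 (cols c ls) j.+1) /\
      E (nth 0 (cols c ls) j) (nth 0 (cols c ls) j.+1) &
    cge (nth a0 s (size s).-1) (nth a0 s (size s).-1) (nth 0 (cols c ls) (size s).-1).+1].
Proof.
move=> + H; elim: H c => {s ls} [//|a l s ls Hl F IH] c /= /andP[Hc HL] _ c0.
split=> //.
  case: F IH HL => [//|a' l' s' ls' Ha' F'] IH /=.
  case: l Hl Hc => [n||] // [Aa [Hn Fn]] Hc /andP[En HL] [|j] Hj //=.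
  by have [|||_ H _] := IH n _ _ _ => //; [right|apply: (H j)].
case: F IH HL => [|a' l' s' ls' Ha' F'] IH HL /=.
  case: l Hl Hc {HL} => [n||] Hl Hc.
  - by apply/(cex_cge _ (proj1 (proj2 Hl))).
  - have [[m Hm]|//] := cexVcge a a; apply/(cex_cge _ Hm).
    have [Aa /(_ m Hm) Fm] := lab_beyond Hl isT.
    case: c0 => [c0|Fc]; first by have := lev_pos T Aa; rewrite (cex_cge _ Hm) c0.
    by rewrite ltnNge; apply: contra Fm => mc; apply: fin_down Fc.
  - have [[m Hm]|//] := cexVcge a a; apply/(cex_cge _ Hm).
    have [Aa /(_ m Hm) Fm] := lab_beyond Hl isT.
    case: c0 => [c0|Fc]; first by have := lev_pos T Aa; rewrite (cex_cge _ Hm) c0.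
    by rewrite ltnNge; apply: contra Fm => mc; apply: fin_down Fc.
case: l Hl Hc HL => [n||] // [Aa [Hn Fn]] Hc /andP[En HL].
by have [|||_ _ H] := IH n _ _ _ => //; right.
Qed.

Lemma list_chain y c s ls a0 : legal E c ls -> List.Forall2 labof s ls -> 0 < size s ->
  (forall a, List.In a s -> isA a) ->
  (forall j, j <= (size s).-1 -> cex y (nth a0 s j) (nth 0 (cols c ls) j)) ->
  (forall n b, isA b -> cex (nth a0 s (size s).-1) (nth a0 s (size s).-1) n -> ~ cex y b n) ->
  chain labof y c s ls.
Proof.
move=> + H; elim: H c => {s ls} [//|a l s ls Hl F IH] c /= /andP[Hc HL] _ As Hp Hs.
have Aa : isA a by apply: As; left.
have Ha : cex y a c := Hp 0 isT.
case: F IH HL Hp Hs As => [|a' l' s' ls' Ha' F'] IH HL Hp Hs As.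
  case Fl : (is_fin l); last by apply: ch_stop => //; rewrite Fl.
  case: l Hl Fl {Hc HL Hp} => [n||] // Hl _; apply: ch_cons => //; constructor=> b Ab.
  by apply: Hs => //; case: Hl => _ [].
case: l Hl Hc HL Hp => [n||] // Hl Hc /andP[En HL] Hp; apply: ch_cons => //.
apply: IH => // [b Hb|j Hj]; first by apply: As; right.
exact: (Hp j.+1).
Qed.

Lemma tree_extY i (s : seq N) ls (e : seq N) : legal E 0 ls -> Q (size s) ->
  List.Forall2 labof s ls -> (forall a, List.In a s -> V i a /\ isA a) ->
  (forall u, List.In u e -> V i u) ->
  exists y, [/\ V i.+1 y, isY y, ~ List.In y e & chain labof y 0 s ls].
Proof.
move=> HL Qs F Hs He; case Es : s => [|a0 s0].
  have [y [H1 H2 H3 H4]] := y_nil T He.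
  by move: F; rewrite Es => F; inversion F; exists y; split=> //; constructor.
rewrite -Es.
have s1 : 0 < size s by rewrite Es.
have Asj j : j <= (size s).-1 -> V i (nth a0 s j) /\ isA (nth a0 s j).
  by move=> Hj; apply: Hs; apply: In_nth; rewrite -(prednK s1) ltnS.
have [H1 H2 H3] := list_levels a0 HL F s1 (or_introl erefl).
have [|y [Vy Yy Ny Hy Sy]] := y_ex T (k := (size s).-1) (x := nth a0 s) (ns := nth 0 (cols 0 ls)) (e := e) _ Asj He H1 H2 H3.
  by rewrite prednK.
exists y; split=> //; apply: list_chain HL F s1 _ Hy Sy.
by move=> a /Hs[].
Qed.

Lemma next_in_chain y c s ls a0 c0 c' a : isY y -> chain labof y c s ls ->
  List.In (a0, c0) (zip s (cols c ls)) -> labof a0 (Fin c') -> isA a -> cex y a c' ->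
  List.In a s.
Proof.
move=> Yy C; elim: C => {c s ls} [//|c b l Ab Hb Hl Fl|c b n s ls Ab Hb Hn C IH].
  case: l Hl Fl => [//||] Hl _ /= [[E0 _]|//] L0; rewrite E0 in Hl.
    by have := lab_fun L0 Hl.
  by have := lab_fun L0 Hl.
rewrite [cols _ _]/= [zip _ _]/= => -[[E0 _]|H] L0 Aa Ha; last by right; apply: IH H L0 Aa Ha.
rewrite E0 in Hn; have [En] := lab_fun L0 Hn; subst n; right.
inversion C as [? F|? b1 l1 Ab1 Hb1|? b1 ? ? ? Ab1 Hb1]; subst.
- by case: (F a Aa).
- by left; apply: (ptr_uniq T Yy Ab1 Aa Hb1 Ha).
- by left; apply: (ptr_uniq T Yy Ab1 Aa Hb1 Ha).
Qed.

(** Induction on the colour: the predecessor of [a] has a smaller colour and lies in the chain; its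
    label is [Fin c], so the chain continues with a pointer of colour [c], which is [a]. Hence
    colours off the chain are out of reach of [Q]. *)
Lemma ptr_in_chain y s ls a c : isY y -> chain labof y 0 s ls -> isA a -> cex y a c ->
  (c = 0 \/ fin c) -> List.In a s.
Proof.
move=> Yy C; elim/ltn_ind: c a => c IH a Aa Ha [c0|Fc].
  subst; inversion C as [? F|? b1 l1 Ab1 Hb1|? b1 ? ? ? Ab1 Hb1]; subst.
  - by case: (F a Aa).
  - by left; apply: (ptr_uniq T Yy Ab1 Aa Hb1 Ha).
  - by left; apply: (ptr_uniq T Yy Ab1 Aa Hb1 Ha).
have [c0|c0] := posnP c.
  subst; inversion C as [? F|? b1 l1 Ab1 Hb1|? b1 ? ? ? Ab1 Hb1]; subst.
  - by case: (F a Aa).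
  - by left; apply: (ptr_uniq T Yy Ab1 Aa Hb1 Ha).
  - by left; apply: (ptr_uniq T Yy Ab1 Aa Hb1 Ha).
have [a0 [c1 [Aa0 H1 H2 H3]]] := ptr_prev T Yy Aa Ha c0.
have I0 : List.In a0 s.
  apply: (IH c1 (E_lt H3) a0) => //; right; apply: fin_down Fc; exact: ltnW (E_lt H3).
have [c2 Hc2] := chain_col_ex C I0.
by apply: next_in_chain C Hc2 _ Aa Ha.
Qed.

Lemma tree_view : view E Q (present fin pI pL) V labof.
Proof.
split.
- exact: T.
- exact: lab_total.
- move=> a [n||] [Aa] /=.
  + by move=> [Hn Fn]; split=> //; have := lev_pos T Aa; rewrite (cex_cge _ Hn).
  + by move=> La; apply/least_pL; exists a.
  + by move=> [H1 H2]; apply: inf_pI H1 H2.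
- exact: lab_fun.
- exact: lab_mono.
- move=> a b [_ La] [_ Lb]; have [//|B1] := least_min La (least_inf Lb).
  have [//|B2] := least_min Lb (least_inf La).
  by case: (below_irr T (below_trans T B1 B2)).
- by move=> a n [_ []].
- move=> a l k Hl Fl Qk; have [_ Ia] := lab_beyond Hl Fl.
  have [[n Hn]|//] := cexVcge a a; apply/(cex_cge _ Hn); exact: Q_fin (Ia n Hn) Qk.
- exact: tree_extA.
- exact: tree_chain.
- exact: tree_legal.
- exact: tree_extY.
- move=> y s ls a k Yy C Aa Na Qk.
  have [[n Hn]|//] := cexVcge y a; apply/(cex_cge _ Hn).
  case Fn : (fin n); last by apply: Q_fin Qk; rewrite Fn.
  by case: Na; apply: ptr_in_chain Yy C Aa Hn (or_intror Fn).
Qed.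

End ViewOfTree.

(** * Explicit tree structures *)

(* The pair (k, j) stands for the dyadic rational (2j+1)/2^(k+1). *)
Definition dlt (d e : nat * nat) : bool := (d.2.*2.+1) * 2 ^ e.1 < (e.2.*2.+1) * 2 ^ d.1.

Lemma dlt_irr d : dlt d d = false.
Proof. by rewrite /dlt ltnn. Qed.

Lemma dlt_trans d e g : dlt d e -> dlt e g -> dlt d g.
Proof.
rewrite /dlt; move: d e g => [k1 j1] [k2 j2] [k3 j3] /=.
set x1 := _.+1; set x2 := (j2.*2).+1; set x3 := (j3.*2).+1 => H1 H2.
have P k : 0 < 2 ^ k by rewrite expn_gt0.
rewrite -(ltn_pmul2r (P k2)) mulnAC; apply: (@leq_ltn_trans (x2 * 2 ^ k1 * 2 ^ k3)).
  by rewrite leq_mul2r ltnW ?orbT.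
by rewrite mulnAC [X in _ < X]mulnAC ltn_mul2r P.
Qed.

Lemma dlt_total d e : [\/ dlt d e, d = e | dlt e d].
Proof.
rewrite /dlt; case: ltngtP => H; [by constructor 1|by constructor 3|constructor 2].
move: d e H => [k1 j1] [k2 j2] /= H.
(* The odd part and the exponent of 2 are determined by the product: after division by [2 ^ a], the
   case [a < b] would equate an even number with an odd one. *)
have aux a b x y : a <= b -> x.*2.+1 * 2 ^ b = y.*2.+1 * 2 ^ a -> a = b /\ x = y.
  move=> ab; rewrite -(subnK ab) expnD mulnA => /eqP.
  rewrite eqn_mul2r expn_eq0 /= => /eqP E.
  have : odd (x.*2.+1 * 2 ^ (b - a)) by rewrite E /= odd_double.
  rewrite oddM oddX /= odd_double /= orbF => /eqP b0.
  by move: E; rewrite b0 muln1 => E; split; lia.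
have [H12|/ltnW H21] := leqP k1 k2; first by have [-> ->] := aux _ _ _ _ H12 H.
by have [-> ->] := aux _ _ _ _ H21 (esym H).
Qed.

(** With first components [k] of [d] and [k'] of [e], this is [d] plus [1/2^(k+k'+2)] rather than
    the mean; two distinct fractions with denominators [2^(k+1)] and [2^(k'+1)] differ by more.
    Similarly [dup d] is [d] plus [1/2^k], and [ddn d] is [1/2^(k+2)], which is below every [d] with
    first component [k]. *)
Definition dmid (d e : nat * nat) := ((d.1 + e.1).+1, d.2.*2.+1 * 2 ^ e.1).
Definition dup (d : nat * nat) := (d.1, d.2.+1).
Definition ddn (d : nat * nat) := (d.1.+1, 0).

Lemma dlt_up d : dlt d (dup d).
Proof. by rewrite /dlt /dup /= ltn_mul2r expn_gt0 /=; lia. Qed.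

Lemma dlt_dn d : dlt (ddn d) d.
Proof.
rewrite /dlt /ddn /= mul1n expnS; have : 0 < 2 ^ d.1 by rewrite expn_gt0.
by move: (2 ^ d.1) => x Hx; nia.
Qed.

Lemma dlt_midl d e : dlt d (dmid d e).
Proof.
rewrite /dlt /dmid /= expnS expnD; have : 0 < 2 ^ d.1 by rewrite expn_gt0.
by move: (2 ^ d.1) (2 ^ e.1) d.2 => x y z Hx; nia.
Qed.

Lemma dlt_midr d e : dlt d e -> dlt (dmid d e) e.
Proof.
rewrite /dlt /dmid /= expnS expnD; have : 0 < 2 ^ e.1 by rewrite expn_gt0.
by move: (2 ^ d.1) (2 ^ e.1) d.2 e.2 => x y z t Hy; nia.
Qed.

(* [(Some n, d)] has level [n.+1] and [(None, d)] infinite level; in both cases [d] is its place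
   inside the level. *)
Definition ael := (option nat * (nat * nat))%type.

Definition alt (a b : ael) : bool :=
  match a.1, b.1 with
  | Some m, Some n => (m < n) || (m == n) && dlt a.2 b.2
  | Some _, None => true
  | None, Some _ => false
  | None, None => dlt a.2 b.2
  end.

Definition alev (a : ael) : option nat := omap S a.1.
Definition alab (a : ael) : label := if alev a is Some n then Fin n else Inf.

Definition lev_ge (a : ael) k : bool := if alev a is Some n then k <= n else true.

(* Pointers along a finite list, or (right summand) along an infinite path of the tree; the numbers
   distinguish elements with the same pointers. *)
Definition yel := (seq ael * nat + nat)%type.

Inductive el := EA of ael | EY of yel | EZA of ael & nat | EZY of yel & ael & nat.

Definition el_sum (e : el) : (ael + yel) + (ael * nat + yel * ael * nat) :=
  match e with
  | EA a => inl (inl a) | EY y => inl (inr y)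
  | EZA a i => inr (inl (a, i)) | EZY y a i => inr (inr (y, a, i))
  end.

Lemma el_sum_inj : injective el_sum.
Proof. by case=> [a|y|a i|y a i] [b|z|b j|z b j] //= [] // -> // -> // ->. Qed.

(** * Pointers along a finite list *)

Section ListPointers.
Variable E : rel nat.
Hypothesis E_lt : forall m n, E m n -> m < n.

Definition lptr c0 (s : seq ael) a c := List.In (a, c) (zip s (cols c0 (map alab s))).

Lemma lptr_cons c0 a0 s a c : lptr c0 (a0 :: s) a c <->
  (a = a0 /\ c = c0) \/ exists2 n, alev a0 = Some n & lptr n s a c.
Proof.
rewrite /lptr /= /alab; case: (alev a0) => [n|] /=.
  split=> [[[<- <-]|H]|[[-> ->]|[m [<-] H]]]; [by left|by right; exists n|by left|by right].
by split=> [[[<- <-]|]|[[-> ->]|[m]]]; [left|case: s|left|].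
Qed.

Lemma legal_cons c0 a0 s : legal E c0 (map alab (a0 :: s)) ->
  (forall n, alev a0 = Some n -> c0 < n) /\
  (s <> [::] -> exists n, [/\ alev a0 = Some n, E c0 n & legal E n (map alab s)]).
Proof.
rewrite /= /alab; case: (alev a0) => [n|] /andP[H1 H2]; split=> //.
- by move=> _ [<-].
- by case: s H2 => // a s /= /andP[? ?] _; exists n.
- by case: s H2.
Qed.

Lemma lptr_ge c0 s a c : legal E c0 (map alab s) -> lptr c0 s a c ->
  c0 <= c /\ forall n, alev a = Some n -> c < n.
Proof.
elim: s c0 => // a0 s IH c0 /legal_cons[H1 H2] /lptr_cons[[-> ->]//|[n Hn Hp]].
have [|n' [Hn' En HL]] := H2; first by move=> E0; rewrite E0 in Hp.
move: Hn'; rewrite Hn => -[E0]; subst.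
have [G1 G2] := IH _ HL Hp; split=> //; have := E_lt En; lia.
Qed.

Lemma lptr_tail c0 a0 s n a c : legal E c0 (map alab (a0 :: s)) -> alev a0 = Some n ->
  lptr n s a c -> [/\ c0 < n, n <= c, E c0 n, legal E n (map alab s) & forall m, alev a = Some m -> n < m].
Proof.
move=> /legal_cons[H1 H2] Hn Hp.
have [|n' [Hn' En HL]] := H2; first by move=> E0; rewrite E0 in Hp.
move: Hn'; rewrite Hn => -[E0]; subst.
have [G1 G2] := lptr_ge HL Hp; split=> //; first exact: E_lt.
by move=> m /G2; lia.
Qed.

Lemma lptr_uniq c0 s a a' c : legal E c0 (map alab s) -> lptr c0 s a c -> lptr c0 s a' c -> a = a'.
Proof.
elim: s c0 => // a0 s IH c0 HL /lptr_cons[[-> ->]|[n Hn Hp]] /lptr_cons[[-> E0]|[n' Hn' Hp']] //.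
- by have [? ? _ _ _] := lptr_tail HL Hn' Hp'; lia.
- by have [? ? _ _ _] := lptr_tail HL Hn Hp; lia.
- move: Hn'; rewrite Hn => -[E0]; subst.
  by have [_ _ _ HL' _] := lptr_tail HL Hn Hp; apply: IH HL' Hp Hp'.
Qed.

Lemma lptr_fun c0 s a c c' : legal E c0 (map alab s) -> lptr c0 s a c -> lptr c0 s a c' -> c = c'.
Proof.
elim: s c0 => // a0 s IH c0 HL /lptr_cons[[-> ->]|[n Hn Hp]] /lptr_cons[[E0 E1]|[n' Hn' Hp']] //.
- by have [_ _ _ _ /(_ _ Hn')] := lptr_tail HL Hn' Hp'; rewrite ltnn.
- by subst a; have [_ _ _ _ /(_ _ Hn)] := lptr_tail HL Hn Hp; rewrite ltnn.
- move: Hn'; rewrite Hn => -[E0]; subst.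
  by have [_ _ _ HL' _] := lptr_tail HL Hn Hp; apply: IH HL' Hp Hp'.
Qed.

Lemma lptr_inj c0 s a a' c c' n : legal E c0 (map alab s) -> lptr c0 s a c -> lptr c0 s a' c' ->
  alev a = Some n -> alev a' = Some n -> a = a'.
Proof.
elim: s c0 => // a0 s IH c0 HL /lptr_cons[[-> _]|[m Hm Hp]] /lptr_cons[[-> _]|[m' Hm' Hp']] // H1 H2.
- have [_ _ _ _ /(_ _ H2)] := lptr_tail HL Hm' Hp'.
  by move: Hm'; rewrite H1 => -[->]; rewrite ltnn.
- have [_ _ _ _ /(_ _ H1)] := lptr_tail HL Hm Hp.
  by move: Hm; rewrite H2 => -[->]; rewrite ltnn.
- move: Hm'; rewrite Hm => -[E0]; subst.
  by have [_ _ _ HL' _] := lptr_tail HL Hm Hp; apply: (IH _ HL' Hp Hp').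
Qed.

Lemma lptr_prev c0 s b c : legal E c0 (map alab s) -> lptr c0 s b c -> c0 < c ->
  exists a c', [/\ lptr c0 s a c', alev a = Some c & E c' c].
Proof.
elim: s c0 => // a0 s IH c0 HL /lptr_cons[[_ ->]|[n Hn Hp]] H0; first by rewrite ltnn in H0.
have [_ nc En HL' _] := lptr_tail HL Hn Hp.
move: nc; rewrite leq_eqVlt => /orP[/eqP E0|nc].
  by subst; exists a0, c0; split=> //; apply/lptr_cons; left.
have [a [c' [H1 H2 H3]]] := IH _ HL' Hp nc.
by exists a, c'; split=> //; apply/lptr_cons; right; exists n.
Qed.

Lemma lptr_In c0 s a c : lptr c0 s a c -> List.In a s.
Proof. by elim: s c0 => // a0 s IH c0 /lptr_cons[[-> _]|[n _ /IH]]; [left|right]. Qed.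

Lemma lptr_nth c0 s a1 j (ns : nat -> nat) : j < size s -> ns 0 = c0 ->
  (forall i, i < j -> alev (nth a1 s i) = Some (ns i.+1)) -> lptr c0 s (nth a1 s j) (ns j).
Proof.
elim: s j c0 ns => // a0 s IH [|j] c0 ns Hj H0 H; apply/lptr_cons; first by left.
right; exists (ns 1); first exact: (H 0).
by apply: (IH j (ns 1) (fun i => ns i.+1)) => // i Hi; apply: (H i.+1).
Qed.

End ListPointers.

(* [okg] selects the elements of infinite level; if [hasp] holds there are elements with pointers
   along the infinite path [f]. *)
Section Concrete.
Variables (E : rel nat) (okg : pred (nat * nat)) (f : nat -> nat) (hasp : bool).
Hypotheses (E_lt : forall m n, E m n -> m < n)
  (okg_up : forall d e, dlt d e -> okg d -> okg e)
  (f_path : hasp -> f 0 = 0 /\ forall i, E (f i) (f i.+1)).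

Definition okA (a : ael) : bool := if a.1 is None then okg a.2 else true.
Definition okY (y : yel) : bool :=
  if y is inl (s, _) then legal E 0 (map alab s) && all okA s else hasp.
(** The pointer number [i] along the path has level [f i.+1]; the predecessor appears because
    [Some n] stands for level [n.+1]. *)
Definition fptr i : ael := (Some (f i.+1).-1, (0, 0)).
Definition ptr (y : yel) (a : ael) (c : nat) : Prop :=
  if y is inl (s, _) then lptr 0 s a c else exists2 i, a = fptr i & c = f i.

(** The links of a pair are numbered, and the intended colour cuts the numbering off. Without a
    pointer from [y] to [a] the condition on [i] is void, which makes the colour infinite; likewise
    at infinite level. *)
Definition valid (e : el) : Prop :=
  match e with
  | EA a => okA a
  | EY y => okY y
  | EZA a i => okA a /\ lev_ge a i.+1
  | EZY y a i => [/\ okY y, okA a & forall c, ptr y a c -> i < c]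
  end.

Definition cdom := {e : el | valid e}.

Definition cbelow (u v : cdom) : Prop :=
  match sval u, sval v with EA a, EA b => alt a b | _, _ => False end.
Definition clink (z u v : cdom) : Prop :=
  match sval z, sval u, sval v with
  | EZA a _, EA b, EA c => a = b /\ a = c
  | EZY y a _, EY y', EA b => y = y' /\ a = b
  | _, _, _ => False
  end.

Definition cfun (g : fsym L0) (a : (far g).-tuple cdom) : cdom :=
  exist _ (EA (Some 0, (0, 0))) isT.
Definition crel (r : rsym L0) (a : (rar r).-tuple cdom) : Prop :=
  match val r, tval a with
  | 0, [:: u; v] => cbelow u v
  | _, [:: z; u; v] => clink z u v
  | _, _ => False
  end.

Definition cmodel : structure L0 :=
  @Structure L0 cdom (inhabits (exist _ (EA (Some 0, (0, 0))) isT : cdom)) cfun crel.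

Lemma cmodel_countable : countable_structure cmodel.
Proof.
exists (fun u : cdom => pickle (el_sum (sval u))) => -[e He] [e' He'] /= H.
have E0 : e = e' by apply: el_sum_inj; apply: (pcan_inj pickleK).
by subst; congr exist; apply: proof_irrelevance.
Qed.

Definition mkA a (H : okA a) : cmodel := exist valid (EA a) H.
Definition mkY y (H : okY y) : cmodel := exist valid (EY y) H.

Lemma cdom_eq (u v : cmodel) : sval u = sval v -> u = v.
Proof. by case: u v => e He [e' He'] /= E0; subst; congr exist; apply: proof_irrelevance. Qed.

Lemma belowE (u v : cmodel) : below u v <-> exists a b, [/\ sval u = EA a, sval v = EA b & alt a b].
Proof.
rewrite /below /= /crel /= /cbelow.
by case: u v => -[a|y|a i|y a i] Hu [[b|y'|b j|y' b j] Hv] /=; split=> [H|[a' [b' [// [->] // [->] //]]]] //; exists a, b.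
Qed.

Lemma alt_irr a : alt a a = false.
Proof. by case: a => -[n|] d; rewrite /alt /= ?ltnn ?eqxx dlt_irr. Qed.

Lemma alt_trans a b c : alt a b -> alt b c -> alt a c.
Proof.
case: a b c => -[l|] d [[m|] e] [[n|] g]; rewrite /alt //=; last exact: dlt_trans.
move=> /orP[H1|/andP[/eqP -> H1]] /orP[H2|/andP[/eqP <- H2]].
- by rewrite (ltn_trans H1 H2).
- by rewrite H1.
- by rewrite H2.
- by rewrite eqxx (dlt_trans H1 H2) orbT.
Qed.

Lemma alt_total a b : [\/ alt a b, a = b | alt b a].
Proof.
case: a b => -[m|] d [[n|] e]; rewrite /alt /=.
- case: ltngtP => [H|H|->] /=; [by constructor 1|by constructor 3|].
  by have [->|->|->] := dlt_total d e; [constructor 1|constructor 2|constructor 3].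
- by constructor 1.
- by constructor 3.
- by have [->|->|->] := dlt_total d e; [constructor 1|constructor 2|constructor 3].
Qed.

Lemma alt_ne o o' d e g : o != o' -> alt (o, d) (o', g) = alt (o, e) (o', g).
Proof.
case: o o' => [m|] [n|] //; rewrite /alt /= => ne.
have /negbTE -> // : m != n; by apply: contra ne => /eqP ->.
Qed.

Lemma isAE (u : cmodel) : isA u <-> exists a, sval u = EA a.
Proof.
split=> [[v /belowE[a [b [H _ _]]]]|[a Ha]]; first by exists a.
have Oa : okA a by have := proj2_sig u; rewrite Ha.
have Ob : okA (a.1, dup a.2).
  by move: Oa; rewrite /okA /=; case: a.1 => // Oa; apply: okg_up Oa; apply: dlt_up.
exists (mkA Ob); apply/belowE; exists a, (a.1, dup a.2); split=> //.
by rewrite /alt /=; case: a.1 => [n|]; rewrite ?eqxx dlt_up ?orbT.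
Qed.

Lemma linkE (z u v : cmodel) : link z u v <->
  (exists a i, [/\ sval z = EZA a i, sval u = EA a & sval v = EA a]) \/
  (exists y a i, [/\ sval z = EZY y a i, sval u = EY y & sval v = EA a]).
Proof.
rewrite /link /= /crel /= /clink; case: z u v => [z Hz] [u Hu] [v Hv] /=.
split; last first.
  case=> [[a [i [-> -> ->]]]|[y [a [i [-> -> ->]]]]] //.
case: z {Hz} => [a|y|a i|y a i] //; case: u {Hu} => [b|y'|b j|y' b j] //;
  case: v {Hv} => [d|y''|d l|y'' d l] // [-> ->].
  by left; exists d, i.
by right; exists y', d, i.
Qed.

Lemma isZE (u : cmodel) : isZ u <-> (exists a i, sval u = EZA a i) \/ (exists y a i, sval u = EZY y a i).
Proof.
split=> [[v [w /linkE[[a [i [H _ _]]]|[y [a [i [H _ _]]]]]]]|].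
- by left; exists a, i.
- by right; exists y, a, i.
case=> [[a [i H]]|[y [a [i H]]]]; have := proj2_sig u; rewrite H /=.
  case=> Oa _; exists (mkA Oa), (mkA Oa); apply/linkE; left; by exists a, i.
by case=> Oy Oa _; exists (mkY Oy), (mkA Oa); apply/linkE; right; exists y, a, i.
Qed.

Lemma isYE (u : cmodel) : isY u <-> exists y, sval u = EY y.
Proof.
rewrite /isY isAE isZE; split=> [[H1 H2]|[y ->]]; last by split=> [[]|[[a []]|[y' [a []]]]].
case: u H1 H2 => -[a|y|a i|y a i] Hu /= H1 H2; [|by exists y|..].
- by case: H1; exists a.
- by case: H2; left; exists a, i.
- by case: H2; right; exists y, a, i.
Qed.

Lemma nat_pigeon k n (g : nat -> nat) : (forall i, i < k -> g i < n) ->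
  (forall i j, i < k -> j < k -> g i = g j -> i = j) -> k <= n.
Proof.
move=> H1 H2; rewrite -(size_iota 0 n); apply: (pigeon (g := g)) => // j Hj.
have := In_map_iota id (s := 0) (n := n) (j := g j); rewrite map_id; apply; exact: H1.
Qed.

Lemma links_of k (F : nat -> el) : (forall i, i < k -> valid (F i)) ->
  exists g : nat -> cmodel, forall i, i < k -> sval (g i) = F i.
Proof.
move=> H; have [u0] := dom_inhabited cmodel.
exists (fun i => if insub i is Some j then exist valid _ (H (val j) (valP (j : 'I_k))) else u0).
by move=> i Hi; rewrite insubT.
Qed.

Lemma linksA (u : cmodel) a k : sval u = EA a -> lev_ge a k ->
  exists g : nat -> cmodel, forall i, i < k -> sval (g i) = EZA a i.
Proof.
move=> Hu H; have Oa : okA a by have := proj2_sig u; rewrite Hu.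
apply: links_of => i Hi; split=> //; move: H; rewrite /lev_ge; case: (alev a) => // n; exact: leq_trans.
Qed.

Lemma linksY (u v : cmodel) y a k : sval u = EY y -> sval v = EA a ->
  (forall c, ptr y a c -> k <= c) ->
  exists g : nat -> cmodel, forall i, i < k -> sval (g i) = EZY y a i.
Proof.
move=> Hu Hv H; have Oa : okA a by have := proj2_sig v; rewrite Hv.
have Oy : okY y by have := proj2_sig u; rewrite Hu.
apply: links_of => i Hi; split=> // c /H; exact: leq_trans.
Qed.

Lemma cgeA (u : cmodel) a k : sval u = EA a ->
  cge u u k <-> lev_ge a k.
Proof.
move=> Hu; split=> [[g H1 H2]|H].
  rewrite /lev_ge; case E0 : (alev a) => [n|//].
  pose h i := if sval (g i) is EZA _ j then j else 0.
  have Hg i : i < k -> sval (g i) = EZA a (h i) /\ h i < n.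
    move=> /H1 /linkE; rewrite Hu => -[[b [j [Hz [Eb] _]]]|[y [b [j [_ //]]]]]; subst b.
    by have := proj2_sig (g i); rewrite /h Hz /= /lev_ge E0 => -[].
  apply: (nat_pigeon (g := h)) => [i /Hg[]//|i j Hi Hj Hh].
  by apply: H2 => //; apply: cdom_eq; case: (Hg i Hi) (Hg j Hj) => -> _ [-> _]; rewrite Hh.
have [g Hg] := linksA Hu H; exists g => [i Hi|i j Hi Hj E0].
  by apply/linkE; left; exists a, i; rewrite Hg.
by have := Hg j Hj; rewrite -E0 Hg // => -[].
Qed.

Lemma cgeY (u v : cmodel) y a k : sval u = EY y -> sval v = EA a ->
  cge u v k <-> forall c, ptr y a c -> k <= c.
Proof.
move=> Hu Hv; split=> [[g H1 H2] c Hc|H].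
  pose h i := if sval (g i) is EZY _ _ j then j else 0.
  have Hg i : i < k -> sval (g i) = EZY y a (h i) /\ h i < c.
    move=> /H1 /linkE; rewrite Hu Hv => -[[b [j [_ //]]]|[y' [b [j [Hz [Ey] [Eb]]]]]]; subst y' b.
    have := proj2_sig (g i); rewrite /h Hz /= => -[_ _ X]; split=> //; exact: X.
  apply: (nat_pigeon (g := h)) => [i /Hg[]//|i j Hi Hj Hh].
  by apply: H2 => //; apply: cdom_eq; case: (Hg i Hi) (Hg j Hj) => -> _ [-> _]; rewrite Hh.
have [g Hg] := linksY Hu Hv H; exists g => [i Hi|i j Hi Hj E0].
  by apply/linkE; right; exists y, a, i; rewrite Hg.
by have := Hg j Hj; rewrite -E0 Hg // => -[].
Qed.

Lemma fS_gt i : hasp -> f i < f i.+1.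
Proof. by move=> /f_path[_ H]; apply: E_lt. Qed.

Lemma f_mono i j : hasp -> i < j -> f i < f j.
Proof.
move=> Hp ij; rewrite -(subnKC ij); elim: (j - i.+1) => [|k IH]; first by rewrite addn0 fS_gt.
by rewrite addnS; apply: ltn_trans IH _; apply: fS_gt.
Qed.

Lemma f_inj i j : hasp -> f i = f j -> i = j.
Proof.
move=> Hp H; case: (ltngtP i j) => // ij; have := f_mono Hp ij; by rewrite H ltnn.
Qed.

Lemma fptr_lev i : hasp -> alev (fptr i) = Some (f i.+1).
Proof. by move=> Hp; rewrite /alev /= prednK //; apply: leq_ltn_trans (fS_gt i Hp). Qed.

Lemma ptr_fun y a c c' : okY y -> ptr y a c -> ptr y a c' -> c = c'.
Proof.
case: y => [[s j]|j] /=; first by move=> /andP[HL _]; apply: lptr_fun HL.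
move=> Hp [i -> ->] [i' E0 ->]; have := congr1 alev E0.
by rewrite !fptr_lev // => -[/(f_inj Hp)[->]].
Qed.

Lemma ptr_okA y a c : okY y -> ptr y a c -> okA a.
Proof.
case: y => [[s j]|j] /=; last by move=> Hp [i -> _].
move=> /andP[_ H] /lptr_In; elim: s H => //= b s IH /andP[H1 H2] [<-//|]; exact: IH.
Qed.

Lemma cexA (u : cmodel) a n : sval u = EA a -> cex u u n <-> alev a = Some n.
Proof.
move=> Hu; rewrite /cex !(cgeA _ Hu) /lev_ge; case: (alev a) => [m|]; last by split=> // -[].
by split=> [[H1 H2]|[->]]; [congr Some; lia|rewrite leqnn ltnn].
Qed.

Lemma cexY (u v : cmodel) y a c : sval u = EY y -> sval v = EA a -> cex u v c <-> ptr y a c.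
Proof.
move=> Hu Hv; rewrite /cex !(cgeY _ Hu Hv).
have Oy : okY y by have := proj2_sig u; rewrite Hu.
split=> [[H1 H2]|H]; last first.
  by split=> [c' /(ptr_fun Oy H) -> //|/(_ c H)]; rewrite ltnn.
have [[c' Hc']|F] := classic (exists c', ptr y a c'); last by case: H2 => c' Hc'; case: F; exists c'.
have [cc'|] := ltnP c c'; first by case: H2 => c2 /(ptr_fun Oy Hc') <-.
move=> c'c; have -> : c = c' by apply/eqP; rewrite eqn_leq c'c H1.
exact: Hc'.
Qed.

Variables (Q : nat -> Prop) (V : nat -> el -> Prop).
Hypotheses (V_mono_el : forall i e, V i e -> V i.+1 e)
  (V_EZA : forall i a j, V i (EZA a j) -> V i (EA a))
  (V_EZY : forall i y a j, V i (EZY y a j) -> V i (EY y) /\ V i (EA a))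
  (V_EY : forall i y a c, okY y -> V i (EY y) -> ptr y a c -> V i (EA a))
  (V_dn : forall i n d, V i (EA (Some n, d)) -> exists2 e, V i.+1 (EA (Some n, e)) & dlt e d)
  (V_up : forall i o d, V i (EA (o, d)) -> exists2 e, V i.+1 (EA (o, e)) & dlt d e)
  (V_mid : forall i o d d', V i (EA (o, d)) -> V i (EA (o, d')) -> dlt d d' ->
     exists e, [/\ V i.+1 (EA (o, e)), dlt d e & dlt e d'])
  (V_lev : forall n, Q n.+1 -> exists d, V 0 (EA (Some n, d)))
  (V_list : forall i s (e : seq el), Q (size s) -> (forall a, List.In a s -> V i (EA a)) ->
     (forall x, List.In x e -> V i x) ->
     exists2 j, V i.+1 (EY (inl (s, j))) & ~ List.In (EY (inl (s, j))) e)
  (V_ZA : forall i a j k, V i (EA a) -> j < k -> Q k -> V i.+1 (EZA a j))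
  (V_ZY : forall i y a j k, V i (EY y) -> V i (EA a) -> j < k -> Q k -> V i.+1 (EZY y a j))
  (Q0 : Q 0).

Lemma In_sval (e : seq cmodel) (u : cmodel) : List.In u e -> List.In (sval u) (map sval e).
Proof. by elim: e => //= v e IH [->|/IH]; [left|right]. Qed.

Lemma sval_In (e : seq cmodel) x : List.In x (map sval e) -> exists2 u, List.In u e & sval u = x.
Proof. by elim: e => //= v e IH [<-|/IH[u Hu <-]]; [exists v; [left|]|exists u; [right|]]. Qed.

Lemma alev_lt a b k : alt a b -> lev_ge a k -> lev_ge b k.
Proof.
rewrite /lev_ge; case: a b => -[m|] d [[n|] e]; rewrite /alt //= => /orP[H1|/andP[/eqP-> _]] //; lia.
Qed.

Lemma cmodel_axioms : @tree_axioms E cmodel Q (fun i u => V i (sval u)).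
Proof.
split.
- by move=> i u; apply: V_mono_el.
- move=> i z u v Vz /linkE[[a [j [Hz -> ->]]]|[y [a [j [Hz -> ->]]]]].
    by move: Vz; rewrite Hz => /V_EZA.
  by move: Vz; rewrite Hz => /V_EZY.
- move=> i y a c Vy /isYE[y' Hy] /isAE[a' Ha] /(cexY _ Hy Ha) Hp.
  rewrite Ha; apply: V_EY Hp; last by rewrite -Hy.
  by have := proj2_sig y; rewrite Hy.
- by move=> u /belowE[a [b [-> [->]]]]; rewrite alt_irr.
- move=> u v w /belowE[a [b [Ha Hb H1]]] /belowE[b' [c [Hb' Hc H2]]].
  move: Hb'; rewrite Hb => -[E0]; subst b'.
  by apply/belowE; exists a, c; split=> //; apply: alt_trans H1 H2.
- move=> u v /isAE[a Ha] /isAE[b Hb]; have [H|H|H] := alt_total a b.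
  + by left; apply/belowE; exists a, b.
  + by right; left; apply: cdom_eq; rewrite Ha Hb H.
  + by right; right; apply/belowE; exists b, a.
- by move=> u v /belowE[a [b [_ Hb _]]]; apply/isAE; exists b.
- move=> z u v; rewrite !isAE isYE => /linkE[[a [i [Hz Hu Hv]]]|[y [a [i [Hz Hu Hv]]]]].
    split; [by exists a|split; last by rewrite Hz => -[]].
    by left; apply: cdom_eq; rewrite Hu Hv.
  by split; [exists a|split; [right; exists y|rewrite Hz => -[]]].
- move=> z u v u' v' /linkE[[a [i [Hz Hu Hv]]]|[y [a [i [Hz Hu Hv]]]]] /linkE.
    rewrite Hz => -[[b [j [[<- _] Hu' Hv']]]|[y [b [j [//]]]]].
    by split; apply: cdom_eq; rewrite ?Hu ?Hv.
  rewrite Hz => -[[b [j [//]]]|[y' [b [j [[<- <- _] Hu' Hv']]]]].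
  by split; apply: cdom_eq; rewrite ?Hu ?Hv.
- by move=> u /isAE[a Ha]; rewrite (cgeA _ Ha) /lev_ge /alev; case: a.1.
- move=> u v k /belowE[a [b [Ha Hb H]]]; rewrite (cgeA _ Ha) (cgeA _ Hb); exact: alev_lt.
- move=> i u n Vu /isAE[[o d] Ha] /(cexA _ Ha).
  rewrite /alev /=; case: o Ha => //= m Ha [<-].
  move: Vu; rewrite Ha => /V_dn[e Ve De].
  have Oe : okA (Some m, e) by [].
  exists (mkA Oe); split=> //; last exact/cexA.
  by apply/belowE; exists (Some m, e), (Some m, d); split=> //; rewrite /alt /= eqxx De orbT.
- move=> i u Vu /isAE[[o d] Ha]; move: Vu; rewrite Ha => /V_up[e Ve De].
  have Oe : okA (o, e).
    by have := proj2_sig u; rewrite Ha /= /okA /=; case: o {Ha Ve} => // /okg_up; apply.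
  exists (mkA Oe); split=> // [|k].
    by apply/belowE; exists (o, d), (o, e); split=> //; rewrite /alt /=; case: o {Ha Ve Oe} => [n|]; rewrite ?eqxx De ?orbT.
  by rewrite (@cgeA _ (o, e)) // (cgeA _ Ha).
- move=> i u v Vu Vv /belowE[[o d] [[o' d'] [Ha Hb H]]].
  move: Vu Vv; rewrite Ha Hb => Vu Vv.
  have Ou : okA (o, d) by have := proj2_sig u; rewrite Ha.
  have [Eo|ne] := eqVneq o o'.
    subst o'; have Dd : dlt d d' by move: H; rewrite /alt /=; case: (o) => [n|] //; rewrite ltnn eqxx.
    have [e [Ve D1 D2]] := V_mid Vu Vv Dd.
    have Oe : okA (o, e) by move: Ou; rewrite /okA /=; case: (o) => // /okg_up; apply.
    exists (mkA Oe); split=> //; apply/belowE; [exists (o, d), (o, e)|exists (o, e), (o, d')]; split=> //;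
      by rewrite /alt /=; case: (o) => [n|]; rewrite ?eqxx ?D1 ?D2 ?orbT.
  (* When the levels differ, moving up inside the level of the lower element stays below the other
     one. *)
  have [e Ve De] := V_up Vu.
  have Oe : okA (o, e) by move: Ou; rewrite /okA /=; case: (o) => // /okg_up; apply.
  exists (mkA Oe); split=> //; apply/belowE; [exists (o, d), (o, e)|exists (o, e), (o', d')]; split=> //.
    by rewrite /alt /=; case: (o) => [n|]; rewrite ?eqxx De ?orbT.
  by rewrite (alt_ne e d d' ne).
- move=> [//|n] _ Qn; have [d Vd] := V_lev Qn.
  have Od : okA (Some n, d) by [].
  by exists (mkA Od); split=> //; [apply/isAE; exists (Some n, d)|apply/cexA].
- move=> y a a' c /isYE[y0 Hy] /isAE[b Hb] /isAE[b' Hb'].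
  have Oy : okY y0 by have := proj2_sig y; rewrite Hy.
  rewrite (cexY _ Hy Hb) (cexY _ Hy Hb') => H H'; apply: cdom_eq; rewrite Hb Hb'; congr EA.
  case: y0 {Hy} Oy H H' => [[s j]|j] /=; first by move=> /andP[HL _]; apply: lptr_uniq HL.
  by move=> Hp [i -> ->] [i' -> /(f_inj Hp) ->].
- move=> y a c /isYE[y0 Hy] /isAE[b Hb].
  have Oy : okY y0 by have := proj2_sig y; rewrite Hy.
  rewrite (cexY _ Hy Hb) (cgeA _ Hb) /lev_ge.
  case: y0 {Hy} Oy => [[s j]|j] /=; last by move=> Hp [i -> ->]; rewrite fptr_lev ?fS_gt.
  by move=> /andP[HL _] /(lptr_ge E_lt HL)[_]; case: (alev b) => // n; apply.
- move=> y b c Yy Ab; have [y0 Hy] := proj1 (isYE y) Yy; have [b0 Hb] := proj1 (isAE b) Ab.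
  have Oy : okY y0 by have := proj2_sig y; rewrite Hy.
  rewrite (cexY _ Hy Hb) => Hp c0.
  suff [a [c' [H1 H2 H3]]] : exists a c', [/\ ptr y0 a c', alev a = Some c & E c' c].
    have Oa := ptr_okA Oy H1; exists (mkA Oa), c'; split=> //; first by apply/isAE; exists a.
      exact/(cexY _ Hy).
    exact/cexA.
  case: y0 {Hy} Oy Hp => [[s j]|j] /=.
    by move=> /andP[HL _] Hp; have [a [c' [? ? ?]]] := lptr_prev E_lt HL Hp c0; exists a, c'.
  move=> Hp [[|i] _ Ec]; first by move: c0; rewrite Ec; case: (f_path Hp) => ->.
  exists (fptr i), (f i); split; [by exists i|by rewrite fptr_lev // Ec|].
  by rewrite Ec; case: (f_path Hp).
- move=> y a a' c c' n /isYE[y0 Hy] /isAE[b Hb] /isAE[b' Hb'].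
  have Oy : okY y0 by have := proj2_sig y; rewrite Hy.
  rewrite (cexY _ Hy Hb) (cexY _ Hy Hb') (cexA _ Hb) (cexA _ Hb') => H H' H1 H2.
  apply: cdom_eq; rewrite Hb Hb'; congr EA.
  case: y0 {Hy} Oy H H' => [[s j]|j] /=.
    by move=> /andP[HL _] H H'; apply: (lptr_inj E_lt HL H H' H1 H2).
  move=> Hp [i Ei _] [i' Ei' _]; move: H1 H2; rewrite Ei Ei' !fptr_lev // => <- [] /(f_inj Hp)[->]; by [].
- move=> i e He.
  have [|||j Vj Nj] := @V_list i [::] (map sval e) => //.
    by move=> x /sval_In[u /He Vu <-].
  have Oy : okY (inl ([::], j)) by [].
  have Hy : sval (mkY Oy) = EY (inl ([::], j)) by [].
  exists (mkY Oy); split=> //; first by apply/isYE; exists (inl ([::], j)).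
    by move/In_sval.
  by move=> b /isAE[b0 Hb]; rewrite (cexY _ Hy Hb).
- move=> i k x ns e Qk Hx He ns0 Hlev Hlast.
  pose a0 : ael := (Some 0, (0, 0)).
  pose g (u : cmodel) : ael := if sval u is EA a then a else a0.
  have Hg j : j <= k -> sval (x j) = EA (g (x j)).
    by move=> /Hx[_ /isAE[a Ha]]; rewrite /g Ha.
  pose s := [seq g (x j) | j <- iota 0 k.+1].
  have Ss : size s = k.+1 by rewrite size_map size_iota.
  have Sn j : j <= k -> nth a0 s j = g (x j).
    by move=> Hj; rewrite (nth_map 0) ?size_iota // nth_iota.
  have HLev j : j < k -> alev (g (x j)) = Some (ns j.+1).
    by move=> Hj; have [H _] := Hlev j Hj; apply/(cexA _ (Hg j (ltnW Hj))).
  have Ins a : List.In a s -> exists2 j, j <= k & a = g (x j).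
    rewrite /s; have: forall j, j \in iota 0 k.+1 -> j <= k by move=> j; rewrite mem_iota.
    elim: (iota 0 k.+1) => //= j t IH Hj [<-|]; last by apply: IH => l Hl; apply: Hj; rewrite inE Hl orbT.
    by exists j => //; apply: Hj; rewrite inE eqxx.
  have [|||j Vj Nj] := @V_list i s (map sval e).
  + by rewrite Ss.
  + by move=> a /Ins[j Hj ->]; have [Vx _] := Hx j Hj; move: Vx; rewrite Hg.
  + by move=> z /sval_In[u /He Vu <-].
  have HL : legal E 0 (map alab s).
    rewrite -ns0 /s; move: Hlev HLev Hlast Hg; clear -E_lt okg_up f_path.
    elim: k x ns => [|k IH] x ns Hlev HLev Hlast Hg.
      move: Hlast; rewrite /= andbT (cgeA _ (Hg 0 isT)) /alab /lev_ge.
      by case: (alev _) => [n|].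
    have -> : [seq alab i | i <- [seq g (x j) | j <- iota 0 k.+2]] =
        alab (g (x 0)) :: [seq alab i | i <- [seq g (x j.+1) | j <- iota 0 k.+1]].
      by rewrite -[iota 0 k.+2]/(0 :: iota (1 + 0) k.+1) iotaDl !map_cons -!map_comp.
    have E1 : alab (g (x 0)) = Fin (ns 1) by rewrite /alab (HLev 0).
    have [_ H2] := Hlev 0 isT.
    rewrite [legal _ _ _]/= E1 H2 (E_lt H2) /=.
    have := IH (fun j => x j.+1) (fun j => ns j.+1) (fun j Hj => Hlev j.+1 Hj) (fun j Hj => HLev j.+1 Hj) Hlast (fun j Hj => Hg j.+1 Hj).
    by move=> /= ->; rewrite ?orbT.
  have Oall : all okA s.
    apply/allP => a; rewrite /s => /mapP[l]; rewrite mem_iota => Hl ->.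
    by have := proj2_sig (x l); rewrite Hg.
  have Oy : okY (inl (s, j)) by apply/andP.
  have Yp l : l <= k -> ptr (inl (s, j)) (g (x l)) (ns l).
    move=> Hl /=; rewrite -(Sn l Hl); apply: lptr_nth => //; first by rewrite Ss.
    by move=> i' Hi'; rewrite Sn ?HLev //; lia.
  have Hy : sval (mkY Oy) = EY (inl (s, j)) by [].
  exists (mkY Oy); split=> //.
  + by apply/isYE; exists (inl (s, j)).
  + by move/In_sval.
  + by move=> l Hl; apply/(cexY _ Hy (Hg l Hl)); apply: Yp.
  (* Such a [b] would be some [x l] with [ns l = n]. But [ns l <= ns k < n], since colours increase
     along the path and the colour of [x k] lies below its level [n]. *)
  + move=> n b /isAE[b0 Hb] /(cexA _ (Hg k (leqnn k))) Hn /(cexY _ Hy Hb) Hp.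
    have n0 : 0 < n by move: Hn; rewrite /alev; case: (g (x k)).1 => //= m [<-].
    have [a [c' [P1 P2 P3]]] := lptr_prev E_lt HL Hp n0.
    have Ea := lptr_inj E_lt HL P1 (Yp k (leqnn k)) P2 Hn; subst a.
    have [_ Hgt] := lptr_ge E_lt HL Hp.
    have /lptr_In/Ins[l Hl Eb] := Hp.
    have Hpl := Yp l Hl; rewrite -Eb in Hpl.
    have Enl := lptr_fun E_lt HL Hp Hpl.
    move: Hl; rewrite leq_eqVlt => /orP[/eqP El|Hl].
      by have := Hgt n; rewrite Eb El Hn ltnn => /(_ erefl).
    have Mono : forall m, m < k -> ns m < ns m.+1 by move=> m /Hlev[_ /E_lt].
    have Hns : forall m l', l' + m <= k -> ns l' <= ns (l' + m).
      elim=> [|m IH] l' Hm'; first by rewrite addn0.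
      rewrite addnS; apply: leq_trans (IH l' _) (ltnW (Mono _ _)); lia.
    have := Hns (k - l) l; rewrite subnKC ?(ltnW Hl) // => /(_ (leqnn k)).
    have [_ Hk] := lptr_ge E_lt HL (Yp k (leqnn k)); have := Hk n Hn; lia.
- move=> i u v k Vu Vv Qk Hc.
  have [k0|kp] := posnP k; first by subst k; exists (fun=> u).
  have [g0 H1 _] := Hc.
  have /linkE[[a [l [_ Hu Hv]]]|[y [a [l [_ Hu Hv]]]]] := H1 0 kp.
    have Euv : u = v by apply: cdom_eq; rewrite Hu Hv.
    subst v; have [g Hg] := linksA Hu (proj1 (cgeA k Hu) Hc).
    exists g; split=> [j Hj|j m Hj Hm E0]; last by have := Hg m Hm; rewrite -E0 Hg // => -[].
    by rewrite Hg //; split; [apply: V_ZA Hj Qk; rewrite -Hu|apply/linkE; left; exists a, j; rewrite Hg].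
  have [g Hg] := linksY Hu Hv (proj1 (cgeY k Hu Hv) Hc).
  exists g; split=> [j Hj|j m Hj Hm E0]; last by have := Hg m Hm; rewrite -E0 Hg // => -[].
  rewrite Hg //; split; last by apply/linkE; right; exists y, a, j; rewrite Hg.
  by apply: V_ZY Hj Qk; rewrite -?Hu -?Hv.
Qed.

End Concrete.

(** * Counting the countable models *)

Lemma tree_axioms_weaken (E : rel nat) (N : structure L0) (Q Q' : nat -> Prop) V :
  (forall k, Q' k -> Q k) -> @tree_axioms E N Q V -> @tree_axioms E N Q' V.
Proof.
move=> H T; split; try by case: T.
- by move=> n n0 /H; apply: (lev_ex T).
- by move=> i k x ns e /H Qk; apply: (y_ex T).
- by move=> i u v k Vu Vv /H; apply: (link_ex T).
Qed.

Lemma infinite_above (E : rel nat) (N : structure L0) Q V (a b : N) n : @tree_axioms E N Q V ->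
  isA a -> isA b -> cex a a n -> (forall k, cge b b k) -> below a b.
Proof.
move=> T Aa Ab Hn Hb; have [//|[Eab|Bba]] := below_total T Aa Ab.
  by subst; case: Hn => _ [].
by case: Hn => _ []; apply: (lev_mono T Bba).
Qed.

(** With counting bounded by [q], all levels from [q] on receive the label [Inf]. That class
    contains an element of level exactly [q] and has no least element, since every finite level is
    open below, so [Least] does not occur. The bound on [fin] makes [E] well founded there, whatever
    infinite paths it has. *)
Lemma finite_view (E : rel nat) (N : structure L0) q V : (forall m n, E m n -> m < n) -> 0 < q ->
  @tree_axioms E N (fun k => k <= q) V ->
  view E (fun k => k <= q) (present (fun n => n < q) True False) V
    (label_of (fun n => n < q) (fun _ : N => False)).
Proof.
move=> E_lt q0 T.
have [a0 [V0 A0 H0]] := lev_ex T q0 (leqnn q).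
have I0 : beyond (fun n => n < q) a0.
  by split=> // n /(cex_inj H0) <-; rewrite -leqNgt.
have Ea : Acc (fun n m => E m n && (n < q)) 0.
  have H d m : q - m <= d -> Acc (fun n m => E m n && (n < q)) m.
    elim: d m => [|d IH] m Hm; constructor=> n /andP[/E_lt mn nq]; first by lia.
    by apply: IH; lia.
  exact: H (leqnn _).
apply: (tree_view T E_lt _ _ _ _ _ Ea) => //.
- by move=> m n; apply: leq_ltn_trans.
- by move=> k l; apply: leq_trans.
- by move=> n k; rewrite -leqNgt => H1 H2; apply: leq_trans H1.
- by split=> [[x []]|[]].
- by move=> _; exists a0; split=> // -[].
- move=> i b Vb [Ab Ib] _; have [[n Hn]|Hinf] := cexVcge b b.
    have [c [Vc Bc Hc]] := lev_dn T Vb Ab Hn.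
    exists c; split=> //; split; first by exists b.
    by move=> m /(cex_inj Hc) <-; apply: Ib.
  (* Below an element of genuinely infinite level, the element [a0] of level [q] will do. *)
  exists a0; split=> //; first exact: (V_leq T (leq0n i.+1) V0).
  exact: infinite_above T A0 Ab H0 Hinf.
Qed.

(** The summand 3 pays for [y] itself, for the other endpoint and for the link in one move of the
    game; the chain has length at most [q]. *)
Lemma chain_size (E : rel nat) (N : structure L0) q V : (forall m n, E m n -> m < n) -> 0 < q ->
  @tree_axioms E N (fun k => k <= q) V -> forall (y : N) s ls, isY y ->
  chain (label_of (fun n => n < q) (fun _ : N => False)) y 0 s ls -> size s + 3 <= q + 3.
Proof.
move=> E_lt q0 T y s ls Yy C; rewrite leq_add2r.
by have [] := v_legal (finite_view E_lt q0 T) Yy C.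
Qed.

(** A sentence is decided by the view up to one more than its rank, and this view looks the same in
    all tree structures over [E]. Thus each of them is a model of the theory of any other. *)
Lemma tree_equivalent (E : rel nat) (N N' : structure L0) (phi : formula L0) :
  (forall m n, E m n -> m < n) -> tree_structure E N -> tree_structure E N' ->
  sentence phi -> holds N phi -> holds N' phi.
Proof.
move=> E_lt T T' sphi HN v'; pose q := (rank phi).+1.
have [u0] := dom_inhabited N.
have TQ := tree_axioms_weaken (Q' := fun k => k <= q) (fun _ _ => I) T.
have TQ' := tree_axioms_weaken (Q' := fun k => k <= q) (fun _ _ => I) T'.
have W := finite_view E_lt (ltn0Sn _) TQ; have W' := finite_view E_lt (ltn0Sn _) TQ'.
have Qd k l : l <= k -> k <= q -> l <= q by apply: leq_trans.
have G := satR_game W W' Qd (chain_size E_lt (ltn0Sn _) TQ) (chain_size E_lt (ltn0Sn _) TQ')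
  (leq_addl _ _) (phi := phi) (t := 0) (p := [::]) (v := fun=> u0) (v' := v').
apply/satR_True/G; last exact/satR_True/HN.
- exact: good_nil.
- by move=> n; rewrite (negbTE (sphi n)).
- by rewrite add0n leqnSn.
Qed.

Definition is_least (N : structure L0) (a : N) : Prop :=
  beyond predT a /\ forall b : N, beyond predT b -> a = b \/ below a b.

(** Without an infinite path every finite level keeps a label of its own, and only the two facts
    [pI] and [pL] about the infinite part remain to distinguish countable structures. *)
Lemma infinite_view (E : rel nat) (N : structure L0) (pI pL : Prop) : (forall m n, E m n -> m < n) ->
  Acc (fun n m => E m n) 0 -> tree_structure E N ->
  (pL <-> exists a : N, is_least a) -> (pI <-> exists a : N, beyond predT a /\ ~ is_least a) ->
  view E (fun=> True) (present predT pI pL) (fun _ _ => True) (label_of predT (@is_least N)).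
Proof.
move=> E_lt E_acc T HL HI.
have Ea : Acc (fun n m => E m n && predT n) 0.
  by elim: E_acc => m _ IH; constructor=> n; rewrite andbT; apply: IH.
apply: (tree_view T E_lt _ _ _ _ _ Ea) => //.
- by move=> a [].
- by move=> a b [_ H] /H.
- by symmetry.
- by move=> a H1 H2; apply/HI; exists a.
- by move=> /HI[a [? ?]]; exists a.
- move=> _ b _ Ib Lb.
  have [d [Id Bd]] : exists d, beyond predT d /\ below d b.
    apply: NNPP => H; apply: Lb; split=> // d Id.
    have [|[->|]] := below_total T (proj1 Id) (proj1 Ib); [|by left|by right].
    by move=> Bd; case: H; exists d.
  have [Ld|Ld] := classic (is_least d); last by exists d.
  (* If [d] is itself the least element, an element strictly between [d] and [b] is taken
     instead. *)
  have [c [_ Bdc Bcb]] := below_dense T (i := 0) I I Bd.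
  exists c; split=> //; first by apply: (beyond_up T) Bdc Id.
  move=> [_ /(_ d Id)[Ecd|Bcd]]; first by subst; apply: (below_irr T Bdc).
  exact: (below_irr T (below_trans T Bcd Bdc)).
Qed.

(* Without elements of infinite level, with such elements but no least one, with a least one. *)
Definition okg_of (j : nat) (d : nat * nat) : bool :=
  match j with 0 => false | 1 => true | _ => (d == (0, 0)) || dlt (0, 0) d end.

Lemma okg_of_up j d e : dlt d e -> okg_of j d -> okg_of j e.
Proof.
case: j => [|[|j]] //= H /orP[/eqP <-|H']; first by rewrite H orbT.
by rewrite (dlt_trans H' H) orbT.
Qed.

Lemma cmodel_tree (E : rel nat) (okg : pred (nat * nat)) (f : nat -> nat) (hasp : bool) : (forall m n, E m n -> m < n) ->
  (forall d e, dlt d e -> okg d -> okg e) ->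
  (hasp -> f 0 = 0 /\ forall i, E (f i) (f i.+1)) ->
  tree_structure E (cmodel E okg f hasp).
Proof.
move=> E_lt Hok Hf; apply: (cmodel_axioms E_lt Hok Hf (Q := fun=> True) (V := fun _ _ => True)) => //.
- by move=> _ n d _; exists (ddn d) => //; apply: dlt_dn.
- by move=> _ o d _; exists (dup d) => //; apply: dlt_up.
- by move=> _ o d e _ _ H; exists (dmid d e); split=> //; [apply: dlt_midl|apply: dlt_midr].
- move=> i s e Qs _ _.
  have [[j Hj]|H] := classic (exists j, ~ List.In (EY (inl (s, j))) e); first by exists j.
  have : (size e).+1 <= size e; last by rewrite ltnn.
  apply: (pigeon (g := fun j => EY (inl (s, j)))) => [k l _ _ []//|j _].
  by apply: NNPP => H'; apply: H; exists j.
Qed.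

(** * Invariants under isomorphism *)

Section Invariants.
Variables (N N' : structure L0) (h : N -> N') (h' : N' -> N).
Hypotheses (hK : cancel h h') (hK' : cancel h' h)
  (h_below : forall u v, below u v <-> below (h u) (h v))
  (h_link : forall z u v, link z u v <-> link (h z) (h u) (h v)).

Lemma iso_isA u : isA (h u) <-> isA u.
Proof.
split=> -[v H]; first by exists (h' v); apply/h_below; rewrite hK'.
by exists (h v); apply/h_below.
Qed.

Lemma iso_isZ u : isZ (h u) <-> isZ u.
Proof.
split=> -[v [w H]]; first by exists (h' v), (h' w); apply/h_link; rewrite !hK'.
by exists (h v), (h w); apply/h_link.
Qed.

Lemma iso_cge u v k : cge (h u) (h v) k <-> cge u v k.
Proof.
split=> -[g H1 H2].
  exists (h' \o g) => [i Hi|i j Hi Hj /(can_inj hK')]; last exact: H2.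
  by apply/h_link; rewrite hK'; apply: H1.
exists (h \o g) => [i Hi|i j Hi Hj /(can_inj hK)]; last exact: H2.
exact/h_link/H1.
Qed.

Lemma iso_cex u v k : cex (h u) (h v) k <-> cex u v k.
Proof. by rewrite /cex !iso_cge. Qed.

Lemma iso_beyond fin u : beyond fin (h u) <-> beyond fin u.
Proof.
rewrite /beyond iso_isA; split=> -[Au H]; split=> // n Hn; apply: H; exact/iso_cex.
Qed.

Lemma iso_least u : is_least u -> is_least (h u).
Proof.
move=> [H1 H2]; split=> [|b Hb]; first exact/iso_beyond.
have [|->|B] := H2 (h' b); first by apply/iso_beyond; rewrite hK'.
  by left; rewrite hK'.
by right; move/h_below: B; rewrite hK'.
Qed.

End Invariants.

Definition has_infinite_chain (N : structure L0) : Prop :=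
  exists2 y : N, isY y & forall n, exists a c, [/\ isA a, cex y a c & n < c].

Lemma isomorphicP (N N' : structure L0) : isomorphic N N' -> exists h h',
  [/\ @cancel N' N h h', cancel h' h, forall u v, below u v <-> below (h u) (h v) &
  forall z u v, link z u v <-> link (h z) (h u) (h v)].
Proof.
move=> [h [[h' H1 H2] _ Hr]]; exists h, h'; split=> // [u v|z u v].
  rewrite /below (Hr rs_lt); suff -> : map_tuple h [tuple u; v] = [tuple h u; h v] by [].
  exact: val_inj.
rewrite /link (Hr rs_link); suff -> : map_tuple h [tuple z; u; v] = [tuple h z; h u; h v] by [].
exact: val_inj.
Qed.

Lemma isomorphic_sym (L : language) (N N' : structure L) : isomorphic N N' -> isomorphic N' N.
Proof.
move=> [h [[h' H1 H2] Hf Hr]]; exists h'; split; first by exists h.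
  move=> g a; rewrite -[a in LHS](_ : map_tuple h (map_tuple h' a) = a) -?Hf ?H1 //.
  by apply: eq_from_tnth => i; rewrite !tnth_map H2.
move=> r a; rewrite -[a in X in X <-> _](_ : map_tuple h (map_tuple h' a) = a) -?Hr //.
by apply: eq_from_tnth => i; rewrite !tnth_map H2.
Qed.

Lemma iso_invariants (N N' : structure L0) : isomorphic N N' ->
  [/\ (exists a : N, beyond predT a) -> (exists a : N', beyond predT a),
      (exists a : N, is_least a) -> (exists a : N', is_least a) &
      has_infinite_chain N -> has_infinite_chain N'].
Proof.
move=> /isomorphicP[h [h' [H1 H2 H3 H4]]]; split.
- by move=> [a Ha]; exists (h a); apply/(iso_beyond H1 H2 H3 H4).
- by move=> [a Ha]; exists (h a); apply: (iso_least H1 H2 H3 H4).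
- move=> [y [nA nZ] Hy]; exists (h y).
    by split; rewrite ?(iso_isA H2 H3) ?(iso_isZ H2 H4).
  move=> n; have [a [c [Aa Ha nc]]] := Hy n; exists (h a), c; split=> //.
    exact/(iso_isA H2 H3).
  exact/(iso_cex H1 H2 H4).
Qed.

Section Models.
Variable E : rel nat.
Hypothesis E_lt : forall m n, E m n -> m < n.

Definition std j f hasp : structure L0 := cmodel E (okg_of j) f hasp.
Notation id_path f hasp := (hasp -> f 0 = 0 /\ forall i : nat, E (f i) (f i.+1)).

Lemma std_tree j f (hasp : bool) : id_path f hasp -> tree_structure E (std j f hasp).
Proof. by move=> Hf; apply: cmodel_tree => //; apply: okg_of_up. Qed.

Definition std0 : structure L0 := std 0 id false.

Lemma std0_tree : tree_structure E std0.
Proof. exact: std_tree. Qed.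

Lemma tree_model N : tree_structure E N -> model (Th std0) N.
Proof. by move=> T phi [H1 H2]; apply: (tree_equivalent E_lt std0_tree T). Qed.

Lemma std_beyond j f (hasp : bool) (u : std j f hasp) : id_path f hasp ->
  beyond predT u <-> exists d, sval u = EA (None, d).
Proof.
move=> Hf; have Hok := @okg_of_up j; split=> [[Au Hu]|[d Hd]].
  have [[[n|] d] Ha] := proj1 (isAE Hok u) Au; last by exists d.
  by have /(_ n.+1) := Hu; rewrite (cexA Hf _ Ha) => /(_ erefl).
split; first by apply/(isAE Hok); exists (None, d).
by move=> n /(cexA Hf _ Hd).
Qed.

Lemma std_types j f (hasp : bool) : id_path f hasp ->
  ((exists a : std j f hasp, beyond predT a) <-> 0 < j) /\
  ((exists a : std j f hasp, is_least a) <-> 1 < j) /\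
  ((exists a : std j f hasp, beyond predT a /\ ~ is_least a) <-> 0 < j).
Proof.
move=> Hf; have Hok := @okg_of_up j; have T := std_tree j Hf.
have mk d : okg_of j d -> exists u : std j f hasp, sval u = EA (None, d).
  by move=> Od; have Oa : okA (okg_of j) (None, d) by []; exists (mkA E f hasp Oa).
have up (u : std j f hasp) : beyond predT u -> exists2 c, below u c & beyond predT c.
  move=> Iu; have [c [_ Bc _]] := lev_up T (i := 0) I (proj1 Iu).
  by exists c => //; apply: (beyond_up T) Bc Iu.
have B1 : (exists a : std j f hasp, beyond predT a) <-> 0 < j.
  split=> [[a /(std_beyond _ Hf)[d Hd]]|j0].
    by have := proj2_sig a; rewrite Hd /=; case: (j).
  have [|u Hu] := mk (0, 0); first by case: (j) j0 => [|[|]].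
  by exists u; apply/(std_beyond _ Hf); exists (0, 0).
split=> //; split.
  split=> [[a [Ia La]]|j1].
    case: (ltnP 1 j) => // jle.
    have j1 : j = 1 by have : 0 < j by [apply/B1; exists a]; lia.
    have [d Hd] := proj1 (std_beyond _ Hf) Ia.
    have [|c Hc] := mk (ddn d); first by rewrite j1.
    have Ic : beyond predT c by apply/(std_beyond _ Hf); exists (ddn d).
    have Bca : below c a by apply/belowE; exists (None, ddn d), (None, d); split=> //; apply: dlt_dn.
    case: (La c Ic) => [Eac|Bac]; first by subst; case: (below_irr T Bca).
    by case: (below_irr T (below_trans T Bca Bac)).
  have [|u Hu] := mk (0, 0); first by case: (j) j1 => [|[|]].
  exists u; split=> [|b /(std_beyond _ Hf)[d Hd]]; first by apply/(std_beyond _ Hf); exists (0, 0).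
  have Od : okg_of j d by have := proj2_sig b; rewrite Hd.
  have [Ed|Ed] : d = (0, 0) \/ dlt (0, 0) d.
      by case: (j) j1 Od => [|[|k]] //= _ /orP[/eqP|]; [left|right].
    by left; apply: cdom_eq; rewrite Hu Hd Ed.
  by right; apply/belowE; exists (None, (0, 0)), (None, d).
rewrite -B1; split=> [[a [Ia _]]|[a Ia]]; first by exists a.
have [c Bac Ic] := up a Ia; exists c; split=> // -[_ /(_ a Ia)[Eca|Bca]].
  by subst; apply: (below_irr T Bac).
exact: (below_irr T (below_trans T Bac Bca)).
Qed.

(** Every countable model of the theory is again a tree structure. Whether it has a least element of
    infinite level, and whether it has others, is all that enters its view, and this selects one of
    the three standard structures. *)
Lemma three_models : Acc (fun n m => E m n) 0 -> has_exactly_countable_models (Th std0) 3.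
Proof.
move=> E_acc; have nopath : id_path id false by [].
exists (fun i => std i id false); split.
- move=> i; split; first exact: cmodel_countable.
  exact/tree_model/std_tree.
- move=> i j Hij; have [I1 I2 _] := iso_invariants Hij.
  have [J1 J2 _] := iso_invariants (isomorphic_sym Hij).
  have [A1 [A2 _]] := std_types i nopath; have [B1 [B2 _]] := std_types j nopath.
  apply: val_inj => /=; have := ltn_ord i; have := ltn_ord j.
  have C1 : 0 < i <-> 0 < j by rewrite -A1 -B1; split.
  have C2 : 1 < i <-> 1 < j by rewrite -A2 -B2; split.
  case: (posnP i) => [i0|i0].
    by case: (posnP j) => [j0|/(proj2 C1)]; lia.
  have j0 := proj1 C1 i0; case: (ltnP 1 i) => [i1|i1]; first by have := proj1 C2 i1; lia.
  by case: (ltnP 1 j) => [/(proj2 C2)|]; lia.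
- move=> N CN MN; have TN : tree_structure E N by apply: tree_extract std0_tree MN.
  pose pL := exists a : N, is_least a.
  pose pI := exists a : N, beyond predT a /\ ~ is_least a.
  (* Above a least element of infinite level there are further ones, so [pL] implies [pI] and only
     three combinations remain. *)
  have [i [Hi1 Hi2]] : exists i : 'I_3, (pL <-> 1 < i) /\ (pI <-> 0 < i).
    have [HL|HL] := classic pL.
      exists (inord 2); rewrite inordK //; split; split=> // _.
      have [a La] := HL; have [c [_ Bac _]] := lev_up TN (i := 0) I (proj1 (proj1 La)).
      exists c; split=> [|[_ Lc]]; first by apply: (beyond_up TN) Bac (proj1 La).
      have [Eca|Bca] := Lc a (proj1 La); first by subst; apply: (below_irr TN Bac).
      exact: (below_irr TN (below_trans TN Bac Bca)).
    have [HI|HI] := classic pI; first by exists (inord 1); rewrite inordK.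
    by exists ord0.
  exists i; have [_ [A2 A3]] := std_types i nopath.
  have W := infinite_view (pI := pI) (pL := pL) E_lt E_acc TN (iff_refl _) (iff_refl _).
  have W' := infinite_view (pI := pI) (pL := pL) E_lt E_acc (std_tree i nopath).
  apply: (view_isomorphic W (W' _ _) CN (@cmodel_countable _ _ _ _)).
    by rewrite Hi1 A2.
  by rewrite Hi2 A3.
Qed.

Lemma std_chain j f (hasp : bool) : id_path f hasp -> has_infinite_chain (std j f hasp) <-> hasp.
Proof.
move=> Hf; have Hok := @okg_of_up j; split=> [[y Yy Hy]|Hp].
  have [y0 Ey] := proj1 (isYE Hok y) Yy.
  have := proj2_sig y; rewrite Ey; case: y0 Ey => [[s i]|i] Ey //= Oy.
  have Hs n : exists a c, List.In (a, c) (zip s (cols 0 (map alab s))) /\ n < c.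
    have [a [c [Aa Ha nc]]] := Hy n; have [a0 Ea] := proj1 (isAE Hok a) Aa.
    by exists a0, c; split=> //; move/(cexY E_lt Hf _ Ey Ea): Ha.
  have Hz : forall t : seq (ael * nat), exists n, forall a c, List.In (a, c) t -> c <= n.
    elim=> [|[a c] t [n IH]]; first by exists 0.
    by exists (c + n) => b d /= [[_ <-]|/IH]; lia.
  have [n Hn] := Hz (zip s (cols 0 (map alab s))).
  by have [a [c [H1 H2]]] := Hs n; have := Hn a c H1; lia.
have Oy : okY E (okg_of j) hasp (inr 0) by [].
pose y : std j f hasp := mkY f Oy.
have Ey : sval y = EY (inr 0) by [].
exists y => [|n]; first by apply/(isYE Hok); exists (inr 0).
have Oa i : okA (okg_of j) (fptr f i) by [].
exists (mkA E f hasp (Oa n.+1)), (f n.+1); split; first by apply/(isAE Hok); exists (fptr f n.+1).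
  by apply/(cexY E_lt Hf _ Ey (a := fptr f n.+1)) => //; exists n.+1.
have: forall i, i <= f i by elim=> // i IH; apply: leq_ltn_trans IH (fS_gt E_lt Hf _ Hp).
by apply.
Qed.

(* The fourth model has no element of infinite level but an element with infinitely many pointers. *)
Lemma not_three_models f : f 0 = 0 -> (forall i, E (f i) (f i.+1)) ->
  ~ has_exactly_countable_models (Th std0) 3.
Proof.
move=> f0 Hf [M [_ _ HM]].
have P b : id_path f b by [].
(* The types [i.-1] are 0, 0, 1, 2: the indices 0 and 1 both lack elements of infinite level and
   differ only in the pointers along the path, present at index 0. *)
pose X (i : 'I_4) := std (i.-1) f (i == ord0).
have [g Hg] : exists g : 'I_4 -> 'I_3, forall i, isomorphic (X i) (M (g i)).
  have H i : exists k, isomorphic (X i) (M k).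
    by apply: HM; [exact: cmodel_countable|exact/tree_model/std_tree].
  exists (fun i => sval (constructive_indefinite_description _ (H i))) => i.
  by case: constructive_indefinite_description.
suff Ig : injective g by have := leq_card g Ig; rewrite !card_ord.
have trans (N N' N'' : structure L0) : isomorphic N N'' -> isomorphic N' N'' ->
    [/\ (exists a : N, beyond predT a) -> (exists a : N', beyond predT a),
      (exists a : N, is_least a) -> (exists a : N', is_least a) &
      has_infinite_chain N -> has_infinite_chain N'].
  move=> /iso_invariants[A1 A2 A3] /isomorphic_sym/iso_invariants[B1 B2 B3].
  by split; auto.
move=> i j Eg; have Hi := Hg i; have Hj := Hg j; rewrite Eg in Hi.
have [I1 I2 I3] := trans _ _ _ Hi Hj; have [J1 J2 J3] := trans _ _ _ Hj Hi.
have [A1 [A2 _]] := std_types i.-1 (P (i == ord0)); have [B1 [B2 _]] := std_types j.-1 (P (j == ord0)).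
have C1 : 0 < i.-1 <-> 0 < j.-1 by rewrite -A1 -B1; split.
have C2 : 1 < i.-1 <-> 1 < j.-1 by rewrite -A2 -B2; split.
have C3 : i == ord0 <-> j == ord0.
  by rewrite -(std_chain i.-1 (P _)) -(std_chain j.-1 (P _)); split.
apply: val_inj => /=; have := ltn_ord i; have := ltn_ord j.
have E0 (k : 'I_4) : (k == ord0) = (val k == 0) by [].
rewrite !E0 /= in C3.
case: (posnP i) => [i0|i0].
  by have := proj1 C3; rewrite i0 => /(_ isT)/eqP ->.
case: (posnP j) => [j0|j0]; first by have := proj2 C3; rewrite j0 => /(_ isT)/eqP ->.
case: (ltnP 0 i.-1) => [i1|i1]; last by case: (ltnP 0 j.-1) => [/(proj2 C1)|]; lia.
have j1 := proj1 C1 i1; case: (ltnP 1 i.-1) => [i2|i2]; first by have := proj1 C2 i2; lia.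
by case: (ltnP 1 j.-1) => [/(proj2 C2)|]; lia.
Qed.

End Models.

(** * Computable functions *)

Definition pfst x := (Cantor.of_nat x).1.
Definition psnd x := (Cantor.of_nat x).2.

Arguments cpair : simpl never.
Arguments pfst : simpl never.
Arguments psnd : simpl never.

Lemma pfst_pair x y : pfst (cpair x y) = x.
Proof. by rewrite /pfst /cpair Cantor.cancel_of_to. Qed.
Lemma psnd_pair x y : psnd (cpair x y) = y.
Proof. by rewrite /psnd /cpair Cantor.cancel_of_to. Qed.
Lemma cpair_eta x : cpair (pfst x) (psnd x) = x.
Proof. by rewrite /cpair /pfst /psnd -surjective_pairing Cantor.cancel_to_of. Qed.
Lemma cpair_inj x y x' y' : cpair x y = cpair x' y' -> x = x' /\ y = y'.
Proof.
by move=> H; split; [move: (congr1 pfst H)|move: (congr1 psnd H)]; rewrite ?pfst_pair ?psnd_pair.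
Qed.
Lemma cpair_ge x y : x + y <= cpair x y.
Proof. by have := Cantor.to_nat_non_decreasing x y; rewrite /cpair; lia. Qed.
Lemma pfst_le x : pfst x <= x.
Proof. by have := cpair_ge (pfst x) (psnd x); rewrite cpair_eta; lia. Qed.
Lemma psnd_le x : psnd x <= x.
Proof. by have := cpair_ge (pfst x) (psnd x); rewrite cpair_eta; lia. Qed.

Definition pairE := (pfst_pair, psnd_pair).

(** One program must serve for all oracles, so it can be used both for indices, where the oracle is
    empty, and inside the reduction. *)
Definition cmp (f : nat -> nat) : Prop :=
  exists p, forall A x y, run A p x y <-> y = f x.
Definition cmpb (b : nat -> bool) : Prop := cmp (fun x => b x).

Lemma cmp_ext f g : (forall x, f x = g x) -> cmp f -> cmp g.
Proof. by move=> H [p Hp]; exists p => A x y; rewrite Hp H. Qed.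

Lemma cmpb_ext f g : (forall x, f x = g x) -> cmpb f -> cmpb g.
Proof. by move=> H; apply: cmp_ext => x; rewrite H. Qed.

Lemma cmp_pair f g : cmp f -> cmp g -> cmp (fun x => cpair (f x) (g x)).
Proof.
move=> [p Hp] [q Hq]; exists (Pair p q) => A x y /=; split.
  by move=> [u [v [/Hp -> /Hq -> ->]]].
by move=> ->; exists (f x), (g x); split=> //; [apply/Hp|apply/Hq].
Qed.

Lemma cmp_comp f g : cmp f -> cmp g -> cmp (fun x => f (g x)).
Proof.
move=> [p Hp] [q Hq]; exists (Comp p q) => A x y /=; split.
  by move=> [z /Hq -> /Hp ->].
by move=> ->; exists (g x); [apply/Hq|apply/Hp].
Qed.

Lemma cmp_pfst f : cmp f -> cmp (fun x => pfst (f x)).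
Proof. by apply: cmp_comp; exists Fst. Qed.
Lemma cmp_psnd f : cmp f -> cmp (fun x => psnd (f x)).
Proof. by apply: cmp_comp; exists Snd. Qed.
Lemma cmp_S f : cmp f -> cmp (fun x => (f x).+1).
Proof. by apply: (@cmp_comp succn); exists Succ. Qed.

(** The identity is not a basic program; pairing the two projections gives it. *)
Lemma cmp_id : cmp (fun x => x).
Proof.
apply: (@cmp_ext (fun x => cpair (pfst x) (psnd x))); first exact: cpair_eta.
by apply: cmp_pair; [exists Fst|exists Snd].
Qed.

Lemma cmp_const n : cmp (fun=> n).
Proof. by elim: n => [|n IH]; [exists Zero|apply: cmp_S]. Qed.

Definition nrec (b : nat) (s : nat -> nat -> nat) (n : nat) : nat :=
  nat_rect (fun=> nat) b s n.

Lemma cmp_nrec b s n : cmp b -> cmp n ->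
  cmp (fun w => s (pfst w) (pfst (psnd w)) (psnd (psnd w))) ->
  cmp (fun x => nrec (b x) (s x) (n x)).
Proof.
move=> Hb Hn [q Hq].
have H : cmp (fun x => nrec (b (pfst x)) (s (pfst x)) (psnd x)).
  have [p Hp] := Hb; exists (Prec p q) => A x y /=.
  rewrite -/(pfst x) -/(psnd x); elim: (psnd x) y => [|m IH] y /=; first exact: Hp.
  split=> [[z /IH -> /Hq ->]|->]; first by rewrite !pairE.
  exists (nrec (b (pfst x)) (s (pfst x)) m); first exact/IH.
  by apply/Hq; rewrite !pairE.
apply: (@cmp_ext (fun x => nrec (b (pfst (cpair x (n x)))) (s (pfst (cpair x (n x)))) (psnd (cpair x (n x))))).
  by move=> x; rewrite !pairE.
exact: (cmp_comp H (cmp_pair cmp_id Hn)).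
Qed.

Lemma cmp_pred f : cmp f -> cmp (fun x => (f x).-1).
Proof.
move=> Hf; apply: (@cmp_ext (fun x => nrec 0 (fun m _ => m) (f x))); first by move=> x; case: (f x).
apply: cmp_nrec => //; first exact: cmp_const.
exact/cmp_pfst/cmp_psnd/cmp_id.
Qed.

Lemma cmp_add f g : cmp f -> cmp g -> cmp (fun x => f x + g x).
Proof.
move=> Hf Hg; apply: (@cmp_ext (fun x => nrec (f x) (fun _ z => z.+1) (g x))).
  by move=> x; elim: (g x) => [|n /= ->]; rewrite ?addn0 ?addnS.
apply: cmp_nrec => //; exact/cmp_S/cmp_psnd/cmp_psnd/cmp_id.
Qed.

Lemma cmp_sub f g : cmp f -> cmp g -> cmp (fun x => f x - g x).
Proof.
move=> Hf Hg; apply: (@cmp_ext (fun x => nrec (f x) (fun _ z => z.-1) (g x))).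
  by move=> x; elim: (g x) => [|n /= ->]; rewrite ?subn0 ?subnS.
apply: cmp_nrec => //; exact/cmp_pred/cmp_psnd/cmp_psnd/cmp_id.
Qed.

Lemma cmp_mul f g : cmp f -> cmp g -> cmp (fun x => f x * g x).
Proof.
move=> Hf Hg; apply: (@cmp_ext (fun x => nrec 0 (fun _ z => z + f x) (g x))).
  by move=> x; elim: (g x) => [|n /= ->]; rewrite ?muln0 ?mulnSr.
apply: cmp_nrec => //; first exact: cmp_const.
apply: cmp_add; first exact/cmp_psnd/cmp_psnd/cmp_id.
exact/(cmp_comp Hf)/cmp_pfst/cmp_id.
Qed.

Lemma cmp_exp2 f : cmp f -> cmp (fun x => 2 ^ f x).
Proof.
move=> Hf; apply: (@cmp_ext (fun x => nrec 1 (fun _ z => z + z) (f x))).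
  by move=> x; elim: (f x) => [|n /= ->] //; rewrite expnS mul2n addnn.
apply: cmp_nrec => //; first exact: cmp_const.
by apply: cmp_add; exact/cmp_psnd/cmp_psnd/cmp_id.
Qed.

Lemma cmp_if b f g : cmpb b -> cmp f -> cmp g -> cmp (fun x => if b x then f x else g x).
Proof.
move=> Hb Hf Hg; apply: (@cmp_ext (fun x => nrec (g x) (fun _ _ => f x) (b x))).
  by move=> x; case: (b x).
apply: cmp_nrec => //; exact/(cmp_comp Hf)/cmp_pfst/cmp_id.
Qed.

Lemma cmp_bool b : cmpb b -> cmp (fun x => nat_of_bool (b x)).
Proof. by []. Qed.

Lemma cmpb_leq f g : cmp f -> cmp g -> cmpb (fun x => f x <= g x).
Proof.
move=> Hf Hg; apply: (@cmp_ext (fun x => 1 - (f x - g x))).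
  by move=> x; case: leqP; lia.
by apply: cmp_sub; [exact: cmp_const|exact: cmp_sub].
Qed.

Lemma cmpb_const b : cmpb (fun=> b).
Proof. exact: cmp_const. Qed.

Lemma cmpb_and b c : cmpb b -> cmpb c -> cmpb (fun x => b x && c x).
Proof.
move=> Hb Hc; apply: (@cmp_ext (fun x => b x * c x)); last exact: cmp_mul.
by move=> x; case: (b x) (c x) => -[].
Qed.

Lemma cmpb_not b : cmpb b -> cmpb (fun x => ~~ b x).
Proof.
move=> Hb; apply: (@cmp_ext (fun x => 1 - b x)); first by move=> x; case: (b x).
by apply: cmp_sub => //; apply: cmp_const.
Qed.

Lemma cmpb_or b c : cmpb b -> cmpb c -> cmpb (fun x => b x || c x).
Proof.
move=> Hb Hc; apply: (@cmpb_ext (fun x => ~~ (~~ b x && ~~ c x))).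
  by move=> x; rewrite negb_and !negbK.
by apply/cmpb_not/cmpb_and; apply: cmpb_not.
Qed.

Lemma cmpb_imp b c : cmpb b -> cmpb c -> cmpb (fun x => b x ==> c x).
Proof.
move=> Hb Hc; apply: (@cmpb_ext (fun x => ~~ b x || c x)); first by move=> x; rewrite implybE.
by apply: cmpb_or => //; apply: cmpb_not.
Qed.

Lemma cmpb_if b c d : cmpb b -> cmpb c -> cmpb d -> cmpb (fun x => if b x then c x else d x).
Proof.
move=> Hb Hc Hd; apply: (@cmp_ext (fun x => if b x then nat_of_bool (c x) else d x)).
  by move=> x; case: (b x).
exact: cmp_if.
Qed.

Lemma cmpb_eq (f g : nat -> nat) : cmp f -> cmp g -> cmpb (fun x => f x == g x).
Proof.
move=> Hf Hg; apply: (@cmpb_ext (fun x => (f x <= g x) && (g x <= f x))).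
  by move=> x; rewrite eqn_leq.
by apply: cmpb_and; apply: cmpb_leq.
Qed.

Lemma cmpb_eqb (b c : nat -> bool) : cmpb b -> cmpb c -> cmpb (fun x => b x == c x).
Proof.
move=> Hb Hc; apply: (@cmpb_ext (fun x => nat_of_bool (b x) == nat_of_bool (c x))).
  by move=> x; case: (b x) (c x) => -[].
exact: cmpb_eq.
Qed.

Fixpoint ball n (P : nat -> bool) : bool := if n is m.+1 then ball m P && P m else true.
Definition bex n (P : nat -> bool) : bool := ~~ ball n (fun i => ~~ P i).

Lemma ballP n (P : nat -> bool) : reflect (forall i, i < n -> P i) (ball n P).
Proof.
elim: n => [|n IH] /=; first by apply: ReflectT.
apply: (iffP andP) => [[/IH H Pn] i|H]; last by split; [apply/IH => i Hi; apply: H; lia|apply: H].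
by rewrite ltnS leq_eqVlt => /orP[/eqP ->|/H].
Qed.

Lemma bexP n (P : nat -> bool) : reflect (exists2 i, i < n & P i) (bex n P).
Proof.
apply: (iffP idP) => [H|[i Hi Pi]]; last by apply/negP => /ballP /(_ i Hi); rewrite Pi.
apply: NNPP => H'; move/negP: H; apply; apply/ballP => i Hi.
by apply/negP => Pi; apply: H'; exists i.
Qed.

Lemma cmpb_ball n (P : nat -> nat -> bool) : cmp n ->
  cmpb (fun w => P (pfst w) (psnd w)) -> cmpb (fun x => ball (n x) (P x)).
Proof.
move=> Hn HP; apply: (@cmp_ext (fun x => nrec 1 (fun i z => P x i * z) (n x))).
  by move=> x; elim: (n x) => //= k ->; case: (ball _ _) (P x k) => -[].
apply: cmp_nrec => //; first exact: cmp_const.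
apply: cmp_mul; last exact/cmp_psnd/cmp_psnd/cmp_id.
apply: (@cmp_ext (fun w => P (pfst (cpair (pfst w) (pfst (psnd w)))) (psnd (cpair (pfst w) (pfst (psnd w)))))).
  by move=> w; rewrite !pairE.
apply: (cmp_comp HP); apply: cmp_pair; [exact/cmp_pfst/cmp_id|exact/cmp_pfst/cmp_psnd/cmp_id].
Qed.

Lemma cmpb_bex n (P : nat -> nat -> bool) : cmp n ->
  cmpb (fun w => P (pfst w) (psnd w)) -> cmpb (fun x => bex (n x) (P x)).
Proof. by move=> Hn HP; apply/cmpb_not/cmpb_ball => //; apply/cmpb_not. Qed.

Lemma cmp_min (P : nat -> nat -> bool) (H : forall x, exists y, P x y) :
  cmpb (fun w => P (pfst w) (psnd w)) -> cmp (fun x => ex_minn (H x)).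
Proof.
move=> /cmpb_not[p Hp]; exists (Min p) => A x y /=; case: ex_minnP => m Pm Hm.
rewrite Hp !pairE; split=> [[H1 H2]|->].
  apply/eqP; rewrite eqn_leq Hm ?andbT.
    by case: leqP => // /H2[k /Hp]; rewrite !pairE Pm.
  by case: (P x y) H1.
split=> [|k km]; first by rewrite Pm.
exists 0; apply/Hp; rewrite !pairE; case E0 : (P x k) => //.
by have := Hm k E0; rewrite leqNgt km.
Qed.

Lemma cmp_iter F f n : cmp F -> cmp f -> cmp n -> cmp (fun x => iter (n x) F (f x)).
Proof.
move=> HF Hf Hn; apply: (@cmp_ext (fun x => nrec (f x) (fun _ z => F z) (n x))).
  by move=> x; elim: (n x) => //= k ->.
apply: cmp_nrec => //; exact/(cmp_comp HF)/cmp_psnd/cmp_psnd/cmp_id.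
Qed.

(** * Coded lists and course-of-values recursion *)

Definition lcons x c := (cpair x c).+1.
Definition lhd c := pfst c.-1.
Definition ltl c := psnd c.-1.
Definition lnth c i := lhd (iter i ltl c).
(** The length is obtained as the number of non-empty iterated tails; a list is never longer than
    its code, so [c] steps suffice and the definition is a primitive recursion. *)
Fixpoint lsize_upto n c := if n is m.+1 then lsize_upto m c + (iter m ltl c != 0) else 0.
Definition lsize c := lsize_upto c c.

Lemma ltl_lt c : 0 < c -> ltl c < c.
Proof. by case: c => // c _; rewrite ltnS; apply: psnd_le. Qed.

Lemma list_of_code c : exists s, seq_code s = c.
Proof.
elim/ltn_ind: c => -[_|c IH]; first by exists [::].
have [s Hs] := IH (ltl c.+1) (ltl_lt (ltn0Sn c)).
by exists (lhd c.+1 :: s); rewrite /= Hs cpair_eta.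
Qed.

Lemma ltl_cons x c : ltl (lcons x c) = c. Proof. by rewrite /ltl /= psnd_pair. Qed.
Lemma lhd_cons x c : lhd (lcons x c) = x. Proof. by rewrite /lhd /= pfst_pair. Qed.

Lemma ltl_iter s i : iter i ltl (seq_code s) = seq_code (drop i s).
Proof.
elim: i s => [|i IH] s; first by rewrite drop0.
rewrite iterSr; case: s => [|x s]; last by rewrite (ltl_cons x) IH.
by rewrite -[ltl _]/(seq_code [::]) IH.
Qed.

Lemma lnth_code s i : lnth (seq_code s) i = nth 0 s i.
Proof.
rewrite /lnth ltl_iter; elim: s i => [|x s IH] [|i] //=.
by rewrite -/(lcons _ _) lhd_cons.
Qed.

Lemma size_le_code s : size s <= seq_code s.
Proof. by elim: s => //= x s IH; rewrite ltnS; apply: leq_trans IH _; have := cpair_ge x (seq_code s); lia. Qed.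

Lemma lsize_code s : lsize (seq_code s) = size s.
Proof.
rewrite /lsize -[RHS](minn_idPr (size_le_code s)).
elim: {1 3}(seq_code s) => [|n IH] /=; first by rewrite min0n.
rewrite IH ltl_iter; case: (leqP (size s) n) => H; first by rewrite drop_oversize //=; lia.
by rewrite (drop_nth 0 H) /=; lia.
Qed.

Lemma cmp_lcons f g : cmp f -> cmp g -> cmp (fun x => lcons (f x) (g x)).
Proof. by move=> Hf Hg; apply/cmp_S/cmp_pair. Qed.
Lemma cmp_lhd f : cmp f -> cmp (fun x => lhd (f x)).
Proof. by move=> Hf; apply/cmp_pfst/cmp_pred. Qed.
Lemma cmp_ltl f : cmp f -> cmp (fun x => ltl (f x)).
Proof. by move=> Hf; apply/cmp_psnd/cmp_pred. Qed.
Lemma cmp_lnth f g : cmp f -> cmp g -> cmp (fun x => lnth (f x) (g x)).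
Proof. by move=> Hf Hg; apply/cmp_lhd/cmp_iter => //; apply/cmp_ltl/cmp_id. Qed.

Lemma cmp_lsize f : cmp f -> cmp (fun x => lsize (f x)).
Proof.
apply: (@cmp_comp lsize).
apply: (@cmp_ext (fun x => nrec 0 (fun m z => z + (iter m ltl x != 0)) x)).
  move=> x; rewrite /lsize; suff H k : nrec 0 (fun m z => z + (iter m ltl x != 0)) k = lsize_upto k x by [].
  by elim: k => //= k ->.
apply: cmp_nrec; [exact: cmp_const|exact: cmp_id|].
apply: cmp_add; first exact/cmp_psnd/cmp_psnd/cmp_id.
apply/cmpb_not/cmpb_eq; last exact: cmp_const.
apply: cmp_iter; [exact/cmp_ltl/cmp_id|exact/cmp_pfst/cmp_id|exact/cmp_pfst/cmp_psnd/cmp_id].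
Qed.

Ltac cmp_hook := fail.
Ltac cmp_step := first [ assumption | cmp_hook | lazymatch goal with
  | |- cmp (fun x => x) => apply: cmp_id
  | |- cmp (fun _ => ?n) => apply: (@cmp_const n)
  | |- cmpb (fun _ => ?b) => apply: (@cmpb_const b)
  | |- cmp (fun x => cpair (@?f x) (@?g x)) => apply: (@cmp_pair f g)
  | |- cmp (fun x => pfst (@?f x)) => apply: (@cmp_pfst f)
  | |- cmp (fun x => psnd (@?f x)) => apply: (@cmp_psnd f)
  | |- cmp (fun x => (@?f x).+1) => apply: (@cmp_S f)
  | |- cmp (fun x => (@?f x).-1) => apply: (@cmp_pred f)
  | |- cmp (fun x => @?f x + @?g x) => apply: (@cmp_add f g)
  | |- cmp (fun x => @?f x - @?g x) => apply: (@cmp_sub f g)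
  | |- cmp (fun x => @?f x * @?g x) => apply: (@cmp_mul f g)
  | |- cmp (fun x => 2 ^ @?f x) => apply: (@cmp_exp2 f)
  | |- cmp (fun x => lcons (@?f x) (@?g x)) => apply: (@cmp_lcons f g)
  | |- cmp (fun x => lhd (@?f x)) => apply: (@cmp_lhd f)
  | |- cmp (fun x => ltl (@?f x)) => apply: (@cmp_ltl f)
  | |- cmp (fun x => lnth (@?f x) (@?g x)) => apply: (@cmp_lnth f g)
  | |- cmp (fun x => lsize (@?f x)) => apply: (@cmp_lsize f)
  | |- cmp (fun x => nat_of_bool (@?b x)) => apply: (@cmp_bool b)
  | |- cmpb (fun x => @?b x && @?c x) => apply: (@cmpb_and b c)
  | |- cmpb (fun x => ~~ @?b x) => apply: (@cmpb_not b)
  | |- cmpb (fun x => @?b x || @?c x) => apply: (@cmpb_or b c)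
  | |- cmpb (fun x => @?b x ==> @?c x) => apply: (@cmpb_imp b c)
  | |- cmpb (fun x => @?f x <= @?g x) => apply: (@cmpb_leq f g)
  | |- cmpb (fun x => ball (@?n x) (@?P x)) => apply: (@cmpb_ball n P)
  | |- cmpb (fun x => bex (@?n x) (@?P x)) => apply: (@cmpb_bex n P)
  | |- cmpb (fun x => @?f x == @?g x) => first [apply: (@cmpb_eq f g) | apply: (@cmpb_eqb f g)]
  | |- cmp ?f => first [let g := eval cbv beta in (fun x => f x) in progress change (cmp g)
      | apply: cmp_if]
  | |- cmpb ?f => first [let g := eval cbv beta in (fun x => f x) in progress change (cmpb g)
      | apply: cmpb_if]
  end ].
Ltac cmp_tac := repeat cmp_step.

(* Course-of-values recursion: [G a c] computes the next value from the parameter [a] and the code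
   [c] of the list of all previous values, the most recent one first. *)
Section CourseOfValues.
Variable G : nat -> nat -> nat.

Fixpoint covs a n : nat := if n is m.+1 then lcons (G a (covs a m)) (covs a m) else 0.
Definition cov a n := G a (covs a n).

Lemma covs_size a n : lsize (covs a n) = n.
Proof.
suff [s -> <-] : exists2 s, covs a n = seq_code s & size s = n by rewrite lsize_code.
by elim: n => [|n [s /= -> Hs]]; [exists [::]|exists (G a (seq_code s) :: s) => //=; rewrite Hs].
Qed.

Lemma covs_nth a n i : i < n -> lnth (covs a n) (n - i.+1) = cov a i.
Proof.
rewrite /lnth => Hi; suff -> : iter (n - i.+1) ltl (covs a n) = covs a i.+1 by rewrite lhd_cons.
elim: n Hi => // n IH; rewrite ltnS leq_eqVlt => /orP[/eqP ->|Hi]; first by rewrite subnn.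
by rewrite subSS -(prednK (n := n - i)) ?subn_gt0 // iterSr [covs a n.+1]/= ltl_cons -subnS IH.
Qed.

Lemma cmp_cov : cmp (fun w => G (pfst w) (psnd w)) -> cmp (fun w => cov (pfst w) (psnd w)).
Proof.
move=> HG.
have HC : cmp (fun w => covs (pfst w) (psnd w)).
  apply: (@cmp_ext (fun w => nrec 0 (fun _ z => lcons (G (pfst w) z) z) (psnd w))).
    by move=> w; elim: (psnd w) => //= n ->.
  apply: cmp_nrec; cmp_tac.
  apply: (@cmp_ext (fun w => G (pfst (cpair (pfst (pfst w)) (psnd (psnd w)))) (psnd (cpair (pfst (pfst w)) (psnd (psnd w)))))).
    by move=> w; rewrite !pairE.
  by apply: (cmp_comp HG); cmp_tac.
apply: (@cmp_ext (fun w => G (pfst (cpair (pfst w) (covs (pfst w) (psnd w)))) (psnd (cpair (pfst w) (covs (pfst w) (psnd w)))))).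
  by move=> w; rewrite !pairE.
by apply: (cmp_comp HG); cmp_tac.
Qed.

End CourseOfValues.

(** * Pi^1_1 sets and computable trees *)

Lemma seq_code_inj : injective seq_code.
Proof.
elim=> [|x s IH] [|y t] //= [] /cpair_inj[-> /IH ->]; by [].
Qed.

Lemma code_args_inj (T : Type) n (a b : {ffun 'I_n -> T}) (c : T -> nat) :
  (forall i t, c (a i) = c t -> a i = t) ->
  seq_code [seq c (a i) | i <- enum 'I_n] = seq_code [seq c (b i) | i <- enum 'I_n] -> a = b.
Proof.
move=> H /seq_code_inj/eq_in_map E; apply/ffunP => i; apply: H; apply: E.
by rewrite mem_enum.
Qed.

Lemma term_code_inj (L : language) : injective (@term_code L).
Proof.
elim/term_ind_ffun => [n|g a IH] [m|h b] /= /cpair_inj[] // _; first by move=> ->.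
move=> /cpair_inj[/val_inj E]; subst h.
by move=> H; congr App; apply: (code_args_inj _ H) => i t; apply: IH.
Qed.

Lemma goedel_inj (L : language) : injective (@goedel L).
Proof.
elim=> [t u|r a|p IH|p IHp q IHq|n p IH] [t' u'|r' a'|p'|p' q'|n' p'] /= /cpair_inj[] // _.
- by move=> /cpair_inj[/term_code_inj -> /term_code_inj ->].
- move=> /cpair_inj[/val_inj E]; subst r'.
  by move=> H; congr Rel; apply: (code_args_inj _ H) => i t; apply: term_code_inj.
- by move=> /IH ->.
- by move=> /cpair_inj[/IHp -> /IHq ->].
- by move=> /cpair_inj[-> /IH ->].
Qed.

(* Every number codes an infinite valuation, almost all of whose values are 0. *)
Definition elook n e := pfst (iter n psnd e).
Fixpoint eupd n e b :=
  if n is k.+1 then cpair (pfst e) (eupd k (psnd e) b) else cpair b (psnd e).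

Lemma elook_eupd m n e b : elook m (eupd n e b) = if m == n then b else elook m e.
Proof.
rewrite /elook; elim: n m e => [|n IH] [|m] e //=; rewrite ?pfst_pair //.
  by rewrite -iterS iterSr psnd_pair -iterSr.
by rewrite -iterS iterSr psnd_pair IH eqSS -[in RHS]iterS iterSr.
Qed.

Lemma elook_update n e b : (fun m => elook m (eupd n e b)) = update (fun m => elook m e) n b.
Proof. by apply: functional_extensionality => m; rewrite elook_eupd. Qed.

Lemma cmp_elook f g : cmp f -> cmp g -> cmp (fun x => elook (f x) (g x)).
Proof. by move=> Hf Hg; apply/cmp_pfst/cmp_iter => //; apply/cmp_psnd/cmp_id. Qed.

Lemma cmp_eupd f g h : cmp f -> cmp g -> cmp h -> cmp (fun x => eupd (f x) (g x) (h x)).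
Proof.
move=> Hf Hg Hh.
(* [eupd] recurses from the outside in, while primitive recursion builds from the inside out: after
   [i] steps it has updated the tail left by [n - i] projections. *)
have H n e b i : i <= n -> nrec (cpair b (iter n.+1 psnd e))
    (fun i z => cpair (pfst (iter (n - i.+1) psnd e)) z) i = eupd i (iter (n - i) psnd e) b.
  elim: i => [|i IH] Hi; first by rewrite subn0 /= .
  rewrite /nrec /= -/(nrec _ _ _) IH ?(ltnW Hi) //; congr cpair; congr eupd.
  by rewrite -iterS; congr iter; lia.
apply: (@cmp_ext (fun x => nrec (cpair (h x) (iter (f x).+1 psnd (g x)))
    (fun i z => cpair (pfst (iter (f x - i.+1) psnd (g x))) z) (f x))).
  by move=> x; rewrite H // subnn.
have Hpsnd : cmp psnd by apply/cmp_psnd/cmp_id.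
apply: cmp_nrec => //.
  by apply: cmp_pair => //; apply: cmp_iter => //; apply: cmp_S.
apply: cmp_pair; last by cmp_tac.
apply: cmp_pfst; apply: cmp_iter => //; first by apply: (cmp_comp Hg); cmp_tac.
apply: cmp_sub; last by cmp_tac.
by apply: (cmp_comp Hf); cmp_tac.
Qed.

(** The newest value stands at the head, so the parent of a prefix is its tail; [pval] therefore
    counts positions from the end. *)
Fixpoint pre (f : nat -> nat) n := if n is k.+1 then lcons (f k) (pre f k) else 0.
Definition pval m i := lnth m (lsize m - i.+1).

Lemma pre_size f n : lsize (pre f n) = n.
Proof.
suff [s -> <-] : exists2 s, pre f n = seq_code s & size s = n by rewrite lsize_code.
by elim: n => [|n [s /= -> Hs]]; [exists [::]|exists (f n :: s) => //=; rewrite Hs].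
Qed.

Lemma pre_val f n i : i < n -> pval (pre f n) i = f i.
Proof.
rewrite /pval pre_size /lnth => Hi.
suff -> : iter (n - i.+1) ltl (pre f n) = pre f i.+1 by rewrite lhd_cons.
elim: n Hi => // n IH; rewrite ltnS leq_eqVlt => /orP[/eqP ->|Hi]; first by rewrite subnn.
by rewrite subSS -(prednK (n := n - i)) ?subn_gt0 // iterSr [pre f n.+1]/= ltl_cons -subnS IH.
Qed.

Lemma arith_term_code (t : term arith) X e :
  @teval arith (standard X) (fun n => elook n e) t = @teval arith (standard xpredT) (fun n => elook n e) t.
Proof.
elim/term_ind_ffun: t => //= g a IH; congr arith_fun.
by apply: eq_from_tnth => i; rewrite !tnth_mktuple IH.
Qed.

Definition tev (t : term arith) e := @teval arith (standard xpredT) (fun n => elook n e) t.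
Definition targ0 (r : rsym arith) (a : {ffun 'I_(rar r) -> term arith}) k e : nat :=
  nth 0 [tuple tev (a i) e | i < rar r] k.

Lemma nth_mktuple0 n (F : 'I_n -> nat) k :
  nth 0 [tuple F i | i < n] k = if insub k is Some i then F i else 0.
Proof.
case: insubP => [i _ <-|]; first by rewrite -tnth_nth tnth_mktuple.
by rewrite -leqNgt => H; rewrite nth_default // size_tuple.
Qed.

Lemma cmp_tev t e : cmp e -> cmp (fun x => tev t (e x)).
Proof.
move=> He; rewrite /tev; elim/term_ind_ffun: t => [n|g a IH] /=.
  by apply: cmp_elook => //; apply: cmp_const.
have H k : cmp (fun x => nth 0 [tuple tev (a i) (e x) | i < far g] k).
  apply: (@cmp_ext (fun x => if insub k is Some i then tev (a i) (e x) else 0)).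
    by move=> x; rewrite nth_mktuple0.
  by case: (insub k) => [i|]; [apply: IH|apply: cmp_const].
rewrite /arith_fun; case: (val g) => [|[|[|n]]]; [exact: cmp_const|exact: cmp_const|..].
  by apply: cmp_add; apply: H.
by apply: cmp_mul; apply: H.
Qed.

Lemma cmp_targ0 r a k e : cmp e -> cmp (fun x => @targ0 r a k (e x)).
Proof.
move=> He; apply: (@cmp_ext (fun x => if insub k is Some i then tev (a i) (e x) else 0)).
  by move=> x; rewrite /targ0 nth_mktuple0.
by case: (insub k) => [i|]; [apply: cmp_tev|apply: cmp_const].
Qed.

(* A function [v] describes a set together with the truth values of all subformulas under all
   valuations (0 for false) and with witnesses for the true existential formulas; [okv] is the
   correctness of this description at the valuation [e] (and at the instance [a] of an existential
   formula), restricted to the places where [d] holds. *)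
Definition fpos (phi : formula arith) e := (cpair (goedel phi) e).*2.
Definition xpos n := n.*2.+1.

Fixpoint okv (v : nat -> nat) (d : nat -> bool) (phi : formula arith) e a : bool :=
  let p := fpos phi e in
  match phi with
  | Equal t u => d p ==> ((0 < v p) == (tev t e == tev u e))
  | @Rel _ r b => if val r == 0 then d p ==> ((0 < v p) == (targ0 b 0 e < targ0 b 1 e))
      else d p && d (xpos (targ0 b 0 e)) ==> ((0 < v p) == (0 < v (xpos (targ0 b 0 e))))
  | Not q => okv v d q e a && (d p && d (fpos q e) ==> ((0 < v p) == ~~ (0 < v (fpos q e))))
  | And q r => [&& okv v d q e a, okv v d r e a &
      [&& d p, d (fpos q e) & d (fpos r e)] ==>
        ((0 < v p) == (0 < v (fpos q e)) && (0 < v (fpos r e)))]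
  | Ex n q => [&& okv v d q e a,
      d p && d (fpos q (eupd n e a)) ==> (0 < v (fpos q (eupd n e a))) ==> (0 < v p) &
      [&& d p, 0 < v p & d (fpos q (eupd n e (v p).-1))] ==> (0 < v (fpos q (eupd n e (v p).-1)))]
  end.

Lemma okv_restrict (f v : nat -> nat) (d : nat -> bool) phi e a : (forall i, d i -> v i = f i) ->
  okv f xpredT phi e a -> okv v d phi e a.
Proof.
move=> H; elim: phi => [t u|r b|q IH|q IHq r IHr|n q IH] /=.
- by move=> H1; apply/implyP => /H ->.
- case: ifP => _ H1; first by apply/implyP => /H ->.
  by apply/implyP => /andP[/H -> /H ->].
- by move=> /andP[/IH -> H1]; apply/implyP => /andP[/H -> /H ->].
- by move=> /and3P[/IHq -> /IHr -> H1]; apply/implyP => /and3P[/H -> /H -> /H ->].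
- move=> /and3P[/IH -> H1 H2]; apply/and3P; split=> //.
    by apply/implyP => /andP[/H -> /H ->].
  apply/implyP => /and3P[Hp]; rewrite (H _ Hp) => H3 Hq; rewrite (H _ Hq).
  by move: H2; rewrite /= H3.
Qed.

(** A single instance inspects only finitely many places of [f], among them that of the witness
    [(f p).-1], which [f] itself determines. Hence a long enough prefix decides it. *)
Lemma okv_limit (f : nat -> nat) phi e a : exists N, forall (v : nat -> nat) (d : nat -> bool),
  (forall i, i < N -> d i /\ v i = f i) -> okv v d phi e a -> okv f xpredT phi e a.
Proof.
elim: phi => [t u|r b|q [N IH]|q [N IHq] r [N' IHr]|m q [N IH]].
- exists (fpos (Equal t u) e).+1 => v d H /=.
  by have [-> ->] := H _ (ltnSn (fpos (Equal t u) e)).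
- exists (fpos (Rel b) e + xpos (targ0 b 0 e)).+1 => v d H /=.
  have [|-> ->] := H (fpos (Rel b) e); first by lia.
  by have [|-> ->] := H (xpos (targ0 b 0 e)); first by lia.
- exists (N + fpos (Not q) e + fpos q e).+1 => v d H /=.
  have [|-> ->] := H (fpos (Not q) e); first by lia.
  have [|-> ->] := H (fpos q e); first by lia.
  by move=> /andP[Hq Hr]; apply/andP; split=> //; apply: IH Hq => i Hi; apply: H; lia.
- exists (N + N' + fpos (And q r) e + fpos q e + fpos r e).+1 => v d H /=.
  have [|-> ->] := H (fpos (And q r) e); first by lia.
  have [|-> ->] := H (fpos q e); first by lia.
  have [|-> ->] := H (fpos r e); first by lia.
  move=> /and3P[Hq Hr Hp]; apply/and3P; split=> //.
    by apply: IHq Hq => i Hi; apply: H; lia.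
  by apply: IHr Hr => i Hi; apply: H; lia.
- pose p := fpos (Ex m q) e; pose p1 := fpos q (eupd m e a); pose p2 := fpos q (eupd m e (f p).-1).
  exists (N + p + p1 + p2).+1 => v d H /=; rewrite -/p -/p1.
  have [|-> ->] := H p; first by lia.
  rewrite -/p2; have [|-> ->] := H p1; first by lia.
  have [|-> ->] := H p2; first by lia.
  move=> /and3P[Hq Hp1 Hp2]; apply/and3P; split=> //.
  by apply: IH Hq => i Hi; apply: H; lia.
Qed.

Section Truth.
Variable f : nat -> nat.
Let X n := 0 < f (xpos n).

Lemma targ0_sat (r : rsym arith) (a : {ffun 'I_(rar r) -> term arith}) e :
  @sat arith (standard X) (fun n => elook n e) (Rel a) <->
  (if val r == 0 then targ0 a 0 e < targ0 a 1 e else X (targ0 a 0 e)).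
Proof.
rewrite /= /arith_rel /targ0.
have -> : [tuple @teval arith (standard X) (fun n => elook n e) (a i) | i < rar r] =
    [tuple tev (a i) e | i < rar r].
  by apply: eq_from_tnth => i; rewrite !tnth_mktuple arith_term_code.
by rewrite -![val r]/(nat_of_ord r); case: (nat_of_ord r).
Qed.

Lemma okv_sat phi e : (forall e a, okv f xpredT phi e a) ->
  (0 < f (fpos phi e)) <-> @sat arith (standard X) (fun n => elook n e) phi.
Proof.
elim: phi e => [t u|r b|q IH|q IHq r IHr|n q IH] e H.
- have /= /eqP -> := H e 0; rewrite !arith_term_code.
  by split=> [/eqP|H']; [|apply/eqP].
- rewrite targ0_sat; have := H e 0; rewrite [okv _ _ _ _ _]/=.
  by case: ifP => _ /= /eqP ->.
- have Hq e' a' : okv f xpredT q e' a' by have /= /andP[] := H e' a'.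
  have /= /andP[_ /eqP ->] := H e 0.
  by rewrite -(IH e Hq); split=> /negP.
- have Hq e' a' : okv f xpredT q e' a' by have /= /and3P[] := H e' a'.
  have Hr e' a' : okv f xpredT r e' a' by have /= /and3P[] := H e' a'.
  have /= /and3P[_ _ /eqP ->] := H e 0.
  by rewrite -(IHq e Hq) -(IHr e Hr); split=> /andP.
- have Hq e' a' : okv f xpredT q e' a' by have /= /and3P[] := H e' a'.
  split=> [Hp|[b Hb]].
    exists (f (fpos (Ex n q) e)).-1; rewrite -elook_update; apply/(IH _ Hq).
    by have /and3P[_ _] := H e 0; rewrite Hp.
  have /and3P[_ /implyP /(_ isT) /implyP H1 _] := H e b; apply: H1.
  by apply/(IH _ Hq); rewrite elook_update.
Qed.

End Truth.

(** The function is chosen place by place: an odd place holds membership in [X]; an even place holds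
    the truth value of the formula and valuation it codes, and for a true existential formula one
    more than a witness. Injectivity of the codes makes the choices independent. *)
Lemma okv_exists (X : nat -> Prop) : exists f : nat -> nat,
  (forall n, 0 < f (xpos n) <-> X n) /\
  (forall phi e a, okv f xpredT phi e a).
Proof.
pose S phi e := @sat arith (standard X) (fun n => elook n e) phi.
have W (i : nat) : exists k, (odd i -> 0 < k <-> X i./2) /\
   (~~ odd i -> forall phi e, i = fpos phi e ->
     (0 < k <-> S phi e) /\ forall n q, phi = Ex n q -> 0 < k -> S q (eupd n e k.-1)).
  have [oi|oi] := boolP (odd i).
    have [Xi|Xi] := classic (X i./2); first by exists 1; split.
    by exists 0; split.
  have [[phi [e Ei]]|F] := classic (exists phi e, i = fpos phi e); last first.
    by exists 0; split=> // _ phi e Ei; case: F; exists phi, e.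
  have inj phi' e' : i = fpos phi' e' -> phi' = phi /\ e' = e.
    rewrite Ei => /(congr1 half); rewrite /fpos !doubleK => /cpair_inj[/goedel_inj -> ->]; by [].
  have [Sp|Sp] := classic (S phi e); last first.
    by exists 0; split=> // _ phi' e' /inj[-> ->]; split.
  have [[n [q Eq]]|F] := classic (exists n q, phi = Ex n q); last first.
    exists 1; split=> // _ phi' e' /inj[-> ->]; split=> // n q Eq; case: F; by exists n, q.
  have [b Hb] : exists b, S q (eupd n e b).
    by move: Sp; rewrite Eq => -[b Hb]; exists b; rewrite /S elook_update.
  exists b.+1; split=> // _ phi' e' /inj[-> ->]; split=> // n' q'.
  by rewrite Eq => -[<- <-].
pose f i := sval (constructive_indefinite_description _ (W i)).
have Hf i : (odd i -> 0 < f i <-> X i./2) /\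
   (~~ odd i -> forall phi e, i = fpos phi e ->
     (0 < f i <-> S phi e) /\ forall n q, phi = Ex n q -> 0 < f i -> S q (eupd n e (f i).-1)).
  by rewrite /f; case: constructive_indefinite_description.
have HX n : 0 < f (xpos n) <-> X n.
  have [/(_ _) H1 _] := Hf (xpos n); rewrite H1 /xpos /= ?odd_double //.
  by rewrite uphalf_double.
have HS phi e : (0 < f (fpos phi e)) <-> S phi e.
  have [_ /(_ _ phi e erefl)[]//] := Hf (fpos phi e).
  by rewrite /fpos odd_double.
have HW n q e : 0 < f (fpos (Ex n q) e) -> S q (eupd n e (f (fpos (Ex n q) e)).-1).
  have [_ /(_ _ (Ex n q) e erefl)[|_ H1]] := Hf (fpos (Ex n q) e); last exact: H1.
  by rewrite /fpos odd_double.
exists f; split=> // phi e a.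
have iffb (b c : bool) : (b <-> c) -> b == c by move: b c => [] [] [] // H1 H2; [have := H1 isT|have := H2 isT].
elim: phi => [t u|r b|q IH|q IHq r IHr|n q IH].
- rewrite /=; apply: iffb; rewrite HS /S /= !arith_term_code.
  by split=> [H'|/eqP]; [apply/eqP|].
- have HR := HS (Rel b) e; rewrite /S in HR.
  have ER : (0 < f (fpos (Rel b) e)) <->
     (if val r == 0 then targ0 b 0 e < targ0 b 1 e else 0 < f (xpos (targ0 b 0 e))).
    rewrite HR /= /arith_rel /targ0.
    have -> : [tuple @teval arith (standard X) (fun n => elook n e) (b i) | i < rar r] =
        [tuple tev (b i) e | i < rar r].
      by apply: eq_from_tnth => i; rewrite !tnth_mktuple arith_term_code.
    by rewrite -![val r]/(nat_of_ord r); case: (nat_of_ord r) => //= k; rewrite HX.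
  by rewrite [okv _ _ _ _ _]/=; case: ifP ER => _ ER /=; apply: iffb.
- rewrite /= IH; apply: iffb; rewrite HS; split=> [H1|/negP H1]; first by apply/negP => /HS.
  by move=> /HS.
- rewrite /= IHq IHr; apply: iffb; rewrite HS; split=> [[/HS -> /HS ->]//|/andP[/HS H1 /HS H2]].
  by split.
- rewrite /= IH /=; apply/andP; split.
    apply/implyP => /HS H1; apply/HS; exists a; by rewrite -elook_update.
  by rewrite andbT; apply/implyP => /HW/HS.
Qed.

(** Since [phi] is fixed, the recursion on it is carried out here, and no universal evaluator of
    arithmetical formulas has to be programmed. *)
Lemma cmpb_okv m phi e a : cmp m -> cmp e -> cmp a ->
  cmpb (fun x => okv (pval (m x)) (fun i => i < lsize (m x)) phi (e x) (a x)).
Proof.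
move=> Hm; elim: phi e a => [t u|r b|q IH|q IHq r IHr|n q IH] e a He Ha /=.
all: have Hpos phi e' : cmp e' -> cmp (fun x => fpos phi (e' x));
  [move=> He'; apply: (@cmp_ext (fun x => 2 * cpair (goedel phi) (e' x))); [by move=> x; rewrite mul2n|by cmp_tac]|].
all: have Hv i : cmp i -> cmp (fun x => pval (m x) (i x)); [by move=> Hi; rewrite /pval; cmp_tac|].
- have H1 := Hpos (Equal t u) e He; have H2 := Hv _ H1.
  have H3 := cmp_tev t He; have H4 := cmp_tev u He.
  by cmp_tac.
- have H1 := Hpos (Rel b) e He; have H2 := Hv _ H1.
  have H3 := cmp_targ0 b 0 He; have H4 := cmp_targ0 b 1 He.
  have H5 : cmp (fun x => xpos (targ0 b 0 (e x))).
    by apply: (@cmp_ext (fun x => (2 * targ0 b 0 (e x)).+1)); [move=> x; rewrite mul2n|cmp_tac].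
  have H6 := Hv _ H5.
  by case: (val r == 0); cmp_tac.
- have H1 := Hpos (Not q) e He; have H2 := Hv _ H1.
  have H3 := Hpos q e He; have H4 := Hv _ H3; have H5 := IH e a He Ha.
  by cmp_tac.
- have H1 := Hpos (And q r) e He; have H2 := Hv _ H1.
  have H3 := Hpos q e He; have H4 := Hv _ H3; have H5 := IHq e a He Ha.
  have H6 := Hpos r e He; have H7 := Hv _ H6; have H8 := IHr e a He Ha.
  by cmp_tac.
- have H1 := Hpos (Ex n q) e He; have H2 := Hv _ H1; have H3 := IH e a He Ha.
  have H4 := Hpos q _ (cmp_eupd (cmp_const n) He Ha); have H5 := Hv _ H4.
  have H6 := Hpos q _ (cmp_eupd (cmp_const n) He (cmp_pred H2)); have H7 := Hv _ H6.
  by cmp_tac.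
Qed.

(** Only instances below the length of the prefix are checked, which keeps the test decidable; along
    an infinite path every instance is eventually reached. [cpair x 0] is a valuation giving [x] to
    variable 0, and the value 0 at its place declares [psi] false. *)
Definition good_node (psi : formula arith) x m : bool :=
  ball (lsize m) (fun e => ball (lsize m) (fun a =>
    okv (pval m) (fun i => i < lsize m) psi e a)) &&
  ((fpos psi (cpair x 0) < lsize m) ==> (pval m (fpos psi (cpair x 0)) == 0)).

Definition tree_rel (psi : formula arith) x m n : bool :=
  [&& 0 < n, ltl n == m & good_node psi x n].

Lemma cmpb_tree_rel psi : cmpb (fun w => tree_rel psi (pfst w) (pfst (psnd w)) (psnd (psnd w))).
Proof.
rewrite /tree_rel /good_node.
have H : cmpb (fun w => ball (lsize w) (fun e => ball (lsize w) (fun a =>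
    okv (pval w) (fun i => i < lsize w) psi e a))).
  apply: cmpb_ball; first by cmp_tac.
  apply: (@cmpb_ball (fun w => lsize (pfst w)) (fun w a => okv (pval (pfst w)) (fun i => i < lsize (pfst w)) psi (psnd w) a)).
    by cmp_tac.
  by apply: cmpb_okv; cmp_tac.
have H' : cmpb (fun w => ball (lsize (psnd (psnd w))) (fun e => ball (lsize (psnd (psnd w))) (fun a =>
    okv (pval (psnd (psnd w))) (fun i => i < lsize (psnd (psnd w))) psi e a))).
  by apply: (cmp_comp H); cmp_tac.
have Hp : cmp (fun w => fpos psi (cpair (pfst w) 0)).
  by apply: (@cmp_ext (fun w => 2 * cpair (goedel psi) (cpair (pfst w) 0))); [move=> w; rewrite mul2n|cmp_tac].
have Hq : cmp (fun w => pval (psnd (psnd w)) (fpos psi (cpair (pfst w) 0))).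
  by rewrite /pval; cmp_tac.
by cmp_tac.
Qed.

Lemma tree_rel_lt psi x m n : tree_rel psi x m n -> m < n.
Proof. by move=> /and3P[n0 /eqP <- _]; apply: ltl_lt. Qed.

(** A path yields a function all of whose instances are correct, hence a set for which [psi] fails.
    Conversely a counterexample [X] has a correct description, and its prefixes form a path. *)
Lemma tree_rel_path psi x : (forall n, free_in n psi -> n = 0) ->
  (forall X, @sat arith (standard X) (fun=> x) psi) <->
  ~ exists F : nat -> nat, F 0 = 0 /\ forall i, tree_rel psi x (F i) (F i.+1).
Proof.
move=> Hfree.
have Esat X : @sat arith (standard X) (fun=> x) psi <->
    @sat arith (standard X) (fun n => elook n (cpair x 0)) psi.
  by apply: sat_ext => n /Hfree ->; rewrite /elook /= pfst_pair.
split=> [H [F [F0 HF]]|H X].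
  pose f i := lhd (F i.+1).
  have EF n : F n = pre f n.
    elim: n => //= n <-; have /and3P[n0 /eqP <- _] := HF n.
    by rewrite /f /lcons /lhd /ltl cpair_eta prednK.
  have ok e a : okv f xpredT psi e a.
    (* A prefix of this length covers the inspected places and has [e] and [a] among its tested
       instances. *)
    have [N HN] := okv_limit f psi e a; pose n := (N + e + a).+1.
    apply: (HN (pval (pre f n)) (fun i => i < lsize (pre f n))) => [i Hi|].
      have Hin : i < n by rewrite /n; lia.
      by rewrite pre_size pre_val.
    have /and3P[_ _ /andP[/ballP Hb _]] := HF n.-1.
    have := Hb e; rewrite -[n.-1.+1]/n EF pre_size => /(_ _)/ballP Hb'.
    by rewrite ?pre_size; apply: Hb'; rewrite /n; lia.
  have := H (fun n => 0 < f (xpos n)); rewrite Esat => /(proj2 (okv_sat _ ok)).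
  pose p := fpos psi (cpair x 0).
  have /and3P[_ _ /andP[_ /implyP Hp]] := HF p.
  by move: Hp; rewrite EF pre_size => /(_ (ltnSn p)); rewrite pre_val // => /eqP ->.
apply: NNPP => nS; apply: H.
have [f [HX Hf]] := okv_exists X.
have EX : X = (fun n => 0 < f (xpos n)) :> (nat -> Prop).
  apply: functional_extensionality => n; apply: PropExtensionality.propositional_extensionality.
  by rewrite HX.
exists (pre f); split=> // i; apply/and3P; split=> //; first by rewrite ltl_cons.
have R e a : okv (pval (pre f i.+1)) (fun j => j < lsize (pre f i.+1)) psi e a.
  by apply: okv_restrict (Hf psi e a) => j; rewrite pre_size; apply: pre_val.
apply/andP; split; first by apply/ballP => e _; apply/ballP => a _.
apply/implyP; rewrite pre_size => Hp; rewrite pre_val // -leqn0 leqNgt; apply/negP.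
move=> /(okv_sat (cpair x 0) (Hf psi)) Hs; apply: nS; rewrite Esat.
by rewrite EX.
Qed.

Lemma pi11_tree B : pi11 B -> exists E : nat -> rel nat,
  [/\ cmpb (fun w => E (pfst w) (pfst (psnd w)) (psnd (psnd w))),
    forall x m n, E x m n -> m < n &
    forall x, B x <-> ~ exists F : nat -> nat, F 0 = 0 /\ forall i, E x (F i) (F i.+1)].
Proof.
move=> [psi Hfree HB]; exists (tree_rel psi); split.
- exact: cmpb_tree_rel.
- exact: tree_rel_lt.
- by move=> x; rewrite HB tree_rel_path.
Qed.

(** * Codes for the elements of the standard structure *)

Lemma cpair_mono x x' y y' : x <= x' -> y <= y' -> cpair x y <= cpair x' y'.
Proof.
move=> Hx Hy; have := Cantor.to_nat_spec x y; have := Cantor.to_nat_spec x' y'.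
rewrite -/(cpair x y) -/(cpair x' y').
have : (y + x) * (y + x).+1 <= (y' + x') * (y' + x').+1 by apply: leq_mul; lia.
lia.
Qed.

Lemma mem_le_code s x : List.In x s -> x <= seq_code s.
Proof.
elim: s => //= y s IH [<-|/IH H]; have := cpair_ge y (seq_code s); first lia.
by move: H; rewrite /=; lia.
Qed.

(** Only elements of finite level occur in [std0], and on them this is a bijection onto the numbers;
    infinite level gets the default 0. [plain] below singles out the elements on which codes are
    faithful. *)
Definition acode (a : ael) : nat := if a.1 is Some n then cpair n (cpair a.2.1 a.2.2) else 0.
Definition adec n : ael := (Some (pfst n), (pfst (psnd n), psnd (psnd n))).

Lemma adecK n : acode (adec n) = n.
Proof. by rewrite /acode /= !cpair_eta. Qed.
Lemma acodeK a : a.1 <> None -> adec (acode a) = a.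
Proof. by case: a => -[n|] [k j] //= _; rewrite /acode /adec /= !pairE. Qed.

Definition ecode (e : el) : nat :=
  match e with
  | EA a => cpair 0 (acode a)
  | EY (inl (s, j)) => cpair 1 (cpair (seq_code (map acode s)) j)
  | EZA a i => cpair 2 (cpair (acode a) i)
  | EZY (inl (s, j)) a i => cpair 3 (cpair (cpair (seq_code (map acode s)) j) (cpair (acode a) i))
  | _ => 0
  end.

Definition plainA (a : ael) : bool := if a.1 is None then false else true.
Definition plainY (y : yel) : bool := if y is inl (s, _) then all plainA s else false.
Definition plain (e : el) : bool :=
  match e with
  | EA a => plainA a | EY y => plainY y
  | EZA a i => plainA a | EZY y a i => plainY y && plainA a
  end.

Lemma plainP a : plainA a -> adec (acode a) = a.
Proof. by case: a => -[n|] d // _; apply: acodeK. Qed.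

Lemma acode_inj a b : plainA a -> plainA b -> acode a = acode b -> a = b.
Proof. by move=> /plainP {2}<- /plainP {2}<- ->. Qed.

Lemma acodes_inj s t : all plainA s -> all plainA t -> map acode s = map acode t -> s = t.
Proof.
elim: s t => [|a s IH] [|b t] //= /andP[Pa Ps] /andP[Pb Pt] [/acode_inj-> // /IH -> //].
Qed.

Lemma ecode_inj e e' : plain e -> plain e' -> ecode e = ecode e' -> e = e'.
Proof.
case: e => [a|[[s j]|j]|a i|[[s j]|j] a i] //; case: e' => [b|[[t l]|l]|b k|[[t l]|l] b k] //=.
all: try by move=> _ _ /cpair_inj[].
- by move=> Pa Pb /cpair_inj[_ /acode_inj ->].
- by move=> Ps Pt /cpair_inj[_ /cpair_inj[/seq_code_inj/acodes_inj -> // ->]].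
- by move=> Pa Pb /cpair_inj[_ /cpair_inj[/acode_inj -> // ->]].
- move=> /andP[Ps Pa] /andP[Pt Pb] /cpair_inj[_ /cpair_inj[]] /cpair_inj[/seq_code_inj/acodes_inj -> // ->].
  by move=> /cpair_inj[/acode_inj -> // ->].
Qed.

Lemma okA_plain a : okA (okg_of 0) a = plainA a.
Proof. by case: a => -[]. Qed.

Lemma valid_plain E e : valid E (okg_of 0) id false e -> plain e.
Proof.
have P s : all (okA (okg_of 0)) s = all plainA s by apply: eq_all => a; apply: okA_plain.
rewrite /valid; case: e => [a|[[s j]|j]|a i|[[s j]|j] a i] //.
- by rewrite /okY P => /andP[].
- by rewrite okA_plain => -[].
- by rewrite /okY P okA_plain => -[/andP[_ H1] H2 _]; apply/andP.
- by case.
Qed.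

Section Filtration.
Variable q : nat.

(* Bounds the codes of the witnesses that the existential axioms require for parameters with codes
   up to [B]; the dyadic numbers are the upper neighbours, lower neighbours and midpoints. *)
Definition grow B := B + cpair 0 (cpair B (cpair (B + B).+1 ((B + B).+1 * 2 ^ B)))
  + cpair 1 (cpair (iter q (lcons B) 0) B.+1) + cpair 2 (cpair B q)
  + cpair 3 (cpair B (cpair B q)).
(** The start is the code of the place [(0, 0)] in level [q.+1], which bounds the codes of that
    place in all levels up to [q]; these elements must be available at stage 0. *)
Definition bound i := iter i grow (cpair 0 (cpair q (cpair 0 0))).
Definition Vcode i e : Prop := plain e /\ ecode e <= bound i.

Lemma grow_ge B : B <= grow B.
Proof. by rewrite /grow; lia. Qed.

Lemma growA B n k j : n <= B -> k <= (B + B).+1 -> j <= (B + B).+1 * 2 ^ B ->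
  ecode (EA (Some n, (k, j))) <= grow B.
Proof.
move=> Hn Hk Hj; have : ecode (EA (Some n, (k, j))) <= cpair 0 (cpair B (cpair (B + B).+1 ((B + B).+1 * 2 ^ B))).
  by do 3!apply: cpair_mono => //.
by rewrite /grow; lia.
Qed.

Lemma codeA_le B n k j : ecode (EA (Some n, (k, j))) <= B -> [/\ n <= B, k <= B & j <= B].
Proof.
rewrite /= /acode /=; have := cpair_ge 0 (cpair n (cpair k j)); have := cpair_ge n (cpair k j).
by have := cpair_ge k j => H1 H2 H3 H4; split; lia.
Qed.

Lemma seq_code_le B s : (forall x, List.In x s -> x <= B) -> forall n, size s <= n ->
  seq_code s <= iter n (lcons B) 0.
Proof.
elim: s => [//|x s IH] H [|n] //= Hn; rewrite ltnS; apply: cpair_mono; first by apply: H; left.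
by apply: IH => // y Hy; apply: H; right.
Qed.

Lemma In_acode (s : seq ael) x : List.In x (map acode s) -> exists2 a, List.In a s & acode a = x.
Proof. by elim: s => //= a s IH [<-|/IH[b Hb <-]]; [exists a; [left|]|exists b; [right|]]. Qed.

Lemma acode_In (s : seq ael) a : List.In a s -> List.In (acode a) (map acode s).
Proof. by elim: s => //= b s IH [->|/IH]; [left|right]. Qed.

Lemma all_In (p : pred ael) (s : seq ael) : (forall a, List.In a s -> p a) -> all p s.
Proof.
elim: s => //= a s IH H; rewrite H ?IH //; last by left.
by move=> b Hb; apply: H; right.
Qed.

Lemma In_all (p : pred ael) (s : seq ael) a : all p s -> List.In a s -> p a.
Proof. by elim: s => //= b s IH /andP[Pb /IH H] [<-|]. Qed.

Lemma std0_filtered (E : rel nat) : (forall m n, E m n -> m < n) ->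
  @tree_axioms E (std0 E) (fun k => k <= q) (fun i u => Vcode i (sval u)).
Proof.
move=> E_lt.
have bS i : bound i.+1 = grow (bound i) by [].
apply: (cmodel_axioms E_lt (@okg_of_up 0)) => //.
- by move=> i e [Pe He]; split=> //; apply: leq_trans He _; rewrite bS grow_ge.
- move=> i a j [Pa Ha]; split=> //; apply: leq_trans Ha; apply: cpair_mono => //.
  by apply: leq_trans (cpair_ge _ _); lia.
- move=> i [[s l]|l] a j [] //= /andP[Ps Pa] H; split; split=> //; apply: leq_trans H; apply: cpair_mono => //.
    by apply: leq_trans (cpair_ge _ _); lia.
  by apply: leq_trans (cpair_ge _ _); have := cpair_ge (acode a) j; lia.
- move=> i [[s j]|j] a c _ [] //= Ps H /lptr_In Ia; split; first exact: In_all Ps Ia.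
  apply: leq_trans H; apply: cpair_mono => //.
  by have := cpair_ge (seq_code (map acode s)) j; have := mem_le_code (acode_In Ia); lia.
- move=> i n [k j] [_ /codeA_le[H1 H2 H3]]; exists (ddn (k, j)); last exact: dlt_dn.
  by split=> //; rewrite bS; apply: growA => //=; lia.
- move=> i [n|] [k j] [] // _ /codeA_le[H1 H2 H3]; exists (dup (k, j)); last exact: dlt_up.
  split=> //; rewrite bS; apply: growA => //=; first by lia.
  have : 0 < 2 ^ bound i by rewrite expn_gt0.
  by move: (2 ^ _) => x Hx; nia.
- move=> i [n|] [k j] [k' j'] [] // _ /codeA_le[H1 H2 H3] [_ /codeA_le[H4 H5 H6]] Hd.
  exists (dmid (k, j) (k', j')); split; [|exact: dlt_midl|exact: dlt_midr].
  split=> //; rewrite bS; apply: growA => //=; first by lia.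
  by apply: leq_mul; [lia|rewrite leq_exp2l].
- move=> n Hn; exists (0, 0); split=> //; rewrite /bound /=.
  by do 2!apply: cpair_mono => //; lia.
(* A code is at least as large as its components, so with the index [(bound i).+1] the new element
   is not among those with codes up to [bound i]. *)
- move=> i s e Hs Hsa He; exists (bound i).+1; last first.
    move=> /He[_]; rewrite /=; have := cpair_ge 1 (cpair (seq_code (map acode s)) (bound i).+1).
    by have := cpair_ge (seq_code (map acode s)) (bound i).+1; lia.
  split; first by apply: all_In => a /Hsa[].
  rewrite bS /=; have : seq_code (map acode s) <= iter q (lcons (bound i)) 0.
    apply: seq_code_le; last by rewrite size_map.
    by move=> x /In_acode[a /Hsa[_ /= H] <-]; have := cpair_ge 0 (acode a); lia.
  move=> H; have : cpair 1 (cpair (seq_code (map acode s)) (bound i).+1) <=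
    cpair 1 (cpair (iter q (lcons (bound i)) 0) (bound i).+1) by do 2!apply: cpair_mono => //.
  by rewrite /grow; lia.
- move=> i a j k [Pa Ha] jk kq; split=> //; rewrite bS.
  have : cpair 2 (cpair (acode a) j) <= cpair 2 (cpair (bound i) q).
    by do 2!apply: cpair_mono => //; [have := cpair_ge 0 (acode a); move: Ha => /=|]; lia.
  by rewrite /grow /=; lia.
- move=> i [[s l]|l] a j k [] //= Ps Hy [Pa Ha] jk kq; split; first by rewrite /= Ps.
  have Ha' : acode a <= bound i by apply: leq_trans Ha; have := cpair_ge 0 (acode a); rewrite /=; lia.
  rewrite bS; have : ecode (EZY (inl (s, l)) a j) <= cpair 3 (cpair (bound i) (cpair (bound i) q)).
    do 2!apply: cpair_mono => //.
      by have := cpair_ge 1 (cpair (seq_code (map acode s)) l); lia.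
    by apply: cpair_mono => //; lia.
  by rewrite /grow; lia.
Qed.

End Filtration.

(** * Order, links and validity computed on codes *)

Definition altC a b : bool := (pfst a < pfst b) || (pfst a == pfst b) &&
  ((2 * psnd (psnd a)).+1 * 2 ^ pfst (psnd b) < (2 * psnd (psnd b)).+1 * 2 ^ pfst (psnd a)).
Definition ltC m n : bool := [&& pfst m == 0, pfst n == 0 & altC (psnd m) (psnd n)].
Definition linkC z u v : bool :=
  ((pfst z == 2) && ((u == cpair 0 (pfst (psnd z))) && (v == u))) ||
  ((pfst z == 3) && ((u == cpair 1 (pfst (psnd z))) && (v == cpair 0 (pfst (psnd (psnd z)))))).
(** The colour of the pointer at position [l] is the level of the previous one; the first component
    of the code of an element is its level minus one, hence the successor. *)
Definition colC s l := if l == 0 then 0 else (pfst (lnth s l.-1)).+1.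
Definition legalC (E : rel nat) s : bool := ball (lsize s) (fun l =>
  (colC s l < (pfst (lnth s l)).+1) && ((l.+1 < lsize s) ==> E (colC s l) (colC s l.+1))).
(** Tag 0 carries no condition, because every number codes an element of sort A. *)
Definition vcode (E : rel nat) n : bool :=
  [|| pfst n == 0,
      (pfst n == 1) && legalC E (pfst (psnd n)),
      (pfst n == 2) && (psnd (psnd n) < (pfst (pfst (psnd n))).+1) |
      (pfst n == 3) && (legalC E (pfst (pfst (psnd n))) &&
        ball (lsize (pfst (pfst (psnd n)))) (fun l =>
          (lnth (pfst (pfst (psnd n))) l == pfst (psnd (psnd n))) ==>
          (psnd (psnd (psnd n)) < colC (pfst (pfst (psnd n))) l)))].

Lemma altC_alt a b : plainA a -> plainA b -> altC (acode a) (acode b) = alt a b.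
Proof.
case: a b => -[m|] [k j] // [[n|] [k' j']] // _ _.
by rewrite /altC /acode /= !pairE /alt /= /dlt /= -!mul2n.
Qed.

Lemma map_adec (t : seq nat) : map acode (map adec t) = t.
Proof. by rewrite -map_comp map_id_in // => x _; apply: adecK. Qed.

Fixpoint legalN (E : rel nat) c (t : seq nat) : bool :=
  if t is x :: t' then (c < (pfst x).+1) && (nilp t' || E c (pfst x).+1 && legalN E (pfst x).+1 t')
  else true.

Lemma legal_legalN E c t : legal E c (map alab (map adec t)) = legalN E c t.
Proof.
elim: t c => //= x t IH c; rewrite IH.
by case: t {IH}.
Qed.

Lemma legalN_ball E c t : legalN E c t <->
  forall l, l < size t -> let col i := if i is i'.+1 then (pfst (nth 0 t i')).+1 else c in
    col l < col l.+1 /\ (l.+1 < size t -> E (col l) (col l.+1)).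
Proof.
elim: t c => [|x t IH] c; first by split.
rewrite [legalN _ _ _]/=; split.
  move=> /andP[H1 H2] [|l] Hl /=.
    by split=> //; case: (t) H2 => //= y t' /andP[].
  case: t IH H2 Hl => // y t IH /= /andP[_ H2] Hl.
  by have [H3 H4] := proj1 (IH _) H2 l Hl; case: (l) H3 H4 => [|l'] /= H3 H4; split.
move=> H; apply/andP; split; first by case: (H 0 isT).
case: t IH H => // y t IH H.
have E0 : E c (pfst x).+1 by case: (H 0 isT) => _; apply.
apply/orP; right; rewrite E0 /=; apply/(IH (pfst x).+1) => l Hl.
by have := H l.+1 Hl; case: (l) => [|l'] /=.
Qed.

Lemma legalC_code E t : legalC E (seq_code t) = legalN E 0 t.
Proof.
have HC i : colC (seq_code t) i = if i is i'.+1 then (pfst (nth 0 t i')).+1 else 0.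
  by case: i => //= i; rewrite /colC /= lnth_code.
apply/idP/idP.
  move=> /ballP H; apply/legalN_ball => l Hl /=.
  have /andP[H1 /implyP H2] : (colC (seq_code t) l < (pfst (lnth (seq_code t) l)).+1) &&
      ((l.+1 < lsize (seq_code t)) ==> E (colC (seq_code t) l) (colC (seq_code t) l.+1)).
    by apply: H; rewrite lsize_code.
  by rewrite lsize_code !HC lnth_code in H1 H2.
move=> /legalN_ball H; apply/ballP => l; rewrite lsize_code => Hl.
have [H1 H2] := H l Hl; rewrite !HC lnth_code; apply/andP; split=> //.
exact/implyP.
Qed.

Lemma lptr_nthP c t a d : lptr c (map adec t) a d <->
  exists l, [/\ l < size t, a = adec (nth 0 t l) & d = if l is l'.+1 then (pfst (nth 0 t l')).+1 else c].
Proof.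
elim: t c => [|x t IH] c; first by split=> // -[l []].
rewrite map_cons lptr_cons; split.
  case=> [[-> ->]|[n En]]; first by exists 0.
  have -> : n = (pfst x).+1 by case: En.
  move=> /IH[l [Hl -> ->]].
  by exists l.+1; split=> //; case: l {Hl}.
move=> [[|l] [Hl Ea Ed]]; first by left.
right; exists (pfst x).+1 => //; apply/IH; exists l; split=> //.
by case: l {Hl Ea} Ed.
Qed.

Section Codes.
Variable E : rel nat.
Hypothesis E_lt : forall m n, E m n -> m < n.
Notation M0 := (std0 E).

Definition cd (u : M0) : nat := ecode (sval u).

Lemma plain_val (u : M0) : plain (sval u).
Proof. exact: (@valid_plain E) (proj2_sig u). Qed.

Lemma cd_inj (u v : M0) : cd u = cd v -> u = v.
Proof. by move=> H; apply: cdom_eq; apply: ecode_inj H; apply: plain_val. Qed.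

Lemma cd_below (u v : M0) : below u v <-> ltC (cd u) (cd v).
Proof.
rewrite belowE /cd; have := plain_val u; have := plain_val v.
split=> [[a [b [Ha Hb H']]]|].
  by rewrite /ltC Ha Hb /= !pairE !eqxx altC_alt //; rewrite Ha Hb in H H0 *.
rewrite /ltC; case: (sval u) H0 => [a|[[s j]|j]|a i|[[s j]|j] a i] //= Pu;
  case: (sval v) H => [b|[[t l]|l]|b k|[[t l]|l] b k] //= Pv; rewrite !pairE //=.
by rewrite altC_alt // => H; exists a, b.
Qed.

Lemma cd_link (z u v : M0) : link z u v <-> linkC (cd z) (cd u) (cd v).
Proof.
rewrite linkE /cd; have := plain_val z; have := plain_val u; have := plain_val v.
move=> Pv Pu Pz; split.
  case=> [[a [i [-> -> ->]]]|[y [a [i [Hz -> ->]]]]]; first by rewrite /linkC /= !pairE !eqxx.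
  by rewrite Hz in Pz *; case: y Pz {Hz} => [[s j]|j] // _; rewrite /linkC /= !pairE !eqxx.
rewrite /linkC; case: (sval z) Pz => [a|[[s j]|j]|a i|[[s j]|j] a i] //= Pz; rewrite !pairE //=.
  rewrite orbF => /andP[/eqP Hu /eqP Hv]; left; exists a, i; split=> //; apply: ecode_inj => //.
  by rewrite Hv.
move=> /andP[/eqP Hu /eqP Hv]; right; exists (inl (s, j)), a, i.
by move: Pz => /andP[Ps Pa]; split=> //; apply: ecode_inj.
Qed.

Lemma list_acode (s : seq ael) : all plainA s -> s = map adec (map acode s).
Proof.
by elim: s => //= a s IH /andP[/plainP -> /IH <-].
Qed.

Lemma vcodeP n : vcode E n <-> exists u : M0, cd u = n.
Proof.
have OkY t j : okY E (okg_of 0) false (inl (map adec t, j)) = legalC E (seq_code t).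
  rewrite legalC_code /= legal_legalN andbC.
  suff -> : all (okA (okg_of 0)) (map adec t) by [].
  by apply/allP => a /mapP[x _ ->].
split.
  have Hn := cpair_eta n; move: (pfst n) (psnd n) Hn => g r <-; rewrite /vcode !pairE.
  move=> /or4P[/eqP ->|/andP[/eqP -> H]|/andP[/eqP -> H]|/andP[/eqP -> /andP[H1 H2]]].
  - have V : valid E (okg_of 0) id false (EA (adec r)) by [].
    by exists (exist _ _ V); rewrite /cd /= adecK.
  - have [t Ht] := list_of_code (pfst r).
    have V : valid E (okg_of 0) id false (EY (inl (map adec t, psnd r))).
      by rewrite [valid _ _ _ _ _]/(is_true (okY _ _ _ _)) OkY Ht.
    by exists (exist _ _ V); rewrite /cd /= map_adec Ht cpair_eta.
  - have V : valid E (okg_of 0) id false (EZA (adec (pfst r)) (psnd r)) by [].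
    by exists (exist _ _ V); rewrite /cd /= adecK cpair_eta.
  - have [t Ht] := list_of_code (pfst (pfst r)).
    have V : valid E (okg_of 0) id false (EZY (inl (map adec t, psnd (pfst r))) (adec (pfst (psnd r))) (psnd (psnd r))).
      split=> //; first by rewrite OkY Ht.
      move=> c /lptr_nthP[l [Hl Ea ->]].
      have El : nth 0 t l = pfst (psnd r) by rewrite -[LHS]adecK -Ea adecK.
      move/ballP: H2 => /(_ l); rewrite -Ht lsize_code lnth_code El eqxx /= => /(_ Hl).
      by rewrite /colC; case: l Hl {Ea El} => //= l Hl; rewrite lnth_code.
    by exists (exist _ _ V); rewrite /cd /= map_adec adecK Ht !cpair_eta.
move=> [u <-]; rewrite /cd; have := proj2_sig u; have := plain_val u.
case: (sval u) => [a|[[s j]|j]|a i|[[s j]|j] a i] //=; rewrite /vcode !pairE //=.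
- by move=> Ps; rewrite {1}(list_acode Ps) legal_legalN -legalC_code => /andP[->].
- by case: a => -[n'|] [k l] // _ [_ H]; rewrite orbF /acode /= pfst_pair.
- move=> /andP[Ps Pa] [/andP[HL _] _ H].
  move: HL; rewrite (list_acode Ps) legal_legalN -legalC_code -(list_acode Ps) => -> /=.
  apply/ballP => l; rewrite lsize_code lnth_code => Hl; apply/implyP => /eqP El.
  apply: H; rewrite {1}(list_acode Ps); apply/lptr_nthP; exists l; split=> //.
    by rewrite El plainP.
  by rewrite /colC; case: (l) => //= l'; rewrite lnth_code.
Qed.

End Codes.

(** * Evaluation with bounded quantifiers *)

Lemma targ_fLt i j : let a := [ffun k : 'I_(rar rs_lt) => Var L0 (nth 0 [:: i; j] k)] in
  (targ a 0 = i) * (targ a 1 = j).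
Proof. by split; rewrite /targ insubT /= ffunE. Qed.

Lemma targ_fLink i j k : let a := [ffun m : 'I_(rar rs_link) => Var L0 (nth 0 [:: i; j; k] m)] in
  ((targ a 0 = i) * (targ a 1 = j)) * (targ a 2 = k).
Proof. by split; [split|]; rewrite /targ insubT /= ffunE. Qed.

Lemma goedel_fLt i j : goedel (fLt i j) = cpair 1 (cpair 0 (seq_code [:: cpair 0 i; cpair 0 j])).
Proof.
rewrite /fLt /=; congr (cpair _ (cpair _ _)).
by rewrite !enum_ordSl enum_ord0 /= !ffunE.
Qed.

Lemma goedel_fLink i j k : goedel (fLink i j k) =
  cpair 1 (cpair 1 (seq_code [:: cpair 0 i; cpair 0 j; cpair 0 k])).
Proof.
rewrite /fLink /=; congr (cpair _ (cpair _ _)).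
by rewrite !enum_ordSl enum_ord0 /= !ffunE.
Qed.

Lemma rank_goedel phi : rank phi <= goedel phi.
Proof.
elim: phi => //= [p IH|p IHp q IHq|n p IH].
- by have := cpair_ge 2 (goedel p); lia.
- by have := cpair_ge 3 (cpair (goedel p) (goedel q)); have := cpair_ge (goedel p) (goedel q); lia.
- by have := cpair_ge 4 (cpair n (goedel p)); have := cpair_ge n (goedel p); lia.
Qed.

(** Up to [q] one move costs at most [q + 3] stages, so a quantifier of depth [t] ranges over codes
    up to the bound of that many stages for each of [t] moves; the successor makes the bound
    strict. *)
Definition qbound q t := (bound q ((q + 3) * t)).+1.

Arguments qbound : simpl never.
Arguments ball : simpl never.
Arguments bex : simpl never.

Section Evaluation.
Variable E : rel nat.
Hypothesis E_lt : forall m n, E m n -> m < n.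
Variable q : nat.

Fixpoint evF t (phi : formula L0) e : Prop :=
  match phi with
  | Equal x y => elook (tvar x) e = elook (tvar y) e
  | @Rel _ r a =>
      if val r == 0 then ltC (elook (targ a 0) e) (elook (targ a 1) e)
      else linkC (elook (targ a 0) e) (elook (targ a 1) e) (elook (targ a 2) e)
  | Not p => ~ evF t p e
  | And p p' => evF t p e /\ evF t p' e
  | Ex n p => exists m, [/\ m < qbound q t.+1, vcode E m & evF t.+1 p (eupd n e m)]
  end.

Lemma evF_satR phi t (v : nat -> std0 E) e :
  (forall n, free_in n phi -> cd (v n) = elook n e) ->
  satR (fun t (u : std0 E) => Vcode q ((q + 3) * t) (sval u)) t v phi <-> evF t phi e.
Proof.
elim/formula_ind0: phi t v e => [i j|i j|i j k|p IH|p p' IHp IHp'|n p IH] t v e H.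
- have Hi : cd (v i) = elook i e by apply: H; rewrite /= eqxx.
  have Hj : cd (v j) = elook j e by apply: H; rewrite /= eqxx orbT.
  by rewrite /= -Hi -Hj; split=> [->|/cd_inj].
- have Hv x : x \in [:: i; j] -> cd (v x) = elook x e.
    move=> Hx; apply: H => /=; apply/existsP.
    by move: Hx; rewrite !inE => /orP[]/eqP ->; [exists ord0|exists (inord 1 : 'I_2)]; rewrite ffunE ?inordK //= eqxx.
  change (sat v (fLt i j) <-> evF t (fLt i j) e); rewrite sat_fLt cd_below /= !targ_fLt.
  by rewrite !Hv // !inE eqxx ?orbT.
- have Hv x : x \in [:: i; j; k] -> cd (v x) = elook x e.
    move=> Hx; apply: H => /=; apply/existsP.
    by move: Hx; rewrite !inE => /or3P[]/eqP ->;
      [exists ord0|exists (inord 1 : 'I_3)|exists (inord 2 : 'I_3)]; rewrite ffunE ?inordK //= eqxx.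
  change (sat v (fLink i j k) <-> evF t (fLink i j k) e); rewrite sat_fLink cd_link /= !targ_fLink.
  by rewrite !Hv // !inE eqxx ?orbT.
- by rewrite /= (IH t v e H).
- by rewrite /= (IHp t v e) ?(IHp' t v e) // => n Hn; apply: H; rewrite /= Hn ?orbT.
- have S u m : cd u = m -> forall x, free_in x p -> cd (update v n u x) = elook x (eupd n e m).
    move=> Hu x Hx; rewrite elook_eupd /update; case: eqP => // /eqP xn.
    by apply: H; rewrite /= xn Hx.
  split=> [[u [_ Vu] Hu]|[m [Hm /(vcodeP E _)[u Hu] Hp]]].
    exists (cd u); split; [by rewrite ltnS|by apply/(vcodeP E _); exists u|].
    by apply/(IH _ _ _ (S u _ erefl)).
  exists u; last exact/(IH _ _ _ (S u _ Hu)).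
  by split; [apply: plain_val|rewrite -/(cd u) Hu -ltnS].
Qed.

(* Entry of a certificate: the formula with code [k] has truth value [b] at depth [t] under [e]. *)
Definition ent t k e b := cpair (cpair t k) (cpair e b).

(** A local check of one entry: its truth value must follow from entries for the immediate
    subformulas, whose presence [has] reports. A false existential formula needs an entry for every
    admissible code. Certificates avoid a recursion in which formula, depth and valuation change
    together. *)
Definition okE (has : nat -> bool) (en : nat) : bool :=
  let t := pfst (pfst en) in let k := psnd (pfst en) in
  let e := pfst (psnd en) in let b := psnd (psnd en) in
  let g := pfst k in let r := psnd k in
  (b <= 1) &&
  (if g == 0 then (b == 1) == (elook (psnd (pfst r)) e == elook (psnd (psnd r)) e)
   else if g == 1 then
     (b == 1) == (if pfst r == 0
       then ltC (elook (psnd (lnth (psnd r) 0)) e) (elook (psnd (lnth (psnd r) 1)) e)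
       else linkC (elook (psnd (lnth (psnd r) 0)) e) (elook (psnd (lnth (psnd r) 1)) e)
              (elook (psnd (lnth (psnd r) 2)) e))
   else if g == 2 then has (ent t r e (1 - b))
   else if g == 3 then bex 2 (fun b1 => bex 2 (fun b2 =>
     [&& has (ent t (pfst r) e b1), has (ent t (psnd r) e b2) & b == b1 * b2]))
   else if b == 1 then bex (qbound q t.+1) (fun m =>
     vcode E m && has (ent t.+1 (psnd r) (eupd (pfst r) e m) 1))
   else ball (qbound q t.+1) (fun m =>
     vcode E m ==> has (ent t.+1 (psnd r) (eupd (pfst r) e m) 0))).

Definition okL (s : seq nat) : bool := all (okE (fun z => z \in s)) s.

Lemma okE_mono (has has' : nat -> bool) en : (forall z, has z -> has' z) -> okE has en -> okE has' en.
Proof.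
move=> H /andP[H1 H2]; apply/andP; split=> //; move: H2.
case: ifP => // _; case: ifP => // _; case: ifP => [_ /H //|_]; case: ifP => [_|_].
  move=> /bexP[b1 B1 /bexP[b2 B2 /and3P[H3 H4 H5]]].
  by apply/bexP; exists b1 => //; apply/bexP; exists b2 => //; rewrite !H.
case: ifP => _; first by move=> /bexP[m Hm /andP[Vm /H Hh]]; apply/bexP; exists m => //; rewrite Vm.
by move=> /ballP Hb; apply/ballP => m Hm; apply/implyP => Vm; apply: H; apply: (implyP (Hb m Hm)).
Qed.

Lemma okL_cat s s' : okL s -> okL s' -> okL (s ++ s').
Proof.
move=> /allP H /allP H'; apply/allP => en; rewrite mem_cat => /orP[/H|/H']; apply: okE_mono => z /= Hz;
  by rewrite mem_cat Hz ?orbT.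
Qed.

Lemma okL_cons en s : okE (fun z => z \in en :: s) en -> okL s -> okL (en :: s).
Proof.
move=> He Hs; rewrite /okL [all _ _]/= He; apply/allP => z Hz.
by apply: okE_mono (allP Hs z Hz) => x /= Hx; rewrite inE Hx orbT.
Qed.

Lemma okL_sound s phi t e b : okL s -> ent t (goedel phi) e b \in s ->
  b <= 1 /\ (b = 1 <-> evF t phi e).
Proof.
move=> Hs; elim/formula_ind0: phi t e b => [i j|i j|i j k|p IH|p p' IHp IHp'|n p IH] t e b Hb;
  have := allP Hs _ Hb; rewrite /okE /ent ?goedel_fLt ?goedel_fLink /= !pairE /= => /andP[b1 H];
  split=> //; move: H.
- by move=> /eqP H; split=> [/eqP|/eqP Hx]; [rewrite H => /eqP|apply/eqP; rewrite H].
- rewrite /lnth /= !lhd_cons (ltl_cons (cpair 0 i)) lhd_cons !pairE /= !targ_fLt.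
  by move=> /eqP H; split=> [/eqP|Hx]; [rewrite H|apply/eqP; rewrite H].
- rewrite /lnth /= lhd_cons !(ltl_cons (cpair 0 i)) (ltl_cons (cpair 0 j)) !lhd_cons !pairE /= !targ_fLink.
  by move=> /eqP H; split=> [/eqP|Hx]; [rewrite H|apply/eqP; rewrite H].
- by move=> /IH[_ <-]; lia.
- move=> /bexP[b2 B2 /bexP[b3 B3 /and3P[/IHp[_ <-] /IHp'[_ <-] /eqP ->]]].
  by case: b2 b3 B2 B3 => [|[|//]] [|[|//]] //= _ _; split=> // -[].
- case: ifP => Hb1 H; last first.
    move/negbT/eqP: Hb1 => Hb1; split=> // -[m [Hm Vm Hp]]; exfalso.
    by have [_] := IH _ _ _ (implyP (ballP _ _ H m Hm) Vm); case=> _ /(_ Hp).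
  split=> [_|_]; last exact/eqP.
  have /bexP[m Hm /andP[Vm Hp]] := H; exists m; split=> //.
  by have [_] := IH _ _ _ Hp; case=> /(_ erefl).
Qed.

Lemma okL_exists (phi : formula L0) t e : exists2 s, okL s & exists b, ent t (goedel phi) e b \in s.
Proof.
have leaf en : okE (fun z => z \in [:: en]) en -> okL [:: en] by move=> H; apply: okL_cons.
elim/formula_ind0: phi t e => [i j|i j|i j k|p IH|p p' IHp IHp'|n p IH] t e.
- pose b : bool := elook i e == elook j e.
  exists [:: ent t (goedel (fEq i j)) e b]; last by exists b; rewrite inE.
  apply: leaf; rewrite /okE /ent /= !pairE /= -/b; by case: (b).
- pose b := ltC (elook i e) (elook j e).
  exists [:: ent t (goedel (fLt i j)) e b]; last by exists b; rewrite inE.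
  apply: leaf; rewrite /okE /ent goedel_fLt !pairE /= /lnth /= !lhd_cons (ltl_cons (cpair 0 i)) lhd_cons !pairE -/b.
  by case: (b).
- pose b := linkC (elook i e) (elook j e) (elook k e).
  exists [:: ent t (goedel (fLink i j k)) e b]; last by exists b; rewrite inE.
  apply: leaf; rewrite /okE /ent goedel_fLink !pairE /= /lnth /= lhd_cons !(ltl_cons (cpair 0 i)) (ltl_cons (cpair 0 j)) !lhd_cons !pairE -/b.
  by case: (b).
- have [s Hs [b Hb]] := IH t e; have [b1 _] := okL_sound Hs Hb.
  exists (ent t (goedel (Not p)) e (1 - b) :: s); last by exists (1 - b); rewrite inE eqxx.
  apply: okL_cons => //; rewrite /okE /ent /= !pairE /=.
  have -> : 1 - (1 - b) = b by lia.
  by rewrite inE Hb orbT andbT; lia.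
- have [s Hs [b Hb]] := IHp t e; have [b1 _] := okL_sound Hs Hb.
  have [s' Hs' [b' Hb']] := IHp' t e; have [b1' _] := okL_sound Hs' Hb'.
  exists (ent t (goedel (And p p')) e (b * b') :: s ++ s'); last by exists (b * b'); rewrite inE eqxx.
  apply: okL_cons; last exact: okL_cat.
  rewrite /okE /ent /= !pairE /=; apply/andP; split; first by case: b b' b1 b1' {Hb Hb'} => [|[|]] // [|[|]].
  apply/bexP; exists b => //; apply/bexP; exists b' => //.
  by rewrite !inE !mem_cat Hb Hb' !orbT eqxx.
- have [s Hs Hm] : exists2 s, okL s & forall m, m < qbound q t.+1 ->
      exists b, ent t.+1 (goedel p) (eupd n e m) b \in s.
    elim: (qbound q t.+1) => [|B [s Hs HB]]; first by exists [::].
    have [s' Hs' [b Hb]] := IH t.+1 (eupd n e B).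
    exists (s ++ s'); first exact: okL_cat.
    move=> m; rewrite ltnS leq_eqVlt => /orP[/eqP ->|/HB[b' Hb']].
      by exists b; rewrite mem_cat Hb orbT.
    by exists b'; rewrite mem_cat Hb'.
  pose b : bool := bex (qbound q t.+1) (fun m => vcode E m && (ent t.+1 (goedel p) (eupd n e m) 1 \in s)).
  exists (ent t (goedel (Ex n p)) e b :: s); last by exists b; rewrite inE eqxx.
  apply: okL_cons => //; rewrite /okE /ent /= !pairE /= ?leq_b1.
  case Eb : (b) => /=.
    have /bexP[m Hm' /andP[Vm Hin]] := Eb; apply/bexP; exists m => //.
    by rewrite Vm inE Hin orbT.
  apply/ballP => m Hm'; apply/implyP => Vm; have [b' Hb'] := Hm m Hm'.
  have [b1 _] := okL_sound Hs Hb'.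
  case: b' Hb' b1 => [|[|//]] Hb' _; first by rewrite inE Hb' orbT.
  by move/negbT/negP: Eb; case; apply/bexP; exists m => //; rewrite Vm.
Qed.

Definition hasC c z : bool := bex (lsize c) (fun i => lnth c i == z).
Definition okC c : bool := ball (lsize c) (fun i => okE (hasC c) (lnth c i)).

Lemma hasC_code s z : hasC (seq_code s) z = (z \in s).
Proof.
apply/bexP/idP => [[i]|/(nthP 0)[i Hi Ez]].
  by rewrite lsize_code lnth_code => Hi /eqP <-; apply: mem_nth.
by exists i; rewrite ?lsize_code // lnth_code Ez.
Qed.

Lemma okC_code s : okC (seq_code s) = okL s.
Proof.
have M en : okE (hasC (seq_code s)) en = okE (fun z => z \in s) en.
  by apply/idP/idP; apply: okE_mono => z; rewrite hasC_code.
apply/ballP/allP => H.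
  by move=> en /(nthP 0)[i Hi <-]; rewrite -M -lnth_code; apply: H; rewrite lsize_code.
by move=> i; rewrite lsize_code lnth_code M => Hi; apply: H; apply: mem_nth.
Qed.

End Evaluation.

(** The game is played between [std0] with unrestricted quantifiers and the same structure filtered
    by codes. The rank of a formula is at most its Goedel number, so a sufficient counting bound can
    be read off the code. *)
Lemma evF_holds (E : rel nat) phi : (forall m n, E m n -> m < n) -> sentence phi ->
  holds (std0 E) phi <-> evF E (goedel phi).+1 0 phi 0.
Proof.
move=> E_lt sphi; pose q := (goedel phi).+1.
have T := tree_axioms_weaken (Q' := fun k => k <= q) (fun _ _ => I) (std0_tree E_lt).
have T' := std0_filtered q E_lt.
have W := finite_view E_lt (ltn0Sn _) T; have W' := finite_view E_lt (ltn0Sn _) T'.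
have Qd k l : l <= k -> k <= q -> l <= q by apply: leq_trans.
have G (v v' : nat -> std0 E) := satR_game W W' Qd (chain_size E_lt (ltn0Sn _) T) (chain_size E_lt (ltn0Sn _) T')
  (leq_addl _ _) (phi := phi) (t := 0) (p := [::]) (v := v) (v' := v') (good_nil _ _ _ _ _ _).
have G' (v v' : nat -> std0 E) : sat v phi <-> evF E q 0 phi 0.
  rewrite -(satR_True 0) (G v v'); first last.
  - by rewrite add0n /q; have := rank_goedel phi; lia.
  - by move=> n; rewrite (negbTE (sphi n)).
  by apply: evF_satR => // n; rewrite (negbTE (sphi n)).
have [u0] := dom_inhabited (std0 E).
split=> [H|H v]; first by apply/(G' (fun=> u0) (fun=> u0)).
exact/(G' v v).
Qed.

(** * Deciding the theory and the reduction *)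

Section Programs.
Variable E : nat -> rel nat.
Hypothesis HE : cmpb (fun w => E (pfst w) (pfst (psnd w)) (psnd (psnd w))).

Lemma cmpb_E f g h : cmp f -> cmp g -> cmp h -> cmpb (fun w => E (f w) (g w) (h w)).
Proof.
move=> Hf Hg Hh; pose t w := cpair (f w) (cpair (g w) (h w)).
apply: (@cmpb_ext (fun w => E (pfst (t w)) (pfst (psnd (t w))) (psnd (psnd (t w))))).
  by move=> w; rewrite /t !pairE.
by apply: (cmp_comp HE); rewrite /t; cmp_tac.
Qed.

Lemma cmp_grow f g : cmp f -> cmp g -> cmp (fun w => grow (f w) (g w)).
Proof.
move=> Hf Hg; rewrite /grow.
have Hi : cmp (fun w => iter (f w) (lcons (g w)) 0).
  apply: (@cmp_ext (fun w => nrec 0 (fun _ z => lcons (g w) z) (f w))).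
    by move=> w; elim: (f w) => //= n ->.
  apply: cmp_nrec => //; cmp_tac.
  by apply: (cmp_comp Hg); cmp_tac.
by cmp_tac.
Qed.

Lemma cmp_bound f g : cmp f -> cmp g -> cmp (fun w => bound (f w) (g w)).
Proof.
move=> Hf Hg; apply: (@cmp_ext (fun w => nrec (cpair 0 (cpair (f w) (cpair 0 0))) (fun _ z => grow (f w) z) (g w))).
  by move=> w; rewrite /bound; elim: (g w) => //= n ->.
apply: cmp_nrec => //; first by cmp_tac.
apply: cmp_grow; last by cmp_tac.
by apply: (cmp_comp Hf); cmp_tac.
Qed.

Lemma cmp_qbound f g : cmp f -> cmp g -> cmp (fun w => qbound (f w) (g w)).
Proof. by move=> Hf Hg; rewrite /qbound; apply/cmp_S/cmp_bound => //; cmp_tac. Qed.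

Lemma cmpb_ltC f g : cmp f -> cmp g -> cmpb (fun w => ltC (f w) (g w)).
Proof. by move=> Hf Hg; rewrite /ltC /altC; cmp_tac. Qed.

Lemma cmpb_linkC f g h : cmp f -> cmp g -> cmp h -> cmpb (fun w => linkC (f w) (g w) (h w)).
Proof. by move=> Hf Hg Hh; rewrite /linkC; cmp_tac. Qed.

Lemma cmp_colC f g : cmp f -> cmp g -> cmp (fun w => colC (f w) (g w)).
Proof. by move=> Hf Hg; rewrite /colC; cmp_tac. Qed.

Lemma cmpb_legalC f g : cmp f -> cmp g -> cmpb (fun w => legalC (E (f w)) (g w)).
Proof.
move=> Hf Hg; rewrite /legalC.
have H : cmpb (fun w => ball (lsize (psnd w)) (fun l =>
  (colC (psnd w) l < (pfst (lnth (psnd w) l)).+1) &&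
  ((l.+1 < lsize (psnd w)) ==> E (pfst w) (colC (psnd w) l) (colC (psnd w) l.+1)))).
  apply: cmpb_ball; first by cmp_tac.
  apply: cmpb_and.
    by apply: cmpb_leq; cmp_tac; apply: cmp_colC; cmp_tac.
  apply: cmpb_imp; first by cmp_tac.
  by apply: cmpb_E; cmp_tac; apply: cmp_colC; cmp_tac.
apply: (@cmpb_ext (fun w => let p := cpair (f w) (g w) in ball (lsize (psnd p)) (fun l =>
  (colC (psnd p) l < (pfst (lnth (psnd p) l)).+1) &&
  ((l.+1 < lsize (psnd p)) ==> E (pfst p) (colC (psnd p) l) (colC (psnd p) l.+1))))).
  by move=> w /=; rewrite !pairE.
by apply: (cmp_comp H); cmp_tac.
Qed.

Lemma cmpb_vcode f g : cmp f -> cmp g -> cmpb (fun w => vcode (E (f w)) (g w)).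
Proof.
move=> Hf Hg; rewrite /vcode.
have H1 : cmpb (fun w => legalC (E (f w)) (pfst (psnd (g w)))) by apply: cmpb_legalC; cmp_tac.
have H2 : cmpb (fun w => legalC (E (f w)) (pfst (pfst (psnd (g w))))) by apply: cmpb_legalC; cmp_tac.
have H3 : cmpb (fun w => ball (lsize (pfst (pfst (psnd (g w))))) (fun l =>
          (lnth (pfst (pfst (psnd (g w)))) l == pfst (psnd (psnd (g w)))) ==>
          (psnd (psnd (psnd (g w))) < colC (pfst (pfst (psnd (g w)))) l))).
  have Hg1 : cmp (fun w => g (pfst w)) by apply: (cmp_comp Hg); cmp_tac.
  apply: cmpb_ball; first by cmp_tac.
  apply: cmpb_imp; first by cmp_tac.
  by apply: cmpb_leq; cmp_tac; apply: cmp_colC; cmp_tac.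
by cmp_tac.
Qed.

Lemma cmpb_hasC f g : cmp f -> cmp g -> cmpb (fun w => hasC (f w) (g w)).
Proof.
move=> Hf Hg; rewrite /hasC.
have Hf1 : cmp (fun w => f (pfst w)) by apply: (cmp_comp Hf); cmp_tac.
have Hg1 : cmp (fun w => g (pfst w)) by apply: (cmp_comp Hg); cmp_tac.
by apply: cmpb_bex; cmp_tac.
Qed.

Lemma cmp_ent t k e b : cmp t -> cmp k -> cmp e -> cmp b -> cmp (fun w => ent (t w) (k w) (e w) (b w)).
Proof. by move=> *; rewrite /ent; cmp_tac. Qed.

Ltac cmp_hook ::= lazymatch goal with
  | |- cmp (fun w => elook (@?f w) (@?g w)) => apply: (@cmp_elook f g)
  | |- cmp (fun w => eupd (@?f w) (@?g w) (@?h w)) => apply: (@cmp_eupd f g h)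
  | |- cmp (fun w => qbound (@?f w) (@?g w)) => apply: (@cmp_qbound f g)
  | |- cmp (fun w => ent (@?t w) (@?k w) (@?e w) (@?b w)) => apply: (@cmp_ent t k e b)
  | |- cmpb (fun w => ltC (@?f w) (@?g w)) => apply: (@cmpb_ltC f g)
  | |- cmpb (fun w => linkC (@?f w) (@?g w) (@?h w)) => apply: (@cmpb_linkC f g h)
  | |- cmpb (fun w => hasC (@?f w) (@?g w)) => apply: (@cmpb_hasC f g)
  | |- cmpb (fun w => vcode (E (@?f w)) (@?g w)) => apply: (@cmpb_vcode f g)
  end.

Lemma cmpb_okE : cmpb (fun w => okE (E (pfst w)) (pfst (psnd w))
  (hasC (pfst (psnd (psnd w)))) (psnd (psnd (psnd w)))).
Proof. by rewrite /okE; cbv zeta; cmp_tac. Qed.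

Lemma cmpb_okC f q c : cmp f -> cmp q -> cmp c -> cmpb (fun w => okC (E (f w)) (q w) (c w)).
Proof.
move=> Hf Hq Hc; rewrite /okC; apply: cmpb_ball; first by cmp_tac.
pose T w := cpair (f (pfst w)) (cpair (q (pfst w)) (cpair (c (pfst w)) (lnth (c (pfst w)) (psnd w)))).
apply: (@cmpb_ext (fun w => okE (E (pfst (T w))) (pfst (psnd (T w)))
  (hasC (pfst (psnd (psnd (T w))))) (psnd (psnd (psnd (T w)))))).
  by move=> w; rewrite /T !pairE.
apply: (cmp_comp cmpb_okE); rewrite /T.
have Hf1 : cmp (fun w => f (pfst w)) by apply: (cmp_comp Hf); cmp_tac.
have Hq1 : cmp (fun w => q (pfst w)) by apply: (cmp_comp Hq); cmp_tac.
have Hc1 : cmp (fun w => c (pfst w)) by apply: (cmp_comp Hc); cmp_tac.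
by cmp_tac.
Qed.

End Programs.

(* The status of [k] with respect to the variable [n]: 0 if [k] is not the code of a formula, and
   otherwise 2 or 1 according as [n] is free in it or not. *)
Definition status_step n c : nat :=
  let k := lsize c in let g := pfst k in let r := psnd k in
  let i := psnd (lnth (psnd r) 0) in let j := psnd (lnth (psnd r) 1) in
  let l := psnd (lnth (psnd r) 2) in
  let v1 := lnth c (k - (pfst r).+1) in let v2 := lnth c (k - (psnd r).+1) in
  if g == 0 then
    if r == cpair (cpair 0 (psnd (pfst r))) (cpair 0 (psnd (psnd r))) then
      if (n == psnd (pfst r)) || (n == psnd (psnd r)) then 2 else 1
    else 0
  else if g == 1 then
    if r == cpair 0 (lcons (cpair 0 i) (lcons (cpair 0 j) 0)) then
      if (n == i) || (n == j) then 2 else 1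
    else if r == cpair 1 (lcons (cpair 0 i) (lcons (cpair 0 j) (lcons (cpair 0 l) 0))) then
      if [|| n == i, n == j | n == l] then 2 else 1
    else 0
  else if g == 2 then lnth c (k - r.+1)
  else if g == 3 then
    if (v1 == 0) || (v2 == 0) then 0 else if (v1 == 2) || (v2 == 2) then 2 else 1
  else if g == 4 then if (v2 == 2) && (n == pfst r) then 1 else v2
  else 0.

Definition status n k := cov status_step n k.

Lemma cmp_status f g : cmp f -> cmp g -> cmp (fun w => status (f w) (g w)).
Proof.
move=> Hf Hg; have H : cmp (fun w => status (pfst w) (psnd w)).
  by apply: cmp_cov; rewrite /status_step; cbv zeta; cmp_tac.
apply: (@cmp_ext (fun w => status (pfst (cpair (f w) (g w))) (psnd (cpair (f w) (g w))))).
  by move=> w; rewrite !pairE.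
by apply: (cmp_comp H); cmp_tac.
Qed.

Lemma free_fLt n i j : free_in n (fLt i j) = (n == i) || (n == j).
Proof.
apply/existsP/orP => [[[[|[|//]] Hk]]|[]/eqP ->]; rewrite ?ffunE /=.
- by left.
- by right.
- by exists ord0; rewrite ffunE /=.
- by exists (inord 1 : 'I_2); rewrite ffunE inordK /=.
Qed.

Lemma free_fLink n i j k : free_in n (fLink i j k) = [|| n == i, n == j | n == k].
Proof.
apply/existsP/or3P => [[[[|[|[|//]]] Hk]]|[]/eqP ->]; rewrite ?ffunE /=.
- by constructor 1.
- by constructor 2.
- by constructor 3.
- by exists ord0; rewrite ffunE /=.
- by exists (inord 1 : 'I_3); rewrite ffunE inordK /=.
- by exists (inord 2 : 'I_3); rewrite ffunE inordK /=.
Qed.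

Lemma status_goedel n (phi : formula L0) : status n (goedel phi) = (free_in n phi).+1.
Proof.
elim/formula_ind0: phi => [i j|i j|i j k|p IH|p p' IHp IHp'|m p IH];
  rewrite /status /cov /status_step covs_size ?goedel_fLt ?goedel_fLink; cbv zeta.
- by rewrite /= !pairE /= eqxx; case: (_ || _).
- by rewrite free_fLt !pairE /= /lnth /= !lhd_cons (ltl_cons (cpair 0 i)) lhd_cons !pairE eqxx; case: (_ || _).
- rewrite free_fLink !pairE /= /lnth /= lhd_cons !(ltl_cons (cpair 0 i)) (ltl_cons (cpair 0 j)) !lhd_cons !pairE.
  rewrite eqxx; case: eqP => [/cpair_inj[]//|_]; by case: [|| _, _ | _].
- have lt : goedel p < cpair 2 (goedel p) by have := cpair_ge 2 (goedel p); lia.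
  by rewrite [goedel _]/= !pairE /= covs_nth // -/(status _ _) IH.
- have lt : goedel p < cpair 3 (cpair (goedel p) (goedel p')).
    by have := cpair_ge 3 (cpair (goedel p) (goedel p')); have := cpair_ge (goedel p) (goedel p'); lia.
  have lt' : goedel p' < cpair 3 (cpair (goedel p) (goedel p')).
    by have := cpair_ge 3 (cpair (goedel p) (goedel p')); have := cpair_ge (goedel p) (goedel p'); lia.
  rewrite [goedel _]/= !pairE /= !covs_nth // -!/(status _ _) IHp IHp' /=.
  by case: (free_in n p); case: (free_in n p').
- have lt : goedel p < cpair 4 (cpair m (goedel p)).
    by have := cpair_ge 4 (cpair m (goedel p)); have := cpair_ge m (goedel p); lia.
  rewrite [goedel _]/= !pairE /= covs_nth // -/(status _ _) IH /=.
  by case: (free_in n p); case: (n == m).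
Qed.

Lemma status_code n k : status n k <> 0 -> exists phi : formula L0, goedel phi = k.
Proof.
elim/ltn_ind: k => k IH.
have Ek := cpair_eta k.
rewrite /status /cov /status_step covs_size; cbv zeta.
move: IH; rewrite -Ek; move: (pfst k) (psnd k) => g r IH; rewrite !pairE.
have lt x : x <= r -> 2 <= g -> x < cpair g r by have := cpair_ge g r; lia.
case: (g =P 0) => [g0|_].
  case: eqP => // Er _; exists (fEq (psnd (pfst r)) (psnd (psnd r))).
  by rewrite g0 [in RHS]Er.
case: (g =P 1) => [g1|_].
  case: eqP => [Er _|_].
    by exists (fLt (psnd (lnth (psnd r) 0)) (psnd (lnth (psnd r) 1))); rewrite goedel_fLt g1 [in RHS]Er.
  case: eqP => // Er _.
  exists (fLink (psnd (lnth (psnd r) 0)) (psnd (lnth (psnd r) 1)) (psnd (lnth (psnd r) 2))).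
  by rewrite goedel_fLink g1 [in RHS]Er.
case: (g =P 2) => [g2|_].
  rewrite covs_nth; last by apply: lt; rewrite ?g2.
  by move=> /IH[|p Hp]; [apply: lt; rewrite ?g2|exists (Not p); rewrite /= Hp g2].
case: (g =P 3) => [g3|_].
  have H1 : pfst r < cpair g r by apply: lt; rewrite ?g3 ?pfst_le.
  have H2 : psnd r < cpair g r by apply: lt; rewrite ?g3 ?psnd_le.
  rewrite !covs_nth //; case: eqP => //= /(IH _ H1)[p Hp]; case: eqP => //= /(IH _ H2)[p' Hp'] _.
  by exists (And p p'); rewrite /= Hp Hp' cpair_eta g3.
case: (g =P 4) => [g4|//].
have H2 : psnd r < cpair g r by apply: lt; rewrite ?g4 ?psnd_le.
rewrite covs_nth //; move=> H.
have [|p Hp] := IH _ H2; first by move: H; rewrite -/(status _ _); case: eqP => [->|].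
by exists (Ex (pfst r) p); rewrite /= Hp cpair_eta g4.
Qed.

Lemma free_goedel n (phi : formula L0) : free_in n phi -> n <= goedel phi.
Proof.
elim/formula_ind0: phi => [i j|i j|i j k|p IH|p p' IHp IHp'|m p IH].
- have := cpair_ge 0 i; have := cpair_ge 0 j; have := cpair_ge (cpair 0 i) (cpair 0 j).
  have := cpair_ge 0 (cpair (cpair 0 i) (cpair 0 j)).
  by move=> ? ? ? ? /= /orP[]/eqP ->; lia.
- rewrite free_fLt goedel_fLt => H.
  have := cpair_ge 1 (cpair 0 (seq_code [:: cpair 0 i; cpair 0 j])).
  have := cpair_ge 0 (seq_code [:: cpair 0 i; cpair 0 j]).
  have : List.In (cpair 0 n) [:: cpair 0 i; cpair 0 j].
    by move: H => /orP[]/eqP ->; [left|right; left].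
  by move/mem_le_code; have := cpair_ge 0 n; lia.
- rewrite free_fLink goedel_fLink => H.
  have := cpair_ge 1 (cpair 1 (seq_code [:: cpair 0 i; cpair 0 j; cpair 0 k])).
  have := cpair_ge 1 (seq_code [:: cpair 0 i; cpair 0 j; cpair 0 k]).
  have : List.In (cpair 0 n) [:: cpair 0 i; cpair 0 j; cpair 0 k].
    by move: H => /or3P[]/eqP ->; [left|right; left|right; right; left].
  by move/mem_le_code; have := cpair_ge 0 n; lia.
- by move=> /= /IH; have := cpair_ge 2 (goedel p); lia.
- have := cpair_ge 3 (cpair (goedel p) (goedel p')); have := cpair_ge (goedel p) (goedel p').
  by move=> ? ? /= /orP[/IHp|/IHp']; lia.
- have := cpair_ge 4 (cpair m (goedel p)); have := cpair_ge m (goedel p).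
  by move=> ? ? /= /andP[_ /IH]; lia.
Qed.

(** Free variables of a formula do not exceed its code, so the variables up to [k] suffice; status 1
    at variable 0 already ensures that [k] codes a formula. *)
Definition is_sent k : bool := ball k.+1 (fun n => status n k == 1).

Lemma is_sentP k : is_sent k <-> exists2 phi : formula L0, sentence phi & goedel phi = k.
Proof.
split=> [/ballP H|[phi sphi <-]].
  have [|phi Hphi] := @status_code 0 k; first by have /eqP -> := H 0 isT.
  exists phi => // n; apply/negP => Fn.
  have := H n; rewrite ltnS -Hphi status_goedel Fn => /(_ _)/eqP H'.
  by have := H' (free_goedel Fn).
by apply/ballP => n _; rewrite status_goedel (negbTE (sphi n)).
Qed.

Lemma cmpb_is_sent f : cmp f -> cmpb (fun w => is_sent (f w)).
Proof.
move=> Hf; rewrite /is_sent; apply: cmpb_ball; first by cmp_tac.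
have Hf1 : cmp (fun w => f (pfst w)) by apply: (cmp_comp Hf); cmp_tac.
by apply: cmpb_eq; [apply: cmp_status|]; cmp_tac.
Qed.

Section Decision.
Variable E : nat -> rel nat.
Hypotheses (HE : cmpb (fun w => E (pfst w) (pfst (psnd w)) (psnd (psnd w))))
  (E_lt : forall x m n, E x m n -> m < n).

(** Every number certifies a non-sentence, so the search for a certificate terminates on all
    inputs. *)
Definition certifies w y : bool := ~~ is_sent (psnd w) ||
  (okC (E (pfst w)) (psnd w).+1 y &&
   (hasC y (ent 0 (psnd w) 0 1) || hasC y (ent 0 (psnd w) 0 0))).

Lemma certified w : exists y, certifies w y.
Proof.
rewrite /certifies; case Hs : (is_sent (psnd w)); last by exists 0.
have [phi sphi Hphi] := proj1 (is_sentP _) Hs.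
have [s Hok [b Hb]] := okL_exists (E (pfst w)) (psnd w).+1 phi 0 0.
have [b1 _] := okL_sound Hok Hb.
exists (seq_code s); rewrite okC_code Hok !hasC_code -Hphi /=.
by case: b Hb b1 => [|[|//]] -> _; rewrite ?orbT.
Qed.

Definition decides w : bool :=
  is_sent (psnd w) && hasC (ex_minn (certified w)) (ent 0 (psnd w) 0 1).

Lemma cmpb_decides : cmpb decides.
Proof.
have H1 : cmpb (fun w => certifies (pfst w) (psnd w)).
  rewrite /certifies; apply: cmpb_or; first by apply/cmpb_not/cmpb_is_sent; cmp_tac.
  apply: cmpb_and; first by apply: (cmpb_okC HE); cmp_tac.
  by apply: cmpb_or; apply: cmpb_hasC; rewrite /ent; cmp_tac.
have H2 := cmp_min certified H1.
apply: cmpb_and; first by apply: cmpb_is_sent; cmp_tac.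
by apply: cmpb_hasC => //; rewrite /ent; cmp_tac.
Qed.

Lemma decidesP x k : decides (cpair x k) <-> goedel_set (Th (std0 (E x))) k.
Proof.
rewrite /decides; case: ex_minnP => y; rewrite /certifies !pairE => Hy _; split.
  move=> /andP[Hs Hh]; have [phi sphi Hphi] := proj1 (is_sentP _) Hs.
  exists phi => //; split=> //; apply: (proj2 (evF_holds (@E_lt x) sphi)).
  move: Hy; rewrite Hs /=; have [s Es] := list_of_code y; subst y.
  rewrite okC_code => /andP[Hok _]; rewrite hasC_code -Hphi in Hh; rewrite -Hphi in Hok.
  by have [_] := okL_sound Hok Hh; case=> /(_ erefl).
move=> [phi [sphi Hphi] Ek]; have Hs : is_sent k by apply/is_sentP; exists phi.
move: Hy; rewrite Hs /=; have [s Es] := list_of_code y; subst y.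
rewrite okC_code !hasC_code -Ek => /andP[Hok /orP[//|Hin]].
by have [_ []] := okL_sound Hok Hin => _ /(_ (proj1 (evF_holds (@E_lt x) sphi) Hphi)).
Qed.

End Decision.

(** * Specialised programs and the reduction *)

Fixpoint const_prog n : prog := if n is k.+1 then Comp Succ (const_prog k) else Zero.

Lemma run_const A n x y : run A (const_prog n) x y <-> y = n.
Proof.
elim: n y => [//|n IH] y /=; split=> [[z /IH -> ->//]|->].
by exists n => //; apply/IH.
Qed.

Lemma prog_code_inj : injective prog_code.
Proof.
elim=> [|||||p IHp q IHq|p IHp q IHq|p IHp q IHq|p IHp] [|||||p' q'|p' q'|p' q'|p'] //= /cpair_inj[] // _.
- by move=> /cpair_inj[/IHp -> /IHq ->].
- by move=> /cpair_inj[/IHp -> /IHq ->].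
- by move=> /cpair_inj[/IHp -> /IHq ->].
- by move=> /IHp ->.
Qed.

(** The parameter theorem: [x] is hard-wired as first component, [Pair Fst Snd] being the
    identity. *)
Definition specialize p x : prog := Comp p (Pair (const_prog x) (Pair Fst Snd)).

Lemma cmp_specialize p : cmp (fun x => prog_code (specialize p x)).
Proof.
have H : cmp (fun x => prog_code (const_prog x)).
  apply: (@cmp_ext (fun x => nrec (cpair 0 0) (fun _ z => cpair 6 (cpair (cpair 1 0) z)) x)).
    by elim=> //= n ->.
  by apply: cmp_nrec; cmp_tac.
by rewrite /=; cmp_tac.
Qed.

Lemma run_specialize A p x k y : run A (specialize p x) k y <-> run A p (cpair x k) y.
Proof.
rewrite /specialize /=; split=> [[z [u [v [/run_const -> [u' [v' [-> -> ->]]] ->]]]]|H].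
  by rewrite -/(pfst k) -/(psnd k) cpair_eta.
exists (cpair x k) => //; exists x, k; split=> //; first exact/run_const.
by exists (pfst k), (psnd k); split=> //; rewrite cpair_eta.
Qed.

(** A code determines its program and a program has at most one value at each argument, so an index
    belongs to at most one theory. The theory quantified in [three_mod] must then be the one
    attached to the tree. *)
Lemma index_of_unique (L : language) e (T T' : formula L -> Prop) : index_of e T -> index_of e T' -> forall phi, T phi -> T' phi.
Proof.
move=> H H' phi Tp; have [y [p Ep Hr] Hc] := H (goedel phi).
have [y' [p' Ep' Hr'] Hc'] := H' (goedel phi).
have Epp : p = p' by apply: prog_code_inj; rewrite Ep Ep'.
subst p'.
have Gs : goedel_set T (goedel phi) by exists phi.
have run_fun A : forall p x y y', run A p x y -> run A p x y' -> y = y'.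
  elim=> [|||||q IHq r IHr|q IHq r IHr|q IHq r IHr|q IHq] x z z' /=; try by move=> -> ->.
  - by move=> [[? ->]|[? ->]] [[? ->]|[? ->]].
  - by move=> [u [v [H1 H2 ->]]] [u' [v' [H1' H2' ->]]]; rewrite (IHq _ _ _ H1 H1') (IHr _ _ _ H2 H2').
  - by move=> [u H1 H2] [u' H1' H2']; have E0 := IHr _ _ _ H1 H1'; subst u'; apply: IHq H2 H2'.
  - elim: (Cantor.of_nat x).2 z z' => [|n IH] z z' /=; first exact: IHq.
    by move=> [u H1 H2] [u' H1' H2']; have E0 := IH _ _ H1 H1'; subst u'; apply: IHr H2 H2'.
  - move=> [H1 H2] [H1' H2']; case: (ltngtP z z') => // Hz.
      by have [k Hk] := H2' z Hz; have := IHq _ _ _ H1 Hk.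
    by have [k Hk] := H2 z' Hz; have := IHq _ _ _ H1' Hk.
have Ey := run_fun _ _ _ _ _ Hr Hr'; subst y'.
case: Hc => [[_ Hy]|[]//]; case: Hc' => [[[psi Tpsi /goedel_inj <-] _]//|[_ Hy']].
by rewrite Hy in Hy'.
Qed.

Lemma isomorphic_Th_eq (L : language) (T T' : formula L -> Prop) n : (forall phi, T phi <-> T' phi) ->
  has_exactly_countable_models T n -> has_exactly_countable_models T' n.
Proof.
move=> H [M [H1 H2 H3]]; exists M; split=> // [i|N CN MN].
  by have [? HM] := H1 i; split=> // phi /H; apply: HM.
by apply: H3 => // phi /H; apply: MN.
Qed.

Lemma three_mod_tree (E : rel nat) e : (forall m n, E m n -> m < n) ->
  index_of e (Th (std0 E)) ->
  three_mod L0 e <-> ~ exists F : nat -> nat, F 0 = 0 /\ forall i, E (F i) (F i.+1).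
Proof.
move=> E_lt He; split.
  move=> [T [_ H3 HT]] [F [F0 HF]]; apply: (not_three_models E_lt F0 HF).
  apply: isomorphic_Th_eq H3 => phi.
  by split=> H; [exact: (index_of_unique HT He H)|exact: (index_of_unique He HT H)].
(* A point that is not accessible has a successor that is not accessible; dependent choice yields an
   infinite path from 0. *)
move=> nF; have E_acc : Acc (fun n m => E m n) 0.
  apply: NNPP => nA; apply: nF.
  have step (x : {m | ~ Acc (fun n m => E m n) m}) : {y : {m | ~ Acc (fun n m => E m n) m} | E (sval x) (sval y)}.
    apply: constructive_indefinite_description; apply: NNPP => H; apply: (proj2_sig x).
    constructor=> y Hy; apply: NNPP => nAy; apply: H; by exists (exist _ y nAy).
  pose F := fix F n := if n is k.+1 then sval (step (F k)) else exist (fun m => ~ Acc (fun n m => E m n) m) 0 nA.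
  exists (fun n => sval (F n)); split=> // i; exact: (proj2_sig (step (F i))).
have H3 := three_models E_lt E_acc.
exists (Th (std0 E)); split=> //; split; first exact: Th_complete.
by exists 3.
Qed.

Theorem theorem9 :
  exists L : language,
    forall B : nat -> Prop, pi11 B -> turing_reducible B (three_mod L).
Proof.
exists L0 => B /pi11_tree[E [HE E_lt HB]].
have [p Hp] := cmpb_decides HE.
have [s Hs] := cmp_specialize p.
have Hidx x : index_of (prog_code (specialize p x)) (Th (std0 (E x))).
  move=> k; exists (decides E (cpair x k)); last first.
    have := decidesP E_lt x k; rewrite /char_fun; case: (decides _ _) => H; [left|right]; split=> //.
      exact/H.
    by move=> /H.
  by exists (specialize p x) => //; apply/run_specialize/Hp.
have HBx x : three_mod L0 (prog_code (specialize p x)) <-> B x.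
  by rewrite (three_mod_tree (E_lt x) (Hidx x)) HB.
(* A many-one reduction: the index of the theory attached to [x] is computed and submitted to the
   oracle once. *)
exists (prog_code (Comp Oracle s)) => x y; split.
  by move=> [r /prog_code_inj -> /= [z /Hs ->]]; rewrite /char_fun HBx.
move=> H; exists (Comp Oracle s) => //=; exists (prog_code (specialize p x)); first exact/Hs.
by rewrite /char_fun HBx.
Qed.
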